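(* Let $\ell\geq 5$ be an integer. Every finite simple graph $G$ with girth $g(G)=2\ell+1$ that has no odd hole of length at least $2\ell+3$ is $3$-colorable.
   Context: Graphs are finite, simple and undirected. The girth $g(G)$ is the minimum length of a cycle of $G$. A hole is an induced cycle of length at least four; an odd hole is a hole of odd length. A graph is $3$-colorable if its vertices can be assigned at most $3$ colors so that adjacent vertices receive different colors. For $\ell\geq 2$, $\mathcal{G}_\ell$ denotes the family of graphs with girth $2\ell+1$ and no odd holes of length at least $2\ell+3$; the theorem says every graph in $\bigcup_{\ell\geq5}\mathcal{G}_\ell$ is $3$-colorable. *)

(* Defs.v *)
From mathcomp Require Import all_boot.

Set Implicit Arguments.
Unset Strict Implicit.
Unset Printing Implicit Defensive.

(* A finite simple graph is a symmetric irreflexive relation e on a finType.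
   A cycle is listed as the sequence of its distinct vertices, so its length
   is the size of the sequence. The bound on the size is needed because ucycle
   alone also holds of the empty sequence and of the two ends of an edge. *)
Definition graph_cycle (T : finType) (e : rel T) (c : seq T) : Prop :=
  2 < size c /\ ucycle e c.

(* Stated as a predicate because an acyclic graph has no finite girth. *)
Definition has_girth (T : finType) (e : rel T) (g : nat) : Prop :=
  (exists2 c : seq T, graph_cycle e c & size c = g) /\
  (forall c : seq T, graph_cycle e c -> g <= size c).

Definition induced_cycle (T : finType) (e : rel T) (c : seq T) : Prop :=
  graph_cycle e c /\
  {in c &, forall x y : T, e x y -> y = next c x \/ x = next c y}.

Definition hole (T : finType) (e : rel T) (c : seq T) : Prop :=
  induced_cycle e c /\ 4 <= size c.

Definition odd_hole (T : finType) (e : rel T) (c : seq T) : Prop :=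
  hole e c /\ odd (size c).

Definition colorable (T : finType) (e : rel T) (k : nat) : Prop :=
  exists f : T -> 'I_k, forall x y : T, e x y -> f x != f y.

(* Main.v *)
(* Let n = 2l+1, so that every cycle has length at least n and every odd hole length n, and
   let G be a counterexample all of whose proper induced subgraphs are 3-colourable. Then G
   has no star cutset and is not bipartite, so it contains a hole C of length n.
   A jump of C is an induced path outside C joining two nonadjacent vertices of C and
   otherwise anticomplete to C. Together with the two arcs of C it closes an even and an odd
   cycle, which forces it to have exactly n-d-1 vertices when its ends are at distance d.
   (1) Among any three consecutive vertices of C one is the end of a jump: otherwise the
   absence of star cutsets provides five holes whose parities are incompatible.
   (2) If a connected set of vertices without neighbours on C touches three vertices having
   pairwise nonadjacent neighbours on C, then C and that set contain a subdivision of K4 with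
   opposite edges subdivided equally often and all branches of length at most l.
   (3) No such K4 exists: a jump given by (1) from the longest branch either attaches to the
   rest of the K4, or avoids it, and each time some odd cycle has the wrong length.
   (4) Take a jump R of C whose ends 0 and d are as far apart as possible, and a jump R' given
   by (1) from a vertex f of the long arc; l >= 5 leaves room for f. Where R' meets R, the
   union contains a configuration (2), a cycle shorter than n or an odd hole longer than n;
   if R' avoids R, going round R, R' and two arcs of C gives an odd hole longer than n. *)
Require Import Defs.
From mathcomp Require Import all_boot.
From mathcomp Require Import perm zify.

Set Implicit Arguments.
Unset Strict Implicit.
Unset Printing Implicit Defensive.

(** Colouring enters only through consequences of criticality: no star cutset, minimum degree at
    least 3, and not being bipartite. The rest compares lengths of induced cycles: each is at least
    n, and an odd one is exactly n. As n is odd, replacing one arc of a hole by the other changes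
    the parity of a cycle; the odd cycle of such a pair gives an equation and the even one an
    inequality. By girth, a vertex off a hole has at most one neighbour on it, and two adjacent
    vertices off the hole cannot both have one. A vertex off the hole is therefore labelled by its
    only neighbour there, or unlabelled, and jumps arise from induced paths through unlabelled
    vertices between labelled ones. The bound on l is felt twice. In (3) the longest branch has
    length at least n/3, hence at least 4, so it has three consecutive interior vertices. In (4) the
    candidates d+2, d+3, d+4 for f must not exceed n-2; for d = l this reads l+4 <= 2l-1. *)

Section CriticalGraph.
Variables (T : finType) (e : rel T) (l : nat).
Hypotheses (e_sym : symmetric e) (e_irr : irreflexive e) (l_ge : 5 <= l).
Hypothesis girth_ge : forall s, graph_cycle e s -> 2 * l + 1 <= size s.
Hypothesis odd_size : forall s, induced_cycle e s -> odd (size s) -> size s = 2 * l + 1.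
Hypothesis not3 : ~ colorable e 3.
Hypothesis crit : forall A : {set T}, A != setT ->
  exists f : T -> 'I_3, {in A &, forall x y, e x y -> f x != f y}.

(** * Induced paths as lists *)

Definition far (x y : T) := (x != y) && ~~ e x y.

(** Anticomplete segments. Since [far] includes distinctness, they are disjoint as well. *)
Definition ac (s t : seq T) := allrel far s t.

(** Induced paths. Each vertex is compared only with later ones, so the condition splits along
    concatenations into smaller paths and [ac] facts. *)
Fixpoint ip (s : seq T) :=
  if s is x :: s1 then
    (if s1 is y :: s2 then [&& e x y, all (far x) s2 & ip s1] else true)
  else true.

Arguments ip : simpl never.

Lemma ip1 x : ip [:: x]. Proof. by []. Qed.
Lemma ip2 x y : ip [:: x; y] = e x y.
Proof. by rewrite /ip /= !andbT. Qed.

Lemma far_sym x y : far x y = far y x.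
Proof. by rewrite /far eq_sym e_sym. Qed.

Lemma ac_sym s t : ac s t = ac t s.
Proof.
rewrite /ac allrelC; apply: eq_allrel => // x y; exact: far_sym.
Qed.

Lemma acP s t : reflect {in s & t, forall x y, far x y} (ac s t).
Proof. exact: allrelP. Qed.

Lemma ac_sub s t s' t' : ac s t -> {subset s' <= s} -> {subset t' <= t} -> ac s' t'.
Proof. by move=> /acP h hs ht; apply/acP => x y /hs hx /ht hy; apply: h. Qed.

Lemma ac_catl s1 s2 t : ac (s1 ++ s2) t = ac s1 t && ac s2 t.
Proof. exact: allrel_catl. Qed.
Lemma ac_catr s t1 t2 : ac s (t1 ++ t2) = ac s t1 && ac s t2.
Proof. exact: allrel_catr. Qed.
Lemma ac_consl x s t : ac (x :: s) t = ac [:: x] t && ac s t.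
Proof. by rewrite -cat1s ac_catl. Qed.
Lemma ac_consr x s t : ac s (x :: t) = ac s [:: x] && ac s t.
Proof. by rewrite -cat1s ac_catr. Qed.
Lemma ac_revl s t : ac (rev s) t = ac s t.
Proof. by apply/acP/acP => h x y hx; apply: h; rewrite ?mem_rev // -mem_rev. Qed.
Lemma ac_revr s t : ac s (rev t) = ac s t.
Proof. by rewrite ac_sym ac_revl ac_sym. Qed.
Lemma ac0l t : ac [::] t. Proof. by []. Qed.
Lemma ac0r s : ac s [::]. Proof. by rewrite ac_sym. Qed.
Lemma ac11 x y : ac [:: x] [:: y] = far x y.
Proof. by rewrite /ac /allrel /= !andbT. Qed.
Lemma ac1l x t : ac [:: x] t = all (far x) t.
Proof. by rewrite /ac /allrel /= !andbT. Qed.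

Lemma ac_notin s t x : ac s t -> x \in s -> x \notin t.
Proof. by move=> /acP h hx; apply/negP => /(h x x hx); rewrite /far eqxx. Qed.

Lemma ac_nedge s t x y : ac s t -> x \in s -> y \in t -> e x y = false.
Proof. by move=> /acP h hx hy; case/andP: (h x y hx hy) => _ /negbTE. Qed.

Lemma ip_cons2 x y s : ip [:: x, y & s] = [&& e x y, ac [:: x] s & ip (y :: s)].
Proof. by rewrite ac1l. Qed.

(* Gluing at a vertex avoids case distinctions on empty segments. *)
Lemma ip_glueE s1 x s2 :
  ip (s1 ++ x :: s2) = [&& ip (s1 ++ [:: x]), ip (x :: s2) & ac s1 s2].
Proof.
elim: s1 => [|y s1 IH]; first by rewrite ac0l andbT.
case: s1 IH => [|z s1] IH.
  rewrite !cat_cons !cat0s !ip_cons2 ac0r /=.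
  by case: (e y x) => //=; rewrite andbC.
have E t : ((y :: z :: s1) ++ t) = y :: z :: (s1 ++ t) by [].
rewrite !E !ip_cons2 -[z :: s1 ++ x :: s2]/((z :: s1) ++ x :: s2) IH.
rewrite [ac (y :: _) s2]ac_consl !ac_catr [ac _ (x :: s2)]ac_consr.
move: (ip _) (ip (x :: _)) (ac (z :: _) _) => A B C.
by case: (e y z) A B C (ac _ s1) (ac _ [:: x]) (ac _ s2) => -[] [] [] [] [] [].
Qed.

Lemma ip_glue s1 x s2 :
  ip (s1 ++ [:: x]) -> ip (x :: s2) -> ac s1 s2 -> ip (s1 ++ x :: s2).
Proof. by move=> h1 h2 h3; rewrite ip_glueE h1 h2. Qed.

Lemma ip_rev s : ip (rev s) = ip s.
Proof.
suff H t : ip t -> ip (rev t) by apply/idP/idP => [/H|/H //]; rewrite revK.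
elim: t => [//|x [//|y t] IH]; rewrite ip_cons2 => /and3P[exy hx /IH].
rewrite !rev_cons -!cats1 -catA /= => h; apply: ip_glue => //=; first by rewrite ip2 e_sym.
by rewrite ac_revl ac_sym.
Qed.

Lemma ip_catl s t : ip (s ++ t) -> ip s.
Proof.
elim: s => [//|x [//|y s] IH]; rewrite !cat_cons !ip_cons2 ac_catr.
by move=> /and3P[-> /andP[-> _] /IH].
Qed.

Lemma ip_catr s t : ip (s ++ t) -> ip t.
Proof. by move=> h; rewrite -ip_rev; apply: (@ip_catl _ (rev s)); rewrite -rev_cat ip_rev. Qed.

Lemma ip_path x s : ip (x :: s) -> path e x s.
Proof.
elim: s x => [//|y s IH] x; rewrite ip_cons2 => /and3P[exy _ /IH h].
by rewrite /= exy.
Qed.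

Lemma ip_uniq s : ip s -> uniq s.
Proof.
elim: s => [//|x [//|y s] IH]; rewrite ip_cons2 => /and3P[exy hx /IH h].
rewrite cons_uniq h andbT inE negb_or; apply/andP; split.
  by apply/eqP => E; rewrite E e_irr in exy.
by apply: (ac_notin hx); rewrite mem_head.
Qed.

Lemma ip_adj s u v : ip s -> u \in s -> v \in s -> e u v ->
  exists s1 s2, s = s1 ++ [:: u, v & s2] \/ s = s1 ++ [:: v, u & s2].
Proof.
elim: s => [//|x s IH] h.
have hs : ip s by apply: (@ip_catr [:: x]).
rewrite !inE => /predU1P[-> | us] /predU1P[-> | vs] euv.
- by rewrite e_irr in euv.
- case: s h vs {IH hs} => [//|y s]; rewrite ip_cons2 => /and3P[exy hx _].
  rewrite inE => /predU1P[-> | vs]; first by exists [::], s; left.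
  by rewrite (ac_nedge hx (mem_head _ _) vs) in euv.
- case: s h us {IH hs} => [//|y s]; rewrite ip_cons2 => /and3P[exy hx _].
  rewrite inE => /predU1P[-> | us]; first by exists [::], s; right.
  by rewrite e_sym (ac_nedge hx (mem_head _ _) us) in euv.
- by have [s1 [s2 [-> | ->]]] := IH hs us vs euv; exists (x :: s1), s2; [left|right].
Qed.

Lemma next_consecutive (s1 s2 : seq T) (u v : T) :
  uniq (s1 ++ [:: u, v & s2]) -> next (s1 ++ [:: u, v & s2]) u = v.
Proof.
move=> h; rewrite -(next_rot (size s1) h) rot_size_cat.
by rewrite /= eqxx.
Qed.

(** Since the interiors are anticomplete, an edge between two vertices of the cycle lies within one
    of the two paths, where it joins consecutive vertices. The hypothesis [0 < size S1] makes [x]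
    and [y] nonadjacent, which forces [S2] to be nonempty as well. *)
Lemma induced_cycle2 (x : T) (S1 : seq T) (y : T) (S2 : seq T) :
  0 < size S1 -> ip (x :: S1 ++ [:: y]) -> ip (y :: S2 ++ [:: x]) -> ac S1 S2 ->
  induced_cycle e (x :: S1 ++ y :: S2).
Proof.
move=> n1 h1 h2 h12.
have U : uniq (x :: S1 ++ y :: S2).
  have := ip_uniq h1; have := ip_uniq h2.
  rewrite !cons_uniq !cat_uniq !mem_cat /= !inE !negb_or !andbT.
  move=> /and3P[/andP[yS2 yx] uS2 xS2] /and3P[/andP[xS1 xy] uS1 yS1].
  rewrite xS1 xy xS2 uS1 yS1 yS2 uS2 /= andbT.
  by apply/hasPn => z z2; rewrite ac_sym in h12; exact: ac_notin h12 z2.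
have C : cycle e (x :: S1 ++ y :: S2).
  have := ip_path h1; have := ip_path h2.
  rewrite !cat_path /= !andbT => /andP[p2 l2] /andP[p1 l1].
  by rewrite rcons_cat /= cat_path /= rcons_path p1 l1 p2 l2.
split; first split.
- by rewrite /= size_cat /=; lia.
- by rewrite /ucycle C U.
have P1 u v : u \in x :: S1 ++ [:: y] -> v \in x :: S1 ++ [:: y] -> e u v ->
    v = next (x :: S1 ++ y :: S2) u \/ u = next (x :: S1 ++ y :: S2) v.
  move=> hu hv euv; have [s1 [s2 E]] := ip_adj h1 hu hv euv.
  have E0 : x :: S1 ++ y :: S2 = (x :: S1 ++ [:: y]) ++ S2 by rewrite /= -catA.
  rewrite E0 in U *; case: E U => ->; rewrite -catA /= => U.
    by left; rewrite next_consecutive.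
  by right; rewrite next_consecutive.
have P2 u v : u \in y :: S2 ++ [:: x] -> v \in y :: S2 ++ [:: x] -> e u v ->
    v = next (x :: S1 ++ y :: S2) u \/ u = next (x :: S1 ++ y :: S2) v.
  move=> hu hv euv; have [s1 [s2 E]] := ip_adj h2 hu hv euv.
  (* Rotating the cycle so that it starts at [y] makes the second path a prefix. *)
  have E0 : rot (size (x :: S1)) (x :: S1 ++ y :: S2) = (y :: S2 ++ [:: x]) ++ S1.
    by rewrite -cat_cons rot_size_cat /= -catA.
  rewrite -!(next_rot (size (x :: S1)) U) E0; move: U; rewrite -(rot_uniq (size (x :: S1))) E0.
  case: E => ->; rewrite -catA /= => U.
    by left; rewrite next_consecutive.
  by right; rewrite next_consecutive.
have split_mem u : u \in x :: S1 ++ y :: S2 ->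
    [\/ u \in x :: S1 ++ [:: y] /\ u \in y :: S2 ++ [:: x], u \in S1 | u \in S2].
  rewrite !(inE, mem_cat); case: (u == x); first by rewrite !orbT; constructor 1.
  by case: (u == y); rewrite ?orbT; [constructor 1 | rewrite !orbF /= => /orP[]; [constructor 2|constructor 3]].
have s1 u : u \in S1 -> u \in x :: S1 ++ [:: y] by move=> h; rewrite !(inE, mem_cat) h orbT.
have s2 u : u \in S2 -> u \in y :: S2 ++ [:: x] by move=> h; rewrite !(inE, mem_cat) h orbT.
move=> u v /split_mem hu /split_mem hv euv.
case: hu => [[u1 u2]|u1|u2]; case: hv => [[v1 v2]|v1|v2].
- exact: P1.
- by apply: P1; auto.
- by apply: P2; auto.
- by apply: P1; auto.
- by apply: P1; auto.
- by rewrite (ac_nedge h12 u1 v2) in euv.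
- by apply: P2; auto.
- by rewrite e_sym (ac_nedge h12 v1 u2) in euv.
- by apply: P2; auto.
Qed.

(** The form in which both hypotheses on cycles are used later: the sizes count the interiors, and
    the [2] counts [x] and [y]. *)
Lemma girth2 (x : T) (S1 : seq T) (y : T) (S2 : seq T) :
  0 < size S1 -> ip (x :: S1 ++ [:: y]) -> ip (y :: S2 ++ [:: x]) -> ac S1 S2 ->
  2 * l + 1 <= size S1 + size S2 + 2 /\
  (odd (size S1 + size S2) -> size S1 + size S2 + 2 = 2 * l + 1).
Proof.
move=> n1 h1 h2 h12; have h := induced_cycle2 n1 h1 h2 h12.
have E : size (x :: S1 ++ y :: S2) = size S1 + size S2 + 2 by rewrite /= size_cat /=; lia.
split; first by rewrite -E; apply: girth_ge h.1.
by move=> o; rewrite -E; apply: odd_size => //; rewrite E; lia.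
Qed.

(** For cycles that need not be induced; the [2] counts [z] and [p]. *)
Lemma girth_close (z : T) (s : seq T) (p : T) :
  path e z s -> uniq (z :: s) -> p \notin z :: s -> 0 < size s -> e p z -> e p (last z s) ->
  2 * l + 1 <= size s + 2.
Proof.
move=> hp hu np s0 pz ps; suff : 2 * l + 1 <= size [:: p, z & s] by rewrite /=; lia.
apply: girth_ge; split; first by rewrite /=; lia.
by rewrite /ucycle (cons_uniq p) np hu andbT /= pz rcons_path hp e_sym ps.
Qed.

Lemma split_first (p : pred T) s : has p s ->
  exists s1 x s2, [/\ s = s1 ++ x :: s2, p x & ~~ has p s1].
Proof.
elim: s => //= x s IH; have [px _|npx /= /IH[s1 [y [s2 [-> py ns]]]]] := boolP (p x).
  by exists [::], x, s.
by exists (x :: s1), y, s2; split=> //=; rewrite negb_or npx.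
Qed.

Lemma split_last (p : pred T) s : has p s ->
  exists s1 x s2, [/\ s = s1 ++ x :: s2, p x & ~~ has p s2].
Proof.
rewrite -has_rev => /split_first[s1 [x [s2 [E px ns]]]].
exists (rev s2), x, (rev s1); split; rewrite ?has_rev //.
by rewrite -(revK s) E rev_cat rev_cons cat_rcons.
Qed.

(** Make the tail induced first, then enter it from [x] at the last neighbour of [x]; if the tail
    passes through [x] itself, start there. *)
Lemma ip_shortest x s y : path e x (rcons s y) -> x != y ->
  exists s', ip (x :: s' ++ [:: y]) /\ {subset s' <= s}.
Proof.
elim: s x => [|z s IH] x; first by rewrite /= andbT => exy; exists [::]; split=> //; rewrite ip2.
rewrite rcons_cons /= => /andP[exz hp] xy.
have [E|zy] := eqVneq z y.
  by exists [::]; split=> //; rewrite -E ip2.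
have [s' [hs' sub]] := IH z hp zy.
have subs w : w \in z :: s' -> w \in z :: s.
  by rewrite !inE => /predU1P[->|/sub ->]; rewrite ?eqxx ?orbT.
have [xs|xs] := boolP (x \in z :: s').
  have /split_first[s1 [x' [s2 [E /eqP xx _]]]] : has (pred1 x) (z :: s').
    by rewrite has_pred1.
  move: hs' subs; rewrite -cat_cons E xx -catA cat_cons => /ip_catr h subs.
  by exists s2; split=> // w ws; apply: subs; rewrite mem_cat inE ws !orbT.
have /split_last[s1 [w [s2 [E ew]]]] : has (e x) (z :: s' ++ [:: y]) by rewrite /= exz.
move=> /hasPn ns2.
have hw : ip (w :: s2) by move: hs'; rewrite E => /ip_catr.
have hx : ac [:: x] s2.
  apply/acP => x' u; rewrite inE => /eqP-> us; rewrite /far ns2 // andbT.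
  have : u \in z :: s' ++ [:: y] by rewrite E mem_cat inE us !orbT.
  rewrite -cat_cons mem_cat mem_seq1 => /orP[uz|/eqP-> //].
  by apply: contraNneq xs => ->.
case/lastP: s2 E hw hx {ns2} => [|s2 y'] E hw hx.
  exists [::]; split=> //; rewrite ip2.
  by move: E; rewrite -[z :: _]/((z :: s') ++ [:: y]) !cats1 => /rcons_inj[_ ->].
move: E; rewrite -[z :: _]/((z :: s') ++ [:: y]) cats1 -rcons_cons -rcons_cat => /rcons_inj[E Ey].
exists (w :: s2); split.
  by rewrite cats1 Ey -[x :: _]/[:: x, w & rcons s2 y'] ip_cons2 ew hx.
by move=> u us; apply: subs; rewrite E mem_cat us orbT.
Qed.

(** * Holes as n-periodic sequences *)

Local Notation n := (2 * l + 1).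

(** A hole of length n as an n-periodic sequence: any n consecutive indices serve as coordinates, so
    arcs never have to be split where the numbering wraps. The alternative [j.+1 == i + n] is the
    closing edge of such a window. *)
Definition is_hole (c : nat -> T) :=
  (forall i, c (i + n) = c i) /\
  (forall i j, i < j < i + n ->
     c i != c j /\ e (c i) (c j) = (j == i.+1) || (j.+1 == i + n)).

Definition arc (c : nat -> T) i m := [seq c j | j <- iota i m].

Lemma size_arc c i m : size (arc c i m) = m.
Proof. by rewrite size_map size_iota. Qed.

Lemma arcS c i m : arc c i m.+1 = c i :: arc c i.+1 m.
Proof. by []. Qed.

Lemma arc_cat c i m1 m2 : arc c i (m1 + m2) = arc c i m1 ++ arc c (i + m1) m2.
Proof. by rewrite /arc iotaD map_cat. Qed.

Lemma arcSr c i m : arc c i m.+1 = arc c i m ++ [:: c (i + m)].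
Proof. by rewrite -addn1 arc_cat. Qed.

Lemma mem_arcP c i m x : reflect (exists2 j, i <= j < i + m & x = c j) (x \in arc c i m).
Proof.
by apply: (iffP mapP) => -[j h E]; exists j => //; rewrite mem_iota in h *.
Qed.

Lemma window_ind (Q : nat -> nat -> Prop) :
  (forall i j, Q i j -> Q (i + n) (j + n)) ->
  (forall i j, i < n -> i < j < i + n -> Q i j) ->
  forall i j, i < j < i + n -> Q i j.
Proof.
move=> hs h0 i; have [k] := ubnP i; elim: k i => // k IH i ik j hj.
have [i_n|n_i] := ltnP i n; first exact: h0.
have -> : i = (i - n) + n by lia.
have -> : j = (j - n) + n by lia.
by apply/hs/IH; lia.
Qed.

Section Hole.
Variable c : nat -> T.
Hypothesis Hc : is_hole c.

Lemma hole_per i : c (i + n) = c i.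
Proof. exact: Hc.1. Qed.

Lemma hole_neq i j : i < j < i + n -> c i != c j.
Proof. by move=> h; have [] := Hc.2 i j h. Qed.

Lemma hole_adj i j : i < j < i + n -> e (c i) (c j) = (j == i.+1) || (j.+1 == i + n).
Proof. by move=> h; have [] := Hc.2 i j h. Qed.

Lemma hole_far i j : i.+1 < j -> j.+1 < i + n -> far (c i) (c j).
Proof. by move=> h1 h2; rewrite /far hole_neq ?hole_adj; lia. Qed.

Lemma ip_arc i m : m < n -> ip (arc c i m).
Proof.
elim: m i => // -[|m] IH i mn //.
rewrite !arcS ip_cons2 hole_adj ?eqxx; last by lia.
rewrite -arcS IH ?andbT; last by lia.
apply/acP => x y; rewrite inE => /eqP-> /mem_arcP[j hj ->].
by apply: hole_far; lia.
Qed.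

Lemma ac_arc i m j k : i + m < j -> j + k < i + n -> ac (arc c i m) (arc c j k).
Proof.
move=> h1 h2; apply/acP => x y /mem_arcP[p hp ->] /mem_arcP[q hq ->].
by apply: hole_far; lia.
Qed.

Lemma on_hole i : c i \in arc c 0 n.
Proof.
have [k] := ubnP i; elim: k i => // k IH i ik.
have [i_n|n_i] := ltnP i n; first by apply/mem_arcP; exists i => //; lia.
have -> : i = (i - n) + n by lia.
by rewrite hole_per; apply: IH; lia.
Qed.

(** Lets the coordinates of a vertex be chosen relative to any starting index. *)
Lemma hole_idx i x : x \in arc c 0 n -> exists2 j, i <= j < i + n & x = c j.
Proof.
move/mem_arcP=> [j0 hj0 ->] {x}.
elim: i => [|i [j hj E]]; first by exists j0.
have [ij|ij] := ltnP i j; first by exists j => //; lia.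
by exists (j + n); rewrite ?hole_per //; lia.
Qed.

(** The value would flip n times during one turn, and n is odd. *)
Lemma hole_odd (f : T -> bool) : (forall i, f (c i) != f (c i.+1)) -> False.
Proof.
move=> h; have H i : f (c i) = odd i (+) f (c 0).
  elim: i => [|i IH] //=; have := h i; rewrite IH.
  by case: (odd i); case: (f (c 0)); case: (f (c i.+1)).
have := H n; rewrite -[n in c n]add0n hole_per.
by rewrite oddD oddM; case: (f (c 0)).
Qed.

Lemma hole_shift k : is_hole (fun i => c (i + k)).
Proof.
split=> [i|i j hij]; first by rewrite addnAC hole_per.
have h : i + k < j + k < i + k + n by lia.
rewrite hole_neq ?hole_adj //; split=> //; congr (_ || _); lia.
Qed.

Lemma mem_shift k x : (x \in arc (fun i => c (i + k)) 0 n) = (x \in arc c 0 n).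
Proof.
apply/idP/idP => [/mem_arcP[j _ ->]|/(hole_idx k)[j hj ->]]; first exact: on_hole.
by apply/mem_arcP; exists (j - k); [lia | rewrite subnK //; lia].
Qed.

(** Reducing [i] modulo n before subtracting keeps the truncated subtraction periodic. *)
Lemma hole_reflect : is_hole (fun i => c (n - i %% n)).
Proof.
split=> [i|]; first by rewrite modnDr.
pose Q i j := c (n - i %% n) != c (n - j %% n) /\
  e (c (n - i %% n)) (c (n - j %% n)) = (j == i.+1) || (j.+1 == i + n).
apply: (window_ind (Q := Q)) => [i j [h1 h2]|i j i_n hij].
  by rewrite /Q !modnDr h1 h2; split=> //; congr (_ || _); lia.
rewrite /Q (modn_small i_n).
have [j_n|n_j] := ltnP j n.
  rewrite (modn_small j_n) eq_sym e_sym hole_neq ?hole_adj; lia.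
have -> : j %% n = j - n.
  by rewrite -[j in LHS](@subnK n) // modnDr modn_small; lia.
by rewrite hole_neq ?hole_adj; lia.
Qed.

Lemma mem_reflect x : (x \in arc (fun i => c (n - i %% n)) 0 n) = (x \in arc c 0 n).
Proof.
apply/idP/idP => [/mem_arcP[j _ ->]|/(hole_idx 1)[j hj ->]]; first exact: on_hole.
apply/mem_arcP; exists (n - j); first by lia.
by rewrite modn_small; [congr c | ]; lia.
Qed.

Lemma outside_arc x i m : x \notin arc c 0 n -> x \notin arc c i m.
Proof. by apply: contra => /mem_arcP[j _ ->]; exact: on_hole. Qed.

(** The cycle formed with the arc from [c i] to [c (i + k)] has k + 2 or k + 3 vertices, at most l +
    3 and hence fewer than n. The case [x == y] is one outside vertex with two neighbours on the
    hole, the other case an edge between two outside vertices with neighbours on it. *)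
Lemma hole_close x y i k : k <= l -> x \notin arc c 0 n -> y \notin arc c 0 n ->
  e x (c (i + k)) -> (if x == y then e x (c i) && (0 < k) else e x y && e y (c i)) -> False.
Proof.
have := l_ge => l5 kl xC yC ex.
have U : uniq (arc c i k.+1) by apply: ip_uniq; apply: ip_arc; lia.
have P : path e (c i) (arc c i.+1 k) by apply: ip_path; rewrite -arcS; apply: ip_arc; lia.
have L : last (c i) (arc c i.+1 k) = c (i + k).
  case: k {kl ex U P} => [|k]; first by rewrite addn0.
  by rewrite arcSr last_cat /=; congr c; lia.
case: eqP => [_ /andP[exi k0]|/eqP xy /andP[exy eyi]].
  have := @girth_close (c i) (arc c i.+1 k) x P; rewrite -arcS U size_arc L outside_arc //.
  by move=> /(_ isT isT k0 exi ex); lia.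
have Py : path e y (arc c i k.+1) by rewrite arcS /= eyi.
have Uy : uniq (y :: arc c i k.+1) by rewrite cons_uniq outside_arc.
have xy' : x \notin y :: arc c i k.+1 by rewrite inE negb_or xy outside_arc.
have Ly : last y (arc c i k.+1) = c (i + k) by rewrite arcS.
have := girth_close Py Uy xy'; rewrite size_arc Ly => /(_ isT exy ex); lia.
Qed.
End Hole.

(** * Labels of the vertices off a hole *)

Definition unlabelled c x := (x \notin arc c 0 n) && ~~ has (e x) (arc c 0 n).
(** The label is an index, hence determined only up to the period; [lab_inj] therefore compares
    [c i] with [c j] and not [i] with [j]. *)
Definition lab c i x := (x \notin arc c 0 n) && e x (c i).

Section Labels.
Variable c : nat -> T.
Hypothesis Hc : is_hole c.

Lemma lab_inj i j x : lab c i x -> lab c j x -> c i = c j.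
Proof.
move=> /andP[xC ei] /andP[_ ej].
have [k hk E] := hole_idx Hc i (on_hole Hc j).
have [ik|ik] := eqVneq i k; first by rewrite E ik.
(* One of the two arcs between the feet has length at most l, and [hole_close] is applied to it. *)
case: (leqP (k - i) l) => h.
  case: (@hole_close c Hc x x i (k - i)) => //; first by rewrite subnKC -?E //; lia.
  by rewrite eqxx ei; lia.
case: (@hole_close c Hc x x k (i + n - k)) => //; first by lia.
  by rewrite subnKC ?hole_per //; lia.
by rewrite eqxx -E ej; lia.
Qed.

Lemma lab_nadj i j x y : lab c i x -> lab c j y -> e x y = false.
Proof.
move=> /andP[xC ei] /andP[yC ej]; apply/negbTE/negP => exy.
have xy : x != y by apply: contraTneq exy => ->; rewrite e_irr.
have [k hk E] := hole_idx Hc j (on_hole Hc i).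
case: (leqP (k - j) l) => h.
  apply: (@hole_close c Hc x y j (k - j)) => //; first by rewrite subnKC -?E //; lia.
  by rewrite (negbTE xy) exy.
apply: (@hole_close c Hc y x k (j + n - k)) => //; first by lia.
  by rewrite subnKC ?hole_per //; lia.
by rewrite eq_sym (negbTE xy) e_sym exy -E.
Qed.

Lemma lab_far i j x y : lab c i x -> lab c j y -> c i != c j -> far x y.
Proof.
move=> hx hy ij; rewrite /far (lab_nadj hx hy) andbT.
by apply: contraNneq ij => E; rewrite -E in hy; rewrite (lab_inj hx hy).
Qed.

Lemma lab_arc x i j m : lab c j x -> c j \notin arc c i m -> ac [:: x] (arc c i m).
Proof.
move=> hx hj; apply/acP => x' y; rewrite inE => /eqP-> hy.
have [p hp Ep] := mem_arcP _ _ _ _ hy; rewrite /far; apply/andP; split.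
  by have /andP[xC _] := hx; apply: contraNneq xC => ->; rewrite Ep; apply: on_hole.
apply: contra hj => exy; have hx' : lab c p x by rewrite /lab -Ep exy (andP hx).1.
by rewrite (lab_inj hx hx') -Ep.
Qed.

Lemma unl_arc x i m : unlabelled c x -> ac [:: x] (arc c i m).
Proof.
move=> /andP[xC /hasPn h]; apply/acP => x' y; rewrite inE => /eqP-> /mem_arcP[p _ ->].
rewrite /far h ?andbT; last exact: on_hole.
by apply: contraNneq xC => ->; apply: on_hole.
Qed.

Lemma notin_arc j i m : i + m <= j < i + n -> c j \notin arc c i m.
Proof.
by move=> h; apply/mem_arcP => -[p hp E]; have := @hole_neq c Hc p j; rewrite E eqxx => /(_ ltac:(lia)).
Qed.
End Labels.

(** The index is reduced modulo the length of [s], so the default [x0] is never returned. *)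
Lemma hole_of_cycle s x0 : induced_cycle e s -> size s = 2 * l + 1 ->
  is_hole (fun i => nth x0 s (i %% (2 * l + 1))).
Proof.
move=> [[s2 /andP[cs us]] ch] sn; split=> [i|]; first by rewrite modnDr.
pose c i := nth x0 s (i %% (2 * l + 1)).
have modS i : i < 2 * l + 1 -> i.+1 %% (2 * l + 1) = if i.+1 == 2 * l + 1 then 0 else i.+1.
  by move=> h; case: eqP => [->|h']; [rewrite modnn | rewrite modn_small; lia].
have nx i : i < 2 * l + 1 -> next s (nth x0 s i) = nth x0 s (i.+1 %% (2 * l + 1)).
  move=> hi; rewrite modS // next_nth mem_nth ?sn //.
  rewrite index_uniq ?sn //; case: (s) sn => [|y p] sn; first by rewrite /= in sn; lia.
  case: eqP => [h|h] /=; last by apply: set_nth_default; rewrite /= in sn; lia.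
  by rewrite nth_default //; rewrite /= in sn; lia.
pose Q i j := c i != c j /\ e (c i) (c j) = (j == i.+1) || (j.+1 == i + (2 * l + 1)).
apply: (window_ind (Q := Q)) => [i j [h1 h2]|i j i_n hij].
  by rewrite /Q /c !modnDr h1 h2; split=> //; congr (_ || _); lia.
have [k [kn Ej hk]] : exists k, [/\ k < 2 * l + 1, c j = nth x0 s k &
    (k == j) || (k + (2 * l + 1) == j)].
  have [jn|nj] := ltnP j (2 * l + 1).
    by exists j; rewrite /c modn_small // eqxx.
  exists (j - (2 * l + 1)); split; [lia| |lia].
  by rewrite /c -[j in LHS](@subnK (2 * l + 1)) // modnDr modn_small //; lia.
rewrite /Q Ej /c modn_small // nth_uniq ?sn //; split; first lia.
have := modS _ i_n; have := modS _ kn; move=> Ek Ei.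
apply/idP/idP.
  move=> /(ch _ _ (mem_nth _ _) (mem_nth _ _)); rewrite sn => /(_ i_n kn).
  rewrite !nx // => -[]/eqP; rewrite nth_uniq ?sn ?ltn_pmod //; try lia.
    by rewrite Ei => /eqP; case: eqP; lia.
  by rewrite Ek => /eqP; case: eqP; lia.
have step m : m < 2 * l + 1 -> e (nth x0 s m) (nth x0 s (m.+1 %% (2 * l + 1))).
  by move=> hm; rewrite -nx //; apply: next_cycle => //; rewrite mem_nth ?sn.
case/orP => /eqP h.
  have -> : k = i.+1 %% (2 * l + 1) by rewrite Ei; case: eqP; lia.
  exact: step.
rewrite e_sym; have -> : i = k.+1 %% (2 * l + 1) by rewrite Ek; case: eqP; lia.
exact: step.
Qed.

Lemma arc_take s x0 i m : size s = 2 * l + 1 -> i + m <= 2 * l + 1 ->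
  arc (fun i => nth x0 s (i %% (2 * l + 1))) i m = take m (drop i s).
Proof.
move=> sn h; apply: (@eq_from_nth _ x0) => [|k]; rewrite size_arc.
  by rewrite size_takel // size_drop sn; lia.
move=> km; rewrite (nth_map 0) ?size_iota // nth_iota // nth_take // nth_drop.
by rewrite modn_small //; lia.
Qed.

(** * Odd closed walks and bipartite induced subgraphs *)

Definition in_set_rel (S : {set T}) : rel T := fun x y => [&& e x y, x \in S & y \in S].

Lemma in_set_sym S : symmetric (in_set_rel S).
Proof. by move=> x y; rewrite /in_set_rel e_sym [(x \in S) && _]andbC. Qed.

(** A shortest odd closed walk is an induced cycle: a repeated vertex or a chord would split it into
    two closed walks, one of them odd and shorter. Its length is then n by [odd_size]. *)
Lemma odd_closed_hole (S : {set T}) w : cycle (in_set_rel S) w -> odd (size w) ->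
  exists2 c, is_hole c & forall i, c i \in S.
Proof.
have [k] := ubnP (size w); elim: k w => // k IH w wk cw ow.
have wS x : x \in w -> x \in S by move=> /(next_cycle cw) /and3P[].
have shorter w1 : size w1 < size w -> cycle (in_set_rel S) w1 -> odd (size w1) ->
    exists2 c, is_hole c & forall i, c i \in S.
  by move=> h c1 o1; apply: (IH w1) => //; lia.
have halves x w1 y w2 : w = x :: w1 ++ y :: w2 \/ (exists m, rot m w = x :: w1 ++ y :: w2) ->
    path (in_set_rel S) x (rcons w1 y) /\ path (in_set_rel S) y (rcons w2 x) /\
    size w = size w1 + size w2 + 2.
  move=> E; have [m E'] : exists m, rot m w = x :: w1 ++ y :: w2.
    by case: E => // ->; exists 0; rewrite rot0.
  have := cw; rewrite -(rot_cycle m) -(size_rot m w) E' /= rcons_cat cat_path /= size_cat /=.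
  rewrite rcons_path => /and3P[h1 h2 h3]; split; [by rewrite rcons_path h1 h2 | split=> //; lia].
have rotw x : x \in w -> exists m w1, rot m w = x :: w1.
  by move=> xw; have [m w1 E] := rot_to xw; exists m, w1.
(* At a repeated vertex the lengths of the two parts add up to the odd length of [w], so exactly one
   of them is odd. *)
have [uw|nu] := boolP (uniq w); last first.
  have [x [m [w1 [w2 E]]]] : exists x m w1 w2, rot m w = x :: w1 ++ x :: w2.
    have : exists x s1 s2, w = s1 ++ x :: s2 /\ x \in s2.
      elim: (w) nu => //= y s IHs; rewrite negb_and negbK.
      case/orP => [ys|/IHs [x [s1 [s2 [-> xs]]]]]; first by exists y, [::], s.
      by exists x, (y :: s1), s2.
    move=> [x [s1 [s2 [E xs2]]]]; exists x, (size s1).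
    have [t1 [y [t2 [E2 /eqP xy _]]]] : exists s3 x0 s4,
        [/\ s2 = s3 ++ x0 :: s4, pred1 x x0 & ~~ has (pred1 x) s3].
      by apply: split_first; rewrite has_pred1.
    exists t1, (t2 ++ s1); rewrite E rot_size_cat E2 xy /= -catA //.
  have [p1 [p2 E2]] := halves x w1 x w2 (or_intror (ex_intro _ m E)).
  have [o1|o1] := boolP (odd (size w1)).
    by apply: (shorter (x :: w2)); rewrite //= ?E2; lia.
  by apply: (shorter (x :: w1)); rewrite //= ?E2; lia.
have w3 : 2 < size w.
  case: (w) cw ow => [//|x [|y [|z s]]] //=.
  by rewrite /in_set_rel e_irr.
have [ch|nch] := boolP [forall x in w, forall y in w, e x y ==> ((y == next w x) || (x == next w y))].
  have Iw : induced_cycle e w.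
    split; first split=> //.
      by rewrite /ucycle uw andbT; apply: sub_cycle cw => x y /andP[].
    move=> x y xw yw exy; have := forall_inP (forall_inP ch x xw) y yw.
    by rewrite exy => /orP[]/eqP; auto.
  have sn := odd_size Iw ow.
  have x0 : T by case: (w) w3 => // x.
  exists (fun i => nth x0 w (i %% (2 * l + 1))); first exact: hole_of_cycle.
  by move=> i; apply/wS/mem_nth; rewrite sn ltn_pmod; lia.
move: nch; rewrite negb_forall_in => /existsP[x /andP[xw]].
rewrite negb_forall_in => /existsP[y /andP[yw]].
rewrite negb_imply negb_or => /and3P[exy yx xy].
have [m [w1 E]] := rotw x xw.
have neq : x != y by apply: contraTneq exy => ->; rewrite e_irr.
have /split_first[t1 [y' [t2 [E2 /eqP yy _]]]] : has (pred1 y) w1.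
  rewrite has_pred1; have : y \in rot m w by rewrite mem_rot.
  by rewrite E inE eq_sym (negbTE neq).
have {yy}E2 : w1 = t1 ++ y :: t2 by rewrite E2 yy.
rewrite E2 in E.
have [p1 [p2 E3]] := halves x t1 y t2 (or_intror (ex_intro _ m E)).
(* The chord is not an edge of the cycle, so both sides have interior vertices and replacing either
   side by the chord shortens the walk. *)
have t10 : 0 < size t1.
  case: t1 E {E2 E3 p1} => //= E; case/negP: yx.
  by rewrite -(next_rot m uw) E /= eqxx.
have t20 : 0 < size t2.
  case: t2 E {E2 E3 p2} => //= E; case/negP: xy; rewrite eq_sym.
  by rewrite -(next_rot m uw) -(next_rot (size (x :: t1))) ?rot_uniq // E -cat_cons rot_size_cat /= eqxx.
have xyS : in_set_rel S x y by rewrite /in_set_rel exy !wS.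
have [o1|o1] := boolP (odd (size t1)).
  apply: (shorter (x :: rcons t1 y)); rewrite /= ?size_rcons ?negbK ?E3 //.
    by clear -t20; lia.
  by rewrite rcons_path p1 last_rcons in_set_sym.
apply: (shorter (y :: rcons t2 x)); rewrite /= ?size_rcons ?negbK ?E3.
- by clear -t10; lia.
- by rewrite rcons_path p2 last_rcons.
- by move: ow; rewrite E3 !oddD (negbTE o1) addbF.
Qed.

(** Colour each vertex by the parity of a chosen path from the root of its component; an edge with
    equal colours closes an odd walk with the two paths to its ends. *)
Lemma bipartite_or_hole (S : {set T}) :
  (exists f : T -> bool, {in S &, forall x y, e x y -> f x != f y}) \/
  (exists2 c, is_hole c & forall i, c i \in S).
Proof.
set r := in_set_rel S.
have sr : symmetric r by exact: in_set_sym.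
have /fin_all_exists[p hp] : forall x, exists p, path r (root r x) p /\ last (root r x) p = x.
  move=> x; have : connect r (root r x) x by rewrite (sym_connect_sym sr) connect_root.
  by move=> /connectP[p h1 h2]; exists p.
have [bad|good] := boolP [exists x in S, exists y in S, e x y && (odd (size (p x)) == odd (size (p y)))].
  right; case/exists_inP: bad => x xS /exists_inP[y yS /andP[exy /eqP oxy]].
  have Rxy : root r x = root r y.
    by apply/(rootP (sym_connect_sym sr))/connect1; rewrite /r /in_set_rel exy xS.
  have [hx lx] := hp x; have [hy ly] := hp y; rewrite -Rxy in hy ly.
  pose a := root r x; have rxy : r x y by rewrite /r /in_set_rel exy xS.
  have py : path r y (rev (belast a (p y))).
    rewrite -{1}ly rev_path; apply: sub_path hy => u v; by rewrite sr.
  have Pc : path r a (p x ++ y :: rev (belast a (p y))) by rewrite cat_path hx /= lx rxy.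
  have Lc : last a (p x ++ y :: rev (belast a (p y))) = a.
    rewrite last_cat /=; case: (p y) ly => [/= <-//|z s] /= _.
    by rewrite rev_cons last_rcons.
  have Sc : odd (size (p x ++ y :: rev (belast a (p y)))).
    rewrite size_cat /= size_rev size_belast oddD /= oxy.
    by case: (odd _).
  case/lastP: (p x ++ _) Pc Lc Sc => [//|q z] Pc; rewrite last_rcons => Lc Sc.
  apply: (@odd_closed_hole S (a :: q)); last by rewrite size_rcons in Sc.
  by rewrite /= -{2}Lc.
left; exists (fun x => odd (size (p x))) => x y xS yS exy.
apply: contraNneq good => E; apply/exists_inP; exists x => //; apply/exists_inP; exists y => //.
by rewrite exy E eqxx.
Qed.

(** * Star cutsets *)

Lemma exists_hole : exists c, is_hole c.
Proof.
have [[f hf]|[c hc _]] := bipartite_or_hole setT; last by exists c.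
case: not3; exists (fun x => inord (f x)) => x y exy.
have := hf x y (in_setT x) (in_setT y) exy; apply: contraNneq => /(congr1 val).
by rewrite /= !inordK; [case: (f x); case: (f y) | case: (f y) | case: (f x)].
Qed.

Section StarCutset.
Variables (v : T) (B : {set T}).
Hypotheses (vB : v \in B) (Bv : forall x, x \in B -> x != v -> e v x).

(** Criticality colours the proper subset, and exchanging two colours gives [v] colour 0. No other
    vertex of [B] then has colour 0, since all of them are adjacent to [v]. *)
Lemma colour_side (A : {set T}) (x : T) : x \notin A :|: B ->
  exists g : T -> 'I_3, g v = ord0 /\ {in A :|: B &, forall x y, e x y -> g x != g y}.
Proof.
move=> xA; have /crit[f hf] : A :|: B != setT by apply: contraNneq xA => ->; rewrite inE.
exists (fun z => tperm (f v) ord0 (f z)); split; first by rewrite tpermL.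
by move=> a b aA bA eab; rewrite (inj_eq perm_inj); apply: hf.
Qed.

(** Only [c i0] can lie in [B], so the rest of the hole is connected off [B] and stays in [A].
    Colour 0 is absent from the hole, so two colours would alternate around an odd cycle. *)
Lemma colour_side_hole (A : {set T}) (g : T -> 'I_3) (c : nat -> T) (i0 : nat) :
  is_hole c -> (forall i, c i != v) ->
  (forall z w, z \in A -> w \notin B -> e z w -> w \in A) ->
  g v = ord0 -> {in A :|: B &, forall x y, e x y -> g x != g y} ->
  (forall i, c i \in A -> g (c i) != ord0) ->
  (forall j, i0 < j < i0 + (2 * l + 1) -> c j \notin B) -> c i0.+1 \in A -> False.
Proof.
move=> Hc cv clA gv hg gA hi0 cA; have l5 := l_ge.
have step j : e (c j) (c j.+1) by rewrite (hole_adj Hc) ?eqxx; lia.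
have inA j : i0 < j < i0 + (2 * l + 1) -> c j \in A.
  elim: j => // j IH hj; have [E|ij] := eqVneq i0 j; first by rewrite -E.
  by apply: (clA (c j)); [apply: IH; lia | apply: hi0 | apply: step].
have inAB j : c j \in A :|: B.
  have [k hk ->] := hole_idx Hc i0 (on_hole Hc j).
  have [E|ik] := eqVneq i0 k; last by rewrite inE inA //; lia.
  rewrite inE -E; have [//|nB] := boolP (c i0 \in B); first by rewrite orbT.
  by rewrite (clA (c i0.+1)) // e_sym.
have nz j : g (c j) != ord0.
  have := inAB j; rewrite inE => /orP[/gA //|cB].
  by rewrite -gv eq_sym; apply: hg; rewrite ?inE ?vB ?cB ?orbT //; apply: Bv.
apply: (hole_odd Hc (f := fun z => g z == lift ord0 ord0)) => j.
have := hg _ _ (inAB j) (inAB j.+1) (step j); have := nz j; have := nz j.+1.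
by case: (g (c j)) => -[|[|[|a]]] p //; case: (g (c j.+1)) => -[|[|[|b]]] q.
Qed.

(* There is no star cutset: colour both sides of B with v coloured 0. If the vertices not
   coloured 0 do not induce a bipartite graph, they contain an odd hole; it meets B at most
   once, since v has at most one neighbour on it, so it lies on one side. *)
Lemma star_connected x y : x \notin B -> y \notin B ->
  exists p, [/\ path e x p, last x p = y & {in p, forall z, z \notin B}].
Proof.
move=> xB yB; have l5 := l_ge; pose r := in_set_rel (~: B).
have [/connectP[p hp ly]|nc] := boolP (connect r x y).
  exists p; split=> //; first by apply: sub_path hp => a b /and3P[].
  move=> z zp; have [s1 [z' [s2 [E /eqP zz _]]]] : exists s1 x s2,
      [/\ p = s1 ++ x :: s2, pred1 z x & ~~ has (pred1 z) s1].
    by apply: split_first; rewrite has_pred1.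
  by move: hp; rewrite E cat_path /= zz => /and3P[_ /and3P[_ _]]; rewrite inE.
exfalso; pose A1 := [set z | (z \notin B) && connect r x z].
pose A2 := [set z | (z \notin B) && ~~ connect r x z].
have cl1 z w : z \in A1 -> w \notin B -> e z w -> w \in A1.
  rewrite !inE => /andP[zB cz] wB ezw; rewrite wB (connect_trans cz) // connect1 //.
  by rewrite /r /in_set_rel ezw !inE zB wB.
have cl2 z w : z \in A2 -> w \notin B -> e z w -> w \in A2.
  rewrite !inE => /andP[zB cz] wB ezw; rewrite wB /=; apply: contra cz => cw.
  rewrite (connect_trans cw) // connect1 //.
  by rewrite /r /in_set_rel e_sym ezw !inE zB wB.
have [|g1 [g1v hg1]] := @colour_side A1 y; first by rewrite !inE negb_or yB (negbTE nc).
have [|g2 [g2v hg2]] := @colour_side A2 x; first by rewrite !inE negb_or xB connect0.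
have inA2 z : z \notin A2 -> z \in A1 :|: B.
  by rewrite !inE; case: (z \in B); rewrite ?orbT //= negbK orbF.
pose M := [set z | if z \in A2 then g2 z != ord0 else g1 z != ord0].
have inM z : (z \in M) = if z \in A2 then g2 z != ord0 else g1 z != ord0 by rewrite in_set.
have vA2 : v \notin A2 by rewrite inE vB.
have vM : v \notin M by rewrite inM (negbTE vA2) g1v eqxx.
have A12 z : z \in A1 -> z \notin A2 by rewrite !inE => /andP[-> ->].
have [[f hf]|[c Hc cM]] := bipartite_or_hole M.
  case: not3; pose col z : 'I_3 := if z \in M then lift ord0 (inord (f z) : 'I_2) else ord0.
  have half a b : e a b -> a \notin M -> b \notin M -> a \in A2 -> False.
    move=> eab; rewrite !inM => + + aA; rewrite aA negbK => /eqP ga.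
    have [bA|bA] := boolP (b \in A2); rewrite negbK => /eqP gb.
      by have := hg2 a b; rewrite !in_setU aA bA ga gb => /(_ isT isT eab).
    have [bB|bB] := boolP (b \in B); last by rewrite (cl2 a) in bA.
    have [E|bv] := eqVneq b v.
      have := hg2 a b; rewrite !in_setU aA bB E g2v ga orbT => /(_ isT isT).
      by rewrite -E => /(_ eab).
    by have := hg1 v b; rewrite !in_setU vB bB !orbT g1v gb => /(_ isT isT (Bv bB bv)).
  exists col => a b eab; rewrite /col.
  have [aM|aM] := boolP (a \in M); have [bM|bM] := boolP (b \in M) => //.
    apply: contraNneq (hf a b aM bM eab) => /lift_inj/(congr1 val)/=.
    by rewrite !inordK; [case: (f a); case: (f b)|case: (f b)|case: (f a)].
  case: (boolP (a \in A2)) => [aA|aA]; first by case: (half a b).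
  case: (boolP (b \in A2)) => [bA|bA]; first by case: (half b a); rewrite // e_sym.
  move: aM bM; rewrite !inM (negbTE aA) (negbTE bA) !negbK => /eqP ga /eqP gb.
  by have := hg1 a b (inA2 _ aA) (inA2 _ bA) eab; rewrite ga gb.
have cv i : c i != v by apply: contraNneq vM => <-.
have vC : v \notin arc c 0 (2 * l + 1).
  by apply/negP => /mem_arcP[j _ E]; have := cv j; rewrite E eqxx.
have [i0 hi0] : exists i0, forall j, i0 < j < i0 + (2 * l + 1) -> c j \notin B.
  have [/hasP[z /mem_arcP[i _ ->] ciB]|/hasPn none] := boolP (has (mem B) (arc c 0 (2 * l + 1))).
    exists i => j hj; apply/negP => cjB.
    have li k : c k \in B -> lab c k v by move=> ckB; rewrite /lab vC Bv.
    by have := hole_neq Hc hj; rewrite (lab_inj Hc (li _ ciB) (li _ cjB)) eqxx.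
  by exists 0 => j _; apply: none; apply: on_hole.
have [c1A|c1A] := boolP (c i0.+1 \in A2).
  apply: (colour_side_hole Hc cv cl2 g2v hg2 _ hi0 c1A) => i ciA.
  by have := cM i; rewrite inM ciA.
apply: (@colour_side_hole A1 g1 c i0 Hc cv cl1 g1v hg1 _ hi0) => [i /A12 ciA|].
  by have := cM i; rewrite inM (negbTE ciA).
have := inA2 _ c1A; rewrite in_setU => /orP[//|]; rewrite (negbTE (hi0 _ _)) //; lia.
Qed.
End StarCutset.

(** Otherwise a colouring of the graph without [v] leaves a third colour for [v]. *)
Lemma degree_gt2 v a b : exists2 w, e v w & (w != a) && (w != b).
Proof.
apply/exists_inP; apply: contra_notT not3 => none.
have [|f hf] := @crit [set~ v].
  by apply/eqP => E; have := in_setT v; rewrite -E !inE eqxx.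
have nv w : e v w -> (w == a) || (w == b).
  move=> ew; apply: contraNT none => h; apply/exists_inP; exists w => //.
  by rewrite -negb_or.
have [k ka kb] : exists2 k : 'I_3, k != f a & k != f b.
  apply/exists_inP; rewrite -negb_forall_in; apply/negP => /forall_inP h.
  have : #|'I_3| <= #|[set f a; f b]|.
    apply/subset_leq_card/subsetP => k _; have := h k; rewrite !inE.
    by case: (k == f a) => //= /(_ isT); case: (k == f b).
  by rewrite card_ord cards2; case: (_ != _).
exists (fun z => if z == v then k else f z) => x y exy.
have [xv|xv] := eqVneq x v; have [yv|yv] := eqVneq y v.
- by rewrite xv yv e_irr in exy.
- by rewrite xv in exy; case/orP: (nv _ exy) => /eqP->.
- by rewrite yv e_sym in exy; case/orP: (nv _ exy) => /eqP->; rewrite eq_sym.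
- by apply: hf; rewrite ?inE.
Qed.

(** * Jumps *)

(** [ac_split] breaks the anticompleteness hypotheses into facts about single vertices and unsplit
    segments; [ac_goal] breaks the goal in the same way and closes the pieces found among the
    hypotheses up to symmetry, leaving the others open. *)
Ltac ac_split :=
  repeat match goal with
  | H : is_true (ac (_ ++ _) _) |- _ =>
    let a := fresh in let b := fresh in
    rewrite ac_catl in H; case/andP: H => a b
  | H : is_true (ac _ (_ ++ _)) |- _ =>
    let a := fresh in let b := fresh in
    rewrite ac_catr in H; case/andP: H => a b
  | H : is_true (ac (_ :: (_ :: _)) _) |- _ =>
    let a := fresh in let b := fresh in
    rewrite ac_consl in H; case/andP: H => a b
  | H : is_true (ac _ (_ :: (_ :: _))) |- _ =>
    let a := fresh in let b := fresh in
    rewrite ac_consr in H; case/andP: H => a b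
  | H : is_true (ac (_ :: (_ ++ _)) _) |- _ =>
    let a := fresh in let b := fresh in
    rewrite ac_consl in H; case/andP: H => a b
  | H : is_true (ac _ (_ :: (_ ++ _))) |- _ =>
    let a := fresh in let b := fresh in
    rewrite ac_consr in H; case/andP: H => a b
  | H : is_true (ac (_ :: ?s) _) |- _ =>
    lazymatch s with [::] => fail | _ => idtac end;
    let a := fresh in let b := fresh in
    rewrite ac_consl in H; case/andP: H => a b
  | H : is_true (ac _ (_ :: ?s)) |- _ =>
    lazymatch s with [::] => fail | _ => idtac end;
    let a := fresh in let b := fresh in
    rewrite ac_consr in H; case/andP: H => a b
  | H : is_true (ac (rev _) _) |- _ => rewrite ac_revl in H
  | H : is_true (ac _ (rev _)) |- _ => rewrite ac_revr in H
  end.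

Ltac ac_goal :=
  lazymatch goal with
  | |- is_true (ac [::] _) => exact: ac0l
  | |- is_true (ac _ [::]) => exact: ac0r
  | |- is_true (ac (_ ++ _) _) => rewrite ac_catl; apply/andP; split; ac_goal
  | |- is_true (ac _ (_ ++ _)) => rewrite ac_catr; apply/andP; split; ac_goal
  | |- is_true (ac (rev _) _) => rewrite ac_revl; ac_goal
  | |- is_true (ac _ (rev _)) => rewrite ac_revr; ac_goal
  | |- is_true (ac (_ :: ?s) ?t) =>
    lazymatch s with
    | [::] =>
      lazymatch t with
      | _ :: [::] => try assumption; try (rewrite ac_sym; assumption)
      | _ :: _ => rewrite ac_consr; apply/andP; split; ac_goal
      | _ => try assumption; try (rewrite ac_sym; assumption)
      end
    | _ => rewrite ac_consl; apply/andP; split; ac_goal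
    end
  | |- is_true (ac _ (_ :: ?s)) =>
    lazymatch s with
    | [::] => try assumption; try (rewrite ac_sym; assumption)
    | _ => rewrite ac_consr; apply/andP; split; ac_goal
    end
  | |- _ => try assumption; try (rewrite ac_sym; assumption)
  end.

Lemma ip_swap x s y : ip (x :: s ++ [:: y]) -> ip (y :: rev s ++ [:: x]).
Proof. by move=> h; rewrite -ip_rev rev_cons rev_cat revK /= -cats1. Qed.

(* The third and fourth conditions force u and v to be distinct and nonadjacent. *)
Definition jump (c : nat -> T) (u v : T) (R : seq T) :=
  [/\ u \in arc c 0 (2 * l + 1), v \in arc c 0 (2 * l + 1), 0 < size R, ip (u :: R ++ [:: v]) &
   forall w x, w \in R -> x \in arc c 0 (2 * l + 1) -> x != u -> x != v -> far w x].

(** Only interior vertices must satisfy [D]. With [D] the unlabelled vertices, the ends may thus be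
    labelled, as they are for a jump. *)
Definition walk (D : T -> bool) (x y : T) := exists s : seq T, path e x (rcons s y) /\ all D s.

Lemma walk_rev D x y : walk D x y -> walk D y x.
Proof.
move=> [s [hp hs]]; exists (rev s); rewrite all_rev; split=> //.
have := rev_path e x (rcons s y); rewrite last_rcons belast_rcons rev_cons.
by rewrite (eq_path (e' := e)) ?hp // => a b; rewrite e_sym.
Qed.

Lemma walk_sub (D D' : T -> bool) x y : (forall z, D z -> D' z) -> walk D x y -> walk D' x y.
Proof. by move=> h [s [hp hs]]; exists s; split=> //; apply: sub_all hs. Qed.

Lemma walk_cat (D : T -> bool) x z y : walk D x z -> walk D z y -> D z -> walk D x y.
Proof.
move=> [s [p1 h1]] [t [p2 h2]] Dz; exists (s ++ z :: t); rewrite all_cat /= h1 h2 Dz; split=> //.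
by rewrite rcons_cat cat_path /= p2; move: p1; rewrite rcons_path => /andP[-> ->].
Qed.

Lemma walk_edge D x y : e x y -> walk D x y.
Proof. by move=> exy; exists [::]; rewrite /= exy. Qed.

Lemma walk_cons (D : T -> bool) x z y : e x z -> D z -> walk D z y -> walk D x y.
Proof. by move=> /(walk_edge D) h1 Dz h2; apply: walk_cat h1 h2 Dz. Qed.

Lemma walk_ip (D : T -> bool) x y : walk D x y -> x != y ->
  exists s, ip (x :: s ++ [:: y]) /\ all D s.
Proof.
move=> [s [hp /allP hs]] xy; have [s' [h1 h2]] := ip_shortest hp xy.
by exists s'; split=> //; apply/allP => z /h2; apply: hs.
Qed.

Lemma path_walk (D : T -> bool) x s y : path e x s -> all D s -> y \in s -> walk D x y.
Proof.
move=> hp hs ys; have /split_first[s1 [y' [s2 [E /eqP yy _]]]] : has (pred1 y) s by rewrite has_pred1.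
rewrite E yy in hp hs; exists s1; split.
  by move: hp; rewrite cat_path /= rcons_path => /and3P[-> -> _].
by move: hs; rewrite all_cat => /andP[].
Qed.

Section Jumps.
Variable c : nat -> T.
Hypothesis Hc : is_hole c.
Local Notation n := (2 * l + 1).

Lemma jump_rev u v R : jump c u v R -> jump c v u (rev R).
Proof.
move=> [uC vC R0 h1 h2]; split; rewrite ?size_rev //.
  exact: ip_swap.
by move=> w x; rewrite mem_rev => wR xC xv xu; apply: h2.
Qed.

Lemma jump_ac u v R i m : jump c u v R -> u \notin arc c i m -> v \notin arc c i m ->
  ac R (arc c i m).
Proof.
move=> [uC vC R0 h1 h2] ui vi; apply/acP => w x wR xi; apply: h2 => //.
- by case/mem_arcP: xi => j _ ->; apply: on_hole.
- by apply: contraNneq ui => <-.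
- by apply: contraNneq vi => <-.
Qed.

Lemma ip_ends_far (x : T) (s : seq T) y : 0 < size s -> ip (x :: s ++ [:: y]) -> far x y.
Proof.
case: s => // z s _; rewrite -[_ :: _]/[:: x, z & s ++ [:: y]] ip_cons2 ac_catr.
by case/and3P=> _ /andP[_ h] _; rewrite -ac11.
Qed.

Lemma jump_far u v R : jump c u v R -> far u v.
Proof. by move=> [_ _ R0 h _]; apply: ip_ends_far h. Qed.

Lemma far_idx i j : i < j < i + n -> far (c i) (c j) -> i + 2 <= j <= i + n - 2.
Proof. by move=> h; rewrite /far (hole_adj Hc) // => /andP[_]; lia. Qed.

Lemma jump_idx i j R : jump c (c i) (c j) R -> i < j < i + n ->
  [/\ i + 2 <= j <= i + n - 2, ac R (arc c i.+1 (j - i.+1)) & ac R (arc c j.+1 (i + n - j.+1))].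
Proof.
move=> hR hij; split; first exact: far_idx (jump_far hR).
  apply: (jump_ac hR); last by apply: (notin_arc Hc); lia.
  by rewrite -(hole_per Hc); apply: (notin_arc Hc); lia.
apply: (jump_ac hR); last by rewrite -(hole_per Hc); apply: (notin_arc Hc); lia.
by rewrite -(hole_per Hc); apply: (notin_arc Hc); lia.
Qed.

Lemma jump_outside u v R w : jump c u v R -> w \in R -> w \notin arc c 0 n.
Proof.
move=> [uC vC R0 h1 h2] wR; apply/negP => wC.
have := ip_uniq h1; rewrite cons_uniq cat_uniq mem_cat negb_or /= orbF.
move=> /and3P[/andP[uR _] _ /andP[vR _]].
have wu : w != u by apply: contraNneq uR => <-.
have wv : w != v by apply: contraNneq vR => <-.
by have := h2 w w wR wC wu wv; rewrite /far eqxx.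
Qed.

Lemma arc_closed i j : i < j < i + n -> c i :: arc c i.+1 (j - i.+1) ++ [:: c j] = arc c i (j - i).+1.
Proof.
move=> h; rewrite -[[:: c j]]/(arc c j 1).
have -> : (j - i).+1 = 1 + ((j - i.+1) + 1) by lia.
by rewrite !arc_cat /=; congr (_ :: _ ++ [:: c _]); [rewrite addn1 | lia].
Qed.

Lemma ip_arc_closed i j : i < j < i + n - 1 -> ip (c i :: arc c i.+1 (j - i.+1) ++ [:: c j]).
Proof. by move=> h; rewrite arc_closed; [apply: ip_arc => //; lia | lia]. Qed.

Lemma ear i j (W : seq T) : i < j < i + n - 1 -> 0 < size W -> ip (c i :: W ++ [:: c j]) ->
  ac W (arc c i.+1 (j - i.+1)) ->
  n <= size W + (j - i.+1) + 2 /\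
  (odd (size W + (j - i.+1)) -> size W + (j - i.+1) + 2 = n).
Proof.
move=> hij W0 h1 h2.
have := @girth2 _ (rev W) _ (arc c i.+1 (j - i.+1)) _ (ip_swap h1) (ip_arc_closed hij).
by rewrite size_rev size_arc ac_revl => /(_ W0 h2).
Qed.

(** The cycles through [R] and the two arcs have opposite parities, and the odd one has length n. It
    uses the shorter arc, since otherwise the other cycle would have fewer than n vertices. The
    maximum counts the interior of the longer arc. *)
Lemma jump_size i j R : jump c (c i) (c j) R -> i < j < i + n ->
  size R = maxn (j - i - 1) (i + n - j - 1).
Proof.
move=> hR hij; have [b a1 a2] := jump_idx hR hij; have l5 := l_ge.
have [_ _ R0 h1 _] := hR.
have [|g1 o1] := ear _ R0 h1 a1; first by lia.
have h1' : ip (c j :: rev R ++ [:: c (i + n)]) by rewrite (hole_per Hc); apply: ip_swap.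
have a2' : ac (rev R) (arc c j.+1 (i + n - j.+1)) by rewrite ac_revl.
have R0' : 0 < size (rev R) by rewrite size_rev.
have [|g2 o2] := ear _ R0' h1' a2'; first by lia.
rewrite size_rev in g2 o2.
have : odd ((size R + (j - i.+1)) + (size R + (i + n - j.+1))).
  have -> : (size R + (j - i.+1)) + (size R + (i + n - j.+1)) = (size R + l - 1).*2.+1 by lia.
  by rewrite /= odd_double.
rewrite oddD; case: (boolP (odd _)) => [o _|_ /= o]; first by have := o1 o; clear -b g1 g2 l5; lia.
by have := o2 o; clear -b g1 g2 l5; lia.
Qed.

Lemma lab_path_jump i j x y (s : seq T) : lab c i x -> lab c j y -> far (c i) (c j) ->
  ip (x :: s ++ [:: y]) -> all (unlabelled c) s -> jump c (c i) (c j) (x :: s ++ [:: y]).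
Proof.
move=> lx ly ij h1 h2.
have far_c w k z : lab c k w -> z \in arc c 0 n -> z != c k -> far w z.
  move=> lw /mem_arcP[q _ ->] zk; rewrite /far; apply/andP; split.
    by apply: contraNneq (andP lw).1 => ->; apply: on_hole.
  by apply: contraNN zk => ewz; rewrite (lab_inj Hc lw (_ : lab c q w)) // /lab ewz (andP lw).1.
have far_u w z : unlabelled c w -> z \in arc c 0 n -> far w z.
  move=> /(unl_arc Hc 0 n) /acP h /h; apply; exact: mem_head.
have ijn : c i != c j by case/andP: ij.
split=> //; rewrite ?on_hole //.
  have -> : c i :: (x :: s ++ [:: y]) ++ [:: c j] = (c i :: x :: s) ++ [:: y; c j].
    by rewrite /= -catA.
  apply: ip_glue; rewrite ?ip2; last first.
  - apply/acP => a b; rewrite inE => + /[!inE] /eqP->; rewrite inE.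
    move=> /predU1P[->//|/predU1P[->|/(allP h2)]]; last by move/far_u; apply; apply: on_hole.
    by apply: far_c lx _ _; rewrite ?on_hole // eq_sym.
  - by case/andP: ly.
  rewrite -[_ ++ _]/[:: c i, x & s ++ [:: y]] ip_cons2 h1 andbT e_sym (andP lx).2 /=.
  rewrite ac_sym; apply/acP => a b; rewrite mem_cat mem_seq1 => + /[!inE] /eqP->.
  move=> /orP[/(allP h2)/far_u|/eqP->]; first by apply; apply: on_hole.
  by apply: far_c ly _ _; rewrite ?on_hole.
move=> w z; rewrite inE mem_cat mem_seq1 => /predU1P[->|/orP[/(allP h2)|/eqP->]] zC zi zj.
- exact: far_c lx _ _.
- by move=> uw; apply: far_u.
- exact: far_c ly _ _.
Qed.

Lemma walk_jump i j x y : lab c i x -> lab c j y -> far (c i) (c j) ->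
  walk (unlabelled c) x y ->
  exists2 s, jump c (c i) (c j) (x :: s ++ [:: y]) & all (unlabelled c) s.
Proof.
move=> lx ly ij hw.
have xy : x != y.
  by apply: contraTneq ij => E; rewrite -E in ly; rewrite /far (lab_inj Hc lx ly) eqxx.
have [s [h1 h2]] := walk_ip hw xy.
by exists s => //; apply: lab_path_jump.
Qed.
End Jumps.

(** * Balanced subdivisions of K4 *)

(** The corners are [a], [b], [c], [q], and the lists are the interiors of the six branches.
    Opposite branches have equal lengths, so all four triangles have length [ga + al + be], that is
    n. Each anticompleteness field compares a branch with the later ones and with the corners that
    are not its ends. *)
Record K4 (a b c q : T) (AB BC CA QA QB QC : seq T) (ga al be : nat) : Prop := MkK4 {
  k4_ab : ip (a :: AB ++ [:: b]);
  k4_bc : ip (b :: BC ++ [:: c]);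
  k4_ca : ip (c :: CA ++ [:: a]);
  k4_qa : ip (q :: QA ++ [:: a]);
  k4_qb : ip (q :: QB ++ [:: b]);
  k4_qc : ip (q :: QC ++ [:: c]);
  k4_AB : ac AB (BC ++ CA ++ QA ++ QB ++ QC ++ [:: c; q]);
  k4_BC : ac BC (CA ++ QA ++ QB ++ QC ++ [:: a; q]);
  k4_CA : ac CA (QA ++ QB ++ QC ++ [:: b; q]);
  k4_QA : ac QA (QB ++ QC ++ [:: b; c]);
  k4_QB : ac QB (QC ++ [:: a; c]);
  k4_QC : ac QC [:: a; b];
  k4_q : ac [:: q] [:: a; b; c];
  k4_a : ac [:: a] [:: b; c];
  k4_b : ac [:: b] [:: c];
  k4_sAB : (size AB).+1 = ga;
  k4_sQC : (size QC).+1 = ga;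
  k4_sBC : (size BC).+1 = al;
  k4_sQA : (size QA).+1 = al;
  k4_sCA : (size CA).+1 = be;
  k4_sQB : (size QB).+1 = be;
  k4_bnd : [&& 2 <= ga <= l, 2 <= al <= l & 2 <= be <= l];
  k4_sum : ga + al + be = 2 * l + 1
}.

Ltac k4_atoms :=
  repeat match goal with
  | H : K4 _ _ _ _ _ _ _ _ _ _ _ _ _ |- _ =>
    let h1 := fresh in let h2 := fresh in let h3 := fresh in let h4 := fresh in
    let h5 := fresh in let h6 := fresh in let h7 := fresh in let h8 := fresh in let h9 := fresh in
    have h1 := k4_AB H; have h2 := k4_BC H; have h3 := k4_CA H; have h4 := k4_QA H;
    have h5 := k4_QB H; have h6 := k4_QC H; have h7 := k4_q H; have h8 := k4_a H;
    have h9 := k4_b H; clear H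
  end; ac_split.

(** The symmetries of the configuration are used to make [AB] the longest branch and to orient
    it. *)
Lemma k4_rot a b c q AB BC CA QA QB QC ga al be :
  K4 a b c q AB BC CA QA QB QC ga al be -> K4 b c a q BC CA AB QB QC QA al be ga.
Proof.
move=> K; split; try (by case: K); try solve [k4_atoms; ac_goal].
- by have := k4_bnd K; lia.
- by have := k4_sum K; lia.
Qed.

Lemma k4_refl a b c q AB BC CA QA QB QC ga al be :
  K4 a b c q AB BC CA QA QB QC ga al be ->
  K4 b a c q (rev AB) (rev CA) (rev BC) QB QA QC ga be al.
Proof.
move=> K; split; rewrite ?size_rev; try (by case: K); try solve [k4_atoms; ac_goal].
- exact: ip_swap (k4_ab K).
- exact: ip_swap (k4_ca K).
- exact: ip_swap (k4_bc K).
- by have := k4_bnd K; lia.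
- by have := k4_sum K; lia.
Qed.

(** Exchanging [c] and [q] keeps the branch [AB] and turns the rest of the rim into part of the tree
    at the new centre. *)
Lemma k4_exch a b c q AB BC CA QA QB QC ga al be :
  K4 a b c q AB BC CA QA QB QC ga al be ->
  K4 a b q c AB (rev QB) QA CA (rev BC) (rev QC) ga be al.
Proof.
move=> K; split; rewrite ?size_rev; try (by case: K); try solve [k4_atoms; ac_goal].
- exact: ip_swap (k4_qb K).
- exact: ip_swap (k4_bc K).
- exact: ip_swap (k4_qc K).
- by have := k4_bnd K; lia.
- by have := k4_sum K; lia.
Qed.

Definition k4_verts (a b c q : T) (AB BC CA QA QB QC : seq T) : seq T :=
  a :: AB ++ b :: BC ++ c :: CA ++ q :: QA ++ QB ++ QC.

(** The analogue of a jump for an arbitrary vertex set: contact with [V] is allowed only at the two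
    ends. *)
Definition attached (V : seq T) (x z : T) (R : seq T) :=
  [/\ 0 < size R, ip (x :: R ++ [:: z]) &
   forall w y, w \in R -> y \in V -> y != x -> y != z -> far w y].

Lemma attached_ac V x z R s : attached V x z R -> {subset s <= V} ->
  x \notin s -> z \notin s -> ac R s.
Proof.
move=> [_ _ h] hs xs zs; apply/acP => w y wR ys.
by apply: h (hs y ys) _ _ => //; [apply: contraNneq xs => <- | apply: contraNneq zs => <-].
Qed.

Definition cycle_length N := 2 * l + 1 <= N /\ (odd N -> N = 2 * l + 1).

Lemma girth2_length (x z : T) (R D : seq T) :
  0 < size R -> ip (x :: R ++ [:: z]) -> ip (z :: D ++ [:: x]) -> ac R D ->
  cycle_length (size R + size D + 2).
Proof.
move=> h0 h1 h2 h3; have [h4 h5] := girth2 h0 h1 h2 h3; split=> // o; apply: h5.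
by move: o; rewrite addn2 /= negbK.
Qed.

(** * Ears from the side AB to the tree centred at q *)

Section Ear.
Variables (a b c q : T) (AB BC CA QA QB QC : seq T) (ga al be : nat).
Hypothesis K : K4 a b c q AB BC CA QA QB QC ga al be.
Variables (X1 X2 : seq T) (x z : T).
Hypothesis EAB : AB = X1 ++ x :: X2.
Let F := q :: QA ++ QB ++ QC.
Hypothesis zF : z \in F.

Lemma tree_ac : [/\ ac AB F, ac BC F & ac CA F].
Proof. by rewrite /F; split; k4_atoms; ac_goal. Qed.

Lemma tree_notin : [/\ a \notin F, b \notin F & c \notin F].
Proof.
have := ip_uniq (k4_qa K); have := ip_uniq (k4_qb K); have := ip_uniq (k4_qc K).
rewrite -!cat_cons !cats1 !rcons_uniq => /andP[cq _] /andP[bq _] /andP[aq _].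
have hA := k4_QA K; have hB := k4_QB K; have hC := k4_QC K.
move: aq bq cq; rewrite /F !inE !mem_cat !negb_or => /andP[-> ->] /andP[-> ->] /andP[-> ->] /=.
split.
- by rewrite !(ac_notin (s := [:: a])) ?mem_head // ac_sym; k4_atoms; ac_goal.
- by rewrite !(ac_notin (s := [:: b])) ?mem_head // ac_sym; k4_atoms; ac_goal.
- by rewrite !(ac_notin (s := [:: c])) ?mem_head // ac_sym; k4_atoms; ac_goal.
Qed.

(** The six ways from [z] to [x]: leave the tree at one corner, then follow the rim to [x], possibly
    through other corners. The [ac] conditions fail when [z] is adjacent to a corner that the path
    visits later; [0 < size X1] and [0 < size X2] keep [x] from being adjacent to the corner where
    the long way round begins. *)
Lemma k4_paths (PA PB PC : seq T) :
  ip (z :: PA ++ [:: a]) -> ip (z :: PB ++ [:: b]) -> ip (z :: PC ++ [:: c]) ->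
  {subset PA <= F} -> {subset PB <= F} -> {subset PC <= F} ->
  [/\ ip (z :: (PB ++ b :: rev X2) ++ [:: x]),
      ip (z :: (PA ++ a :: X1) ++ [:: x]),
      ac [:: b] (z :: PC) -> ip (z :: (PC ++ c :: rev BC ++ b :: rev X2) ++ [:: x]) &
      ac [:: a] (z :: PC) -> ip (z :: (PC ++ c :: CA ++ a :: X1) ++ [:: x])] /\
  (0 < size X1 -> ac [:: b] (z :: PA) -> ac [:: c] (z :: PA) ->
     ip (z :: (PA ++ a :: rev CA ++ c :: rev BC ++ b :: rev X2) ++ [:: x])) /\
  (0 < size X2 -> ac [:: a] (z :: PB) -> ac [:: c] (z :: PB) ->
     ip (z :: (PB ++ b :: BC ++ c :: CA ++ a :: X1) ++ [:: x])).
Proof.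
move=> hA hB hC sA sB sC.
have [tAB tBC tCA] := tree_ac.
have : ip ((a :: X1) ++ x :: (X2 ++ [:: b])) by have := k4_ab K; rewrite EAB -catA.
rewrite ip_glueE => /and3P[hax hxb aX].
have hbx := ip_swap hxb.
have acP (t s : seq T) : ac t F -> {subset s <= F} -> ac t (z :: s).
  by move=> h hs; apply: ac_sub h _ _ => // y; rewrite inE => /predU1P[->|/hs].
have [tA1 tA2 tA3] := And3 (acP _ _ tAB sA) (acP _ _ tBC sA) (acP _ _ tCA sA).
have [tB1 tB2 tB3] := And3 (acP _ _ tAB sB) (acP _ _ tBC sB) (acP _ _ tCA sB).
have [tC1 tC2 tC3] := And3 (acP _ _ tAB sC) (acP _ _ tBC sC) (acP _ _ tCA sC).
have kAB := k4_AB K; have kBC := k4_BC K; have kCA := k4_CA K; have ka := k4_a K; have kb := k4_b K.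
rewrite EAB in kAB tA1 tB1 tC1 tAB.
have kbc := k4_bc K; have kca := k4_ca K.
have hcb := ip_swap kbc; have hac := ip_swap kca.
ac_split.
have bx1 : ip ((c :: rev BC) ++ b :: (rev X2 ++ [:: x])).
  by apply: ip_glue => //; ac_goal.
have ax1 : ip ((c :: CA) ++ a :: (X1 ++ [:: x])).
  by apply: ip_glue => //; ac_goal.
split; [split|split].
- by rewrite -catA; apply: (@ip_glue (z :: PB) b (rev X2 ++ [:: x])) => //; ac_goal.
- by rewrite -catA; apply: (@ip_glue (z :: PA) a (X1 ++ [:: x])) => //; ac_goal.
- move=> hb; ac_split.
  by rewrite -catA /= -catA; apply: (@ip_glue (z :: PC) c (rev BC ++ b :: rev X2 ++ [:: x])) => //; ac_goal.
- move=> hb; ac_split.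
  by rewrite -catA /= -catA; apply: (@ip_glue (z :: PC) c (CA ++ a :: X1 ++ [:: x])) => //; ac_goal.
- move=> X10 hb hc; have ax : ac [:: a] [:: x] by rewrite ac11; apply: ip_ends_far hax.
  ac_split; rewrite -catA /= -catA /= -catA.
  apply: (@ip_glue (z :: PA) a (rev CA ++ c :: rev BC ++ b :: rev X2 ++ [:: x])) => //; last by ac_goal.
  by apply: (@ip_glue (a :: rev CA) c (rev BC ++ b :: rev X2 ++ [:: x])) => //; ac_goal.
- move=> X20 hb hc; have bx : ac [:: b] [:: x].
    by rewrite ac_sym ac11; apply: ip_ends_far hxb.
  ac_split; rewrite -catA /= -catA /= -catA.
  apply: (@ip_glue (z :: PB) b (BC ++ c :: CA ++ a :: X1 ++ [:: x])) => //; last by ac_goal.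
  by apply: (@ip_glue (b :: BC) c (CA ++ a :: X1 ++ [:: x])) => //; ac_goal.
Qed.

Variable R : seq T.
Hypothesis att : attached (k4_verts a b c q AB BC CA QA QB QC) x z R.

(** Each of the six paths closes an induced cycle with [R]. The number [f] is the distance from [a]
    to [x] along the side, and [ga - f] the distance from [x] to [b]. *)
Lemma ear_lengths (PA PB PC : seq T) :
  ip (z :: PA ++ [:: a]) -> ip (z :: PB ++ [:: b]) -> ip (z :: PC ++ [:: c]) ->
  {subset PA <= F} -> {subset PB <= F} -> {subset PC <= F} ->
  let u := size R in let f := (size X1).+1 in
  [/\ cycle_length (u + size PB + ga - f + 2),
      cycle_length (u + size PA + f + 2),
      ac [:: b] (z :: PC) -> cycle_length (u + size PC + al + ga - f + 2) &
      ac [:: a] (z :: PC) -> cycle_length (u + size PC + be + f + 2)] /\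
  (0 < size X1 -> ac [:: b] (z :: PA) -> ac [:: c] (z :: PA) ->
     cycle_length (u + size PA + be + al + ga - f + 2)) /\
  (0 < size X2 -> ac [:: a] (z :: PB) -> ac [:: c] (z :: PB) ->
     cycle_length (u + size PB + al + be + f + 2)).
Proof.
move=> hA hB hC sA sB sC u f.
have [R0 hR _] := att; have [aF bF cF] := tree_notin; have [tAB tBC tCA] := tree_ac.
have : ip ((a :: X1) ++ x :: (X2 ++ [:: b])) by have := k4_ab K; rewrite EAB -catA.
rewrite ip_glueE => /and3P[hax hxb aX].
have hbx := ip_swap hxb.
have U : uniq (a :: AB ++ [:: b]) := ip_uniq (k4_ab K).
have zAB : z \notin AB by apply/negP => h; have := zF; rewrite (negbTE (ac_notin tAB h)).
have zBC : z \notin BC by apply/negP => h; have := zF; rewrite (negbTE (ac_notin tBC h)).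
have zCA : z \notin CA by apply/negP => h; have := zF; rewrite (negbTE (ac_notin tCA h)).
have xAB : x \in AB by rewrite EAB mem_cat mem_head orbT.
have xF : x \notin F := ac_notin tAB xAB.
have na y : y \in F -> [/\ y != a, y != b & y != c].
  by move=> yF; split; apply: contraTneq yF => ->.
have [za zb zc] := na z zF.
have xs s : ac AB s -> x \notin s by move=> h; apply: ac_notin h xAB.
have xBC : x \notin BC by apply: xs; k4_atoms; ac_goal.
have xCA : x \notin CA by apply: xs; k4_atoms; ac_goal.
have xc : x != c.
  by have := xs [:: c]; rewrite inE; apply; k4_atoms; ac_goal.
have [xa xb xX1 xX2] : [/\ x != a, x != b, x \notin X1 & x \notin X2].
  have := ip_uniq hax; rewrite cats1 rcons_uniq inE negb_or => /andP[/andP[-> ->] _].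
  have := ip_uniq hxb; rewrite cons_uniq mem_cat negb_or mem_seq1 => /andP[/andP[-> ->] _].
  by [].
have [zX1 zX2] : z \notin X1 /\ z \notin X2.
  by move: zAB; rewrite EAB mem_cat inE !negb_or => /and3P[-> _ ->].
pose V := k4_verts a b c q AB BC CA QA QB QC.
have inV y : [|| y == a, y == b, y == c, y \in AB, y \in BC, y \in CA | y \in F] -> y \in V.
  rewrite /V /k4_verts /F !(inE, mem_cat).
  by case: (y == a) (y == b) (y == c) (y \in AB) (y \in BC) (y \in CA) => [] [] [] [] [] [] //=;
    rewrite ?orbT.
have rA s : {subset s <= V} -> x \notin s -> z \notin s -> ac R s by apply: (attached_ac att).
have acR1 : ac R X1 by apply: rA => // y h; apply: inV; rewrite EAB mem_cat h ?orbT.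
have acR2 : ac R X2 by apply: rA => // y h; apply: inV; rewrite EAB mem_cat inE h ?orbT.
have acRBC : ac R BC by apply: rA => // y h; apply: inV; rewrite h ?orbT.
have acRCA : ac R CA by apply: rA => // y h; apply: inV; rewrite h ?orbT.
have acRa : ac R [:: a] by apply: rA; rewrite ?mem_seq1 // => y; rewrite mem_seq1 => /eqP->; apply: inV; rewrite eqxx ?orbT.
have acRb : ac R [:: b] by apply: rA; rewrite ?mem_seq1 // => y; rewrite mem_seq1 => /eqP->; apply: inV; rewrite eqxx ?orbT.
have acRc : ac R [:: c] by apply: rA; rewrite ?mem_seq1 // => y; rewrite mem_seq1 => /eqP->; apply: inV; rewrite eqxx ?orbT.
have acRP P w : ip (z :: P ++ [:: w]) -> {subset P <= F} -> ac R P.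
  move=> hP sP; apply: rA => [y /sP yF||].
  - by apply: inV; rewrite yF ?orbT.
  - by apply: contra xF => /sP.
  - by have := ip_uniq hP; rewrite cons_uniq mem_cat negb_or => /andP[/andP[-> _] _].
have RA := acRP _ _ hA sA; have RB := acRP _ _ hB sB; have RC := acRP _ _ hC sC.
have sAB : size X1 + size X2 + 2 = ga by rewrite -(k4_sAB K) EAB size_cat /=; clear; lia.
have sBC := k4_sBC K; have sCA := k4_sCA K.
have close D N : ip (z :: D ++ [:: x]) -> ac R D -> size R + size D + 2 = N -> cycle_length N.
  by move=> h1 h2 <-; exact: girth2_length R0 hR h1 h2.
have [[p1 p2 p3 p4] [p6 p5]] := k4_paths hA hB hC sA sB sC.
clear za zb zc na hA hB hC.
split; [split|split].
- apply: close p1 _ _; first by ac_goal.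
  by rewrite size_cat /= size_rev; clear -sAB; lia.
- apply: close p2 _ _; first by ac_goal.
  by rewrite size_cat /=; clear -sAB; lia.
- move=> /p3 h; apply: close h _ _; first by ac_goal.
  by rewrite !size_cat /= size_cat /= !size_rev; clear -sAB sBC; lia.
- move=> /p4 h; apply: close h _ _; first by ac_goal.
  by rewrite !size_cat /= size_cat /=; clear -sAB sCA; lia.
- move=> X10 hb /(p6 X10 hb) h; apply: close h _ _; first by ac_goal.
  by rewrite !size_cat /= !size_cat /= size_cat /= !size_rev; clear -sAB sCA sBC; lia.
move=> X20 hb /(p5 X20 hb) h; apply: close h _ _; first by ac_goal.
by rewrite !size_cat /= !size_cat /= size_cat /=; clear -sAB sCA sBC; lia.
Qed.
End Ear.

(** The number [s] is the distance from [q] to [z] along the leg, with [s = 0] for [z = q]. The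
    condition [s < al - 1] says that [z] is not adjacent to [a]. The other two legs are covered by
    rotating the K4. *)
Lemma leg_paths a b c q AB BC CA QA QB QC ga al be z :
  K4 a b c q AB BC CA QA QB QC ga al be -> z \in q :: QA ->
  exists s PA PB PC,
  [/\ s < al, size PA = al - s - 1, size PB = be + s - 1 & size PC = ga + s - 1] /\
  [/\ ip (z :: PA ++ [:: a]), ip (z :: PB ++ [:: b]) & ip (z :: PC ++ [:: c])] /\
  [/\ {subset PA <= q :: QA ++ QB ++ QC}, {subset PB <= q :: QA ++ QB ++ QC}
      & {subset PC <= q :: QA ++ QB ++ QC}] /\
  [/\ ac [:: b] (z :: PA), ac [:: b] (z :: PC), ac [:: c] (z :: PA) & ac [:: c] (z :: PB)] /\
  (s < al - 1 -> ac [:: a] (z :: PB) /\ ac [:: a] (z :: PC)).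
Proof.
move=> K zq; have /split_first[L1 [z' [Y [E /eqP zz _]]]] : has (pred1 z) (q :: QA).
  by rewrite has_pred1.
rewrite {}zz {z'} in E.
have sQA := k4_sQA K; have sQB := k4_sQB K; have sQC := k4_sQC K.
have sE : size L1 + size Y = size QA.
  by have := congr1 size E; rewrite /= size_cat /=; clear; lia.
have hqa : ip ((L1 ++ z :: Y) ++ [:: a]) by rewrite -E; apply: k4_qa K.
have subL y : y \in L1 -> y \in q :: QA by rewrite E mem_cat => ->.
have subY y : y \in Y -> y \in q :: QA by rewrite E mem_cat inE => ->; rewrite !orbT.
have hL : ip (L1 ++ [:: z]) by move: hqa; rewrite -catA cat_cons ip_glueE => /and3P[].
have leg w Q : ip (q :: Q ++ [:: w]) -> ac QA (Q ++ [:: w]) -> ip (z :: (rev L1 ++ Q) ++ [:: w]).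
  move=> hq hQ; case: L1 E hL {sE hqa subL} => [|q' L1] /= [<- EQ] hL; first by [].
  have hQ' : ac (L1 ++ z :: Y) (Q ++ [:: w]) by rewrite -EQ.
  have hz : ip ((z :: rev L1) ++ [:: q]) by apply: ip_swap.
  have -> : z :: (rev (q :: L1) ++ Q) ++ [:: w] = (z :: rev L1) ++ q :: (Q ++ [:: w]).
    by rewrite rev_cons -cats1 -!catA.
  by apply: ip_glue => //; ac_split; ac_goal.
exists (size L1), Y, (rev L1 ++ QB), (rev L1 ++ QC); rewrite !size_cat !size_rev.
split; first by split; clear -sE sQA sQB sQC; lia.
split; first split.
- by move: hqa; rewrite -catA => /ip_catr.
- by apply: leg; [apply: k4_qb K | k4_atoms; ac_goal].
- by apply: leg; [apply: k4_qc K | k4_atoms; ac_goal].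
split; first split=> y; rewrite ?(mem_cat, mem_rev).
- by move/subY; rewrite !(inE, mem_cat) => /orP[->|->]; rewrite ?orbT.
- by case/orP => [/subL|]; rewrite !(inE, mem_cat); [move=> /orP[->|->] | move=> ->]; rewrite ?orbT.
- by case/orP => [/subL|]; rewrite !(inE, mem_cat); [move=> /orP[->|->] | move=> ->]; rewrite ?orbT.
have far_leg w : ac [:: w] (q :: QA) -> [/\ ac [:: w] L1, ac [:: w] [:: z] & ac [:: w] Y].
  by rewrite E => h; ac_split; split; ac_goal.
have [b1 b2 b3] := far_leg b ltac:(k4_atoms; ac_goal).
have [c1 c2 c3] := far_leg c ltac:(k4_atoms; ac_goal).
split; first by split; k4_atoms; ac_goal.
move=> sa; case: Y E sE hqa subY {b3 c3 far_leg} => [|y Y] E sE hqa subY.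
  by move: sE sa; rewrite /= -sQA; clear; lia.
have : ip ((L1 ++ [:: z]) ++ y :: (Y ++ [:: a])) by rewrite -catA; move: hqa; rewrite -catA.
by rewrite ip_glueE => /and3P[_ _ h]; k4_atoms; split; ac_goal.
Qed.

(** Let f be the distance from a to x and s that from q to z. As [ga + al + be] is odd, two of the
    four shorter cycles are odd, so both have length n. On the legs to a and b this contradicts 0 <
    f < ga, or girth suffices if z is next to the corner. On the leg to c it gives only equal
    distances, and a cycle round the rim decides; maximality of [ga] settles the cases where that
    cycle has a chord. *)
Lemma k4_no_ear a b c q AB BC CA QA QB QC ga al be X1 x X2 z R :
  K4 a b c q AB BC CA QA QB QC ga al be -> al <= ga -> be <= ga ->
  AB = X1 ++ x :: X2 -> z \in q :: QA ++ QB ++ QC ->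
  attached (k4_verts a b c q AB BC CA QA QB QC) x z R -> False.
Proof.
move=> K ag bg EAB zF att; have H := ear_lengths K EAB zF att.
have bnd := k4_bnd K; have sum := k4_sum K.
have sAB : size X1 + size X2 + 2 = ga by rewrite -(k4_sAB K) EAB size_cat /=; clear; lia.
move: (zF); rewrite -cat_cons 2!mem_cat => /or3P[zA|zB|zC].
- have [s [PA [PB [PC [[s0 eA eB eC] [[hA hB hC] [[sA sB sC] [[a1 a2 a3 a4] a5]]]]]]]] := leg_paths K zA.
  have [[h1 h2 /(_ a2) h3 h4] _] := H PA PB PC hA hB hC sA sB sC.
  have {}h4 : s < al - 1 -> cycle_length (size R + size PC + be + (size X1).+1 + 2).
    by move=> /a5[_ /h4].
  rewrite eA eB eC in h1 h2 h3 h4.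
  case: h1 h2 h3 h4 => [_ h1] [h2 h2'] [_ h3] h4.
  have {}h4 := fun h => (h4 h).2.
  by clear -bnd sum sAB s0 h1 h2 h2' h3 h4; lia.
- have zB' : z \in q :: QB by rewrite inE zB orbT.
  have [s [PB [PC [PA [[s0 eB eC eA] [[hB hC hA] [[sB sC sA] [[a1 a2 a3 a4] a5]]]]]]]] :=
    leg_paths (k4_rot K) zB'.
  have sub (P : seq T) : {subset P <= q :: QB ++ QC ++ QA} -> {subset P <= q :: QA ++ QB ++ QC}.
    by move=> h y /h; rewrite !(inE, mem_cat) => /or4P[->|->|->|->]; rewrite ?orbT.
  have [[h1 h2 h3 /(_ a4) h4] _] := H PA PB PC hA hB hC (sub PA sA) (sub PB sB) (sub PC sC).
  have {}h3 : s < be - 1 -> cycle_length (size R + size PC + al + ga - (size X1).+1 + 2).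
    by move=> /a5[/h3].
  rewrite eA eB eC in h1 h2 h3 h4.
  case: h1 h2 h3 h4 => [h1' h1] [_ h2] h3 [_ h4].
  have {}h3 := fun h => (h3 h).2.
  by clear -bnd sum sAB s0 h1 h1' h2 h3 h4; lia.
have zC' : z \in q :: QC by rewrite inE zC orbT.
have [s [PC [PA [PB [[s0 eC eA eB] [[hC hA hB] [[sC sA sB] [[a1 a2 a3 a4] a5]]]]]]]] :=
  leg_paths (k4_rot (k4_rot K)) zC'.
have sub (P : seq T) : {subset P <= q :: QC ++ QA ++ QB} -> {subset P <= q :: QA ++ QB ++ QC}.
  by move=> h y /h; rewrite !(inE, mem_cat) => /or4P[->|->|->|->]; rewrite ?orbT.
have [[h1 h2 /(_ a3) h3 /(_ a1) h4] [h6 h5]] := H PA PB PC hA hB hC (sub PA sA) (sub PB sB) (sub PC sC).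
have {}h6 : s < ga - 1 -> 0 < size X1 -> cycle_length (size R + size PA + be + al + ga - (size X1).+1 + 2).
  by move=> /a5[/[swap] _ /[swap]]; move=> /h6 /(_ a4).
have {}h5 : s < ga - 1 -> 0 < size X2 -> cycle_length (size R + size PB + al + be + (size X1).+1 + 2).
  by move=> /a5[_ /[swap]] /h5 /(_ a2).
rewrite eA eB eC in h1 h2 h3 h4 h5 h6.
case: h1 h2 h3 h4 => [h1' h1] [h2' h2] [h3' h3] [h4' h4].
have {}h5 := fun h h' => (h5 h h').2; have {}h6 := fun h h' => (h6 h h').2.
move: (size X1) (size X2) (size R) sAB h1 h1' h2 h2' h3 h3' h4 h4' h5 h6.
clear -bnd sum s0 ag bg => f1 f2 u sAB h1 h1' h2 h2' h3 h3' h4 h4' h5 h6.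
(* Equating the two odd cycles makes [z] as far from [q] as [x] is from [a] in this case, and as far
   as [x] is from [b] in the other. *)
case: (boolP (odd (u + (be + s - 1) + ga - f1.+1 + 2))) => [/h1 E|o].
  have {E h1 h1' h2 h3 h5}Eu : u = al + f1 - s by clear -E bnd sum sAB s0; lia.
  have {h4 h4'}Es : s = f1.+1 by clear -Eu bnd sum sAB s0 h4 h4'; lia.
  have {h6}f0 : f1 = 0 \/ s = ga - 1 by clear -Es Eu bnd sum sAB s0 h6; lia.
  (* If [x] is next to [a] or [z] next to [c], a remaining cycle has [2 * al + 2] vertices. Then
     [al = l], hence [ga = l] by maximality and [be = 1], which is too small. *)
  by clear -Es Eu bnd sum sAB s0 f0 h2' h3' ag; lia.
have o2 : odd (u + (al + s - 1) + f1.+1 + 2) by clear -o bnd sum sAB s0 h1' h2'; lia.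
have {h2 h2' h1 h4 h6}Eu : u = be + f2 - s by have := h2 o2; clear -bnd sum sAB s0; lia.
have {h3 h3'}Es : s = f2.+1 by clear -Eu bnd sum sAB s0 h3 h3'; lia.
have {h5}f0 : f2 = 0 \/ s = ga - 1 by clear -Es Eu bnd sum sAB s0 h5; lia.
by clear -Es Eu bnd sum sAB s0 f0 h1' h4' bg; lia.
Qed.

(** * Connecting three labelled vertices *)

Section Tripod.
Variables (Y : T -> bool) (pc : T).

(* P joins pa to pb, and D0 ++ [:: d] leads from pc to its first contact d with P. *)
Definition tripod (pa pb : T) (P D0 : seq T) (d : T) :=
  [/\ [/\ 0 < size P, ip (pa :: P ++ [:: pb]) & all Y P],
      ip (D0 ++ [:: d]), exists2 W, D0 ++ [:: d] = pc :: W & all Y W,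
      (d \notin P) && has (e d) P & ac D0 P].

(** The good normal form: the leg from [pc] meets [P] through one edge only, and [f] becomes the
    centre of the K4. *)
Definition tripod_balanced (pa pb : T) := exists P1 f P3 D0 d,
  [/\ tripod pa pb (P1 ++ f :: P3) D0 d, e d f, ac [:: d] P1, ac [:: d] P3
    & ac (D0 ++ [:: d]) [:: pa; pb]].

(** Here [pa] has a neighbour on the leg, the first being [w], and the leg meets [P] only at the
    vertex next to [pa]. *)
Definition tripod_skew (pa pb : T) := exists f P3 D0 d G1 w G2,
  [/\ tripod pa pb (f :: P3) D0 d, e d f /\ ac [:: d] P3, ac (D0 ++ [:: d]) [:: pb],
      D0 ++ [:: d] = G1 ++ w :: G2 /\ e w pa & ac G1 [:: pa]].

(** The leg consists of [pc] alone, which has two neighbours on [P]. *)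
Definition tripod_double (pa pb : T) := exists P1 f P2 f' P3,
  [/\ ip (pa :: (P1 ++ f :: P2 ++ f' :: P3) ++ [:: pb]),
      all Y (P1 ++ f :: P2 ++ f' :: P3), pc \notin P1 ++ f :: P2 ++ f' :: P3, e pc f & e pc f'].

Lemma tripod_rev pa pb P D0 d : tripod pa pb P D0 d -> tripod pb pa (rev P) D0 d.
Proof.
move=> [[P0 hP YP] hD W hd h0]; split=> //.
- by rewrite size_rev all_rev; split=> //; apply: ip_swap.
- by rewrite mem_rev has_rev.
- by rewrite ac_revr.
Qed.

Lemma not_has_ac x s : x \notin s -> ~~ has (e x) s -> ac [:: x] s.
Proof.
move=> xs /hasPn h; apply/acP => a b; rewrite inE => /eqP-> bs; rewrite /far h // andbT.
by apply: contraNneq xs => ->.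
Qed.

Lemma ac_far_mem s t x y : ac s t -> x \in s -> y \in t -> far x y.
Proof. by move=> /acP; apply. Qed.

Section Reduce.
Variables (pa pb : T).
Hypotheses (paY : ~~ Y pa) (pbY : ~~ Y pb) (pcY : ~~ Y pc).
Hypotheses (pab : far pa pb) (pac : far pa pc) (pbc : far pb pc).

Lemma tripod_notin P D0 d : tripod pa pb P D0 d ->
  [/\ pa \notin D0 ++ [:: d], pb \notin D0 ++ [:: d] & pc \notin P].
Proof.
move=> [[_ _ YP] _ [W -> YW] _ _]; split.
- by rewrite inE negb_or (andP pac).1 /=; apply: contra paY => /(allP YW).
- by rewrite inE negb_or (andP pbc).1 /=; apply: contra pbY => /(allP YW).
- by apply: contra pcY => /(allP YP).
Qed.

(* If both pa and pb have neighbours on D0 ++ [:: d], a piece of it can replace P. *)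
Lemma tripod_cut P D0 d : tripod pa pb P D0 d ->
  (exists G1 w G2, [/\ D0 ++ [:: d] = G1 ++ w :: G2, e pb w, ~~ has (e pb) G1 &
     has (e pa) (G1 ++ [:: w])]) ->
  exists P' D0' d', tripod pa pb P' D0' d' /\ size P' + size D0' < size P + size D0.
Proof.
move=> tri [G1 [w [G2 [ED ew nG1 /split_last[H1 [y [H2 [EH ey nH2]]]]]]]].
have [paD pbD pcP] := tripod_notin tri.
have [[P0 hP YP] hD [W EW YW] hd h0] := tri.
have hGw : ip (H1 ++ y :: H2) by rewrite -EH cats1; move: hD; rewrite ED -cat_rcons; apply: ip_catl.
have ED' : D0 ++ [:: d] = H1 ++ (y :: H2 ++ G2) by rewrite ED -cat_rcons -cats1 EH -catA.
have subD z : z \in H1 ++ y :: H2 -> z \in D0 ++ [:: d].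
  by rewrite ED' !(mem_cat, inE) => /or3P[->|->|->]; rewrite ?orbT.
case/lastP: H1 EH hGw ED' subD => [|H1 d'] EH hGw ED' subD.
  move: ED'; rewrite EW => -[Ey _]; have := andP pac; rewrite Ey; move: ey => /= ->.
  by case.
exists (y :: H2), H1, d'.
have := hGw; rewrite ip_glueE => /and3P[hH1 hH2 acH].
have sz : size H1 + size H2 + 2 <= size D0 + 1.
  have := congr1 size ED'; rewrite !size_cat /= size_rcons size_cat; clear; lia.
split; last by clear -sz P0; rewrite /=; lia.
have subY z : z \in y :: H2 -> Y z.
  move=> zH; apply: (allP YW); have : z \in pc :: W.
    by rewrite -EW; apply: subD; rewrite mem_cat zH orbT.
  rewrite inE => /predU1P[zpc|//].
  have : uniq (rcons H1 d' ++ y :: H2) := ip_uniq hGw.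
  rewrite cat_uniq => /and3P[_ /hasPn/(_ z zH) + _].
  have : pc \in rcons H1 d'.
    by move: ED'; rewrite EW; case: (H1) => [|? ?] [-> _]; rewrite mem_head.
  by rewrite zpc => ->.
have far_pb : ac [:: pb] G1.
  apply: not_has_ac => //; apply: contra pbD; rewrite ED mem_cat => ->; exact: isT.
have far_pa : ac [:: pa] H2.
  by apply: not_has_ac => //; apply: contra paD => h; apply: subD; rewrite mem_cat inE h !orbT.
have pH2 : ip (pa :: (y :: H2) ++ [:: pb]).
  rewrite -[_ :: _]/[:: pa, y & H2 ++ [:: pb]] ip_cons2 ac_catr ac11 ey far_pa pab /=.
  case/lastP: H2 EH {hGw ED' subD acH sz subY nH2 far_pa} hH2 => [|H2 w'] EH hH2.
    move: EH; rewrite !cats1 => /rcons_inj[_ <-]; by rewrite ip2 e_sym.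
  move: EH; rewrite cats1 -rcons_cons -rcons_cat => /rcons_inj[EG Ew].
  rewrite -cats1 -catA /= -[y :: _]/((y :: H2) ++ w' :: [:: pb]).
  apply: ip_glue; first by rewrite /= cats1.
    by rewrite ip2 -Ew e_sym.
  by rewrite ac_sym; move: far_pb; rewrite EG ac_catr => /andP[].
split=> //.
- by split=> //; apply/allP.
- by move: hH1 => /ip_catl; rewrite cats1.
- have [W1 EW1] : exists W1, rcons H1 d' = pc :: W1.
    by move: ED'; rewrite EW; case: (H1) => [|z1 H1'] [-> _]; [exists [::] | exists (rcons H1' d')].
  exists W1; rewrite ?cats1 //; apply/allP => z zW; apply: (allP YW).
  by move: ED'; rewrite EW EW1 => -[->]; rewrite mem_cat zW.
- have edy : e d' y.
    have : ip (H1 ++ d' :: y :: H2) by rewrite -cat_rcons.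
    by move=> /ip_catr; rewrite ip_cons2 => /andP[].
  rewrite /= edy andbT; have := ip_uniq hGw; rewrite cat_uniq => /and3P[_ /hasPn h _].
  by apply/negP => /h; rewrite mem_rcons mem_head.
have : ip (H1 ++ d' :: y :: H2) by rewrite -cat_rcons.
by rewrite ip_glueE => /and3P[].
Qed.

Lemma tripod_far P D0 d s : tripod pa pb P D0 d -> {subset s <= D0 ++ [:: d]} ->
  (~~ has (e pa) s -> ac [:: pa] s) /\ (~~ has (e pb) s -> ac [:: pb] s).
Proof.
move=> tri hs; have [paD pbD _] := tripod_notin tri.
by split=> h; apply: not_has_ac => //; [apply: contra paD | apply: contra pbD] => /hs.
Qed.

Lemma tripod_prefix D0 d W E1 w E2 : D0 ++ [:: d] = pc :: W -> D0 ++ [:: d] = E1 ++ w :: E2 ->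
  all Y W -> 0 < size E1 ->
  exists E0 d', [/\ E1 = E0 ++ [:: d'], exists2 W', E1 = pc :: W' & all Y W' & all Y (w :: E2)].
Proof.
move=> -> E YW; case: E1 E => [//|z E1] [<- EW] _; exists (belast pc E1), (last pc E1).
rewrite cats1 -lastI; move: YW; rewrite EW all_cat => /andP[h1 h2].
by split=> //; exists E1.
Qed.

(** If the last neighbour [f] of [d] on [P] is not the first vertex of [P], go from [pa] to its last
    neighbour [w] on the leg, along the leg to [d], and on through [f] to [pb]. The part of the leg
    before [w] is the new leg, and the nonempty part of [P] before [f] is saved. *)
Lemma tripod_one_sided P D0 d : tripod pa pb P D0 d ->
  has (e pa) (D0 ++ [:: d]) -> ~~ has (e pb) (D0 ++ [:: d]) ->
  tripod_skew pa pb \/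
  exists P' D0' d', tripod pa pb P' D0' d' /\ size P' + size D0' < size P + size D0.
Proof.
move=> tri hA hB; have [paD pbD pcP] := tripod_notin tri.
have [[P0 hP YP] hD [W EW YW] /andP[dP hd] h0] := tri.
have fB : ac [:: pb] (D0 ++ [:: d]) by apply: (tripod_far tri _).2.
have [P1 [f [P3 [EP edf nP3]]]] := split_last hd.
have dP3 : ac [:: d] P3.
  by apply: not_has_ac => //; apply: contra dP => h; rewrite EP mem_cat inE h !orbT.
case: P1 EP => [|p1 P1] EP.
  left; have [G1 [w [G2 [ED ew nG1]]]] := split_first hA.
  exists f, P3, D0, d, G1, w, G2; rewrite /= in EP; rewrite -EP; split=> //.
  - by rewrite ac_sym.
  - by rewrite e_sym.
  rewrite ac_sym; apply: (tripod_far tri _).1 => // z zG.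
  by rewrite ED mem_cat zG.
right; have [E1 [w [E2 [ED ew nE2]]]] := split_last hA.
have E10 : 0 < size E1.
  case: E1 ED => // E; move: EW; rewrite E => -[Ew _].
  by have := (andP pac).2; rewrite -Ew ew.
have [E0 [d' [EE [W' EW' YW'] Ywe]]] := tripod_prefix EW ED YW E10.
have {}hP : ip (pa :: ((p1 :: P1) ++ f :: P3) ++ [:: pb]) by rewrite -EP.
have hfP : ip (f :: P3 ++ [:: pb]).
  by have := @ip_catr (pa :: p1 :: P1) (f :: P3 ++ [:: pb]); rewrite /= -catA in hP *; apply.
have paP : ac [:: pa] (f :: P3 ++ [:: pb]).
  move: hP; rewrite -catA /= -[pa :: _]/[:: pa, p1 & (P1 ++ (f :: P3) ++ [:: pb])] ip_cons2.
  by rewrite ac_catr => /and3P[_ /andP[_]].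
have hlong : ip ((D0 ++ [:: d]) ++ f :: P3 ++ [:: pb]).
  rewrite -catA /=; apply: ip_glue => //.
    rewrite ip_cons2 edf hfP andbT ac_catr dP3 /=; move: fB; rewrite ac_sym ac_catl.
    by case/andP.
  rewrite -cat_cons ac_catr; move: h0; rewrite EP ac_catr => /andP[_ ->] /=.
  by move: fB; rewrite ac_sym ac_catl => /andP[].
have h1 : ip (E0 ++ d' :: (w :: (E2 ++ f :: P3) ++ [:: pb])).
  have -> : E0 ++ d' :: (w :: (E2 ++ f :: P3) ++ [:: pb]) = (D0 ++ [:: d]) ++ f :: P3 ++ [:: pb].
    by rewrite ED EE -!catA.
  exact: hlong.
have := h1; rewrite ip_glueE => /and3P[h2 h3 h4].
exists (w :: E2 ++ f :: P3), E0, d'; split; last first.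
  have := congr1 size ED; rewrite EE EP !size_cat /= size_cat /=; clear; lia.
split.
- split=> //; last first.
    move: Ywe; rewrite -cat_cons all_cat => -> /=.
    by move: YP; rewrite EP all_cat => /andP[_].
  rewrite -[_ :: _]/[:: pa, w & (E2 ++ f :: P3) ++ [:: pb]] ip_cons2 e_sym.
  have h5 : ip (w :: (E2 ++ f :: P3) ++ [:: pb]) by exact: ip_catr [:: d'] _ h3.
  rewrite h5 andbT; apply/andP; split; first by rewrite e_sym.
  rewrite -catA ac_catr; apply/andP; split; last exact: paP.
  apply: (tripod_far tri _).1 => // z zE.
  by rewrite ED mem_cat inE zE !orbT.
- by [].
- by rewrite -EE; exists W'.
- have := h3; rewrite ip_cons2 => /and3P[edw _ _]; rewrite /= edw andbT.
  have := ip_uniq h3; rewrite cons_uniq => /andP[+ _].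
  by apply: contra => h; rewrite -[w :: _]/((w :: E2 ++ f :: P3) ++ [:: pb]) mem_cat h.
by move: h4; rewrite -[w :: _]/((w :: E2 ++ f :: P3) ++ [:: pb]) ac_catr => /andP[].
Qed.

Lemma tripod_two_sided (p1 p2 : T) s : has (e p1) s -> has (e p2) s ->
  (exists G1 w G2, [/\ s = G1 ++ w :: G2, e p2 w, ~~ has (e p2) G1 & has (e p1) (G1 ++ [:: w])]) \/
  (exists G1 w G2, [/\ s = G1 ++ w :: G2, e p1 w, ~~ has (e p1) G1 & has (e p2) (G1 ++ [:: w])]).
Proof.
elim: s => //= x s IH.
have case_x q1 q2 : e q1 x -> e q2 x || has (e q2) s ->
    exists G1 w G2, [/\ x :: s = G1 ++ w :: G2, e q2 w, ~~ has (e q2) G1 & has (e q1) (G1 ++ [:: w])].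
  move=> h1 h2; have [[|y G1] [w [G2 [E ew nG]]]] := @split_first (e q2) (x :: s) h2.
    by exists [::], w, G2; split=> //=; case: E => <- _; rewrite h1.
  by exists (y :: G1), w, G2; split=> //=; case: E => <- _; rewrite h1.
have [h1|n1] := boolP (e p1 x); first by move=> _ /(case_x _ _ h1); left.
have [h2|n2] := boolP (e p2 x); first by move=> /= hs _; right; apply: (case_x _ _ h2); rewrite hs orbT.
move=> /= s1 s2; have [[G1 [w [G2 [-> ew nG h]]]]|[G1 [w [G2 [-> ew nG h]]]]] := IH s1 s2.
  by left; exists (x :: G1), w, G2; split=> //=; rewrite ?h ?orbT // negb_or n2.
by right; exists (x :: G1), w, G2; split=> //=; rewrite ?h ?orbT // negb_or n1.
Qed.

(** If [d] has two neighbours on [P], take the first and the last and reroute [P] through [d]. There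
    is no triangle, so the part of [P] between them is nonempty, and moving [d] from the leg to [P]
    decreases the total size. When [d] is all of the leg, this is the double case. *)
Lemma tripod_zero_sided P D0 d : tripod pa pb P D0 d ->
  ~~ has (e pa) (D0 ++ [:: d]) -> ~~ has (e pb) (D0 ++ [:: d]) ->
  [\/ tripod_balanced pa pb, tripod_double pa pb |
   exists P' D0' d', tripod pa pb P' D0' d' /\ size P' + size D0' < size P + size D0].
Proof.
move=> tri hA hB; have [paD pbD pcP] := tripod_notin tri.
have [[P0 hP YP] hD [W EW YW] /andP[dP hd] h0] := tri.
have fA : ac [:: pa] (D0 ++ [:: d]) by apply: (tripod_far tri _).1.
have fB : ac [:: pb] (D0 ++ [:: d]) by apply: (tripod_far tri _).2.
have [P1 [f [Q [EP edf nP1]]]] := split_first hd.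
have dP1 : ac [:: d] P1.
  by apply: not_has_ac => //; apply: contra dP => h; rewrite EP mem_cat h.
have [hQ|nQ] := boolP (has (e d) Q); last first.
  constructor 1; exists P1, f, Q, D0, d; rewrite -EP; split=> //.
    by apply: not_has_ac => //; apply: contra dP => h; rewrite EP mem_cat inE h !orbT.
  by rewrite ac_sym ac_consl fA.
have [P2 [f' [P3 [EQ edf' nP3]]]] := split_last hQ.
have dP3 : ac [:: d] P3.
  apply: not_has_ac => //; apply: contra dP => h.
  by rewrite EP EQ !(mem_cat, inE) h !orbT.
case/lastP: D0 EW tri h0 hD fA fB {hA hB paD pbD} => [|E0 d'] EW tri h0 hD fA fB.
  constructor 2; case: EW => E _; exists P1, f, P2, f', P3.
  by rewrite -EQ -EP -E; split=> //; rewrite E.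
have {}hP : ip ((pa :: P1) ++ f :: P2 ++ f' :: P3 ++ [:: pb]).
  by move: hP; rewrite EP EQ -!catA /= -catA.
have := hP; rewrite ip_glueE => /and3P[hP1 hf aP].
have f_f' : 0 < size P2.
  case: (P2) hf => // /andP[eff' _]; have l5 := l_ge; exfalso.
  have dff : d \notin [:: f; f'].
    apply: contra dP; rewrite EP EQ !inE => /orP[]/eqP->; rewrite !(mem_cat, inE) eqxx ?orbT //.
  have := @girth_close f [:: f'] d; rewrite /= eff' edf edf' dff inE.
  have -> : f != f' by apply: contraTneq eff' => ->; rewrite e_irr.
  by move=> /(_ isT isT isT isT isT isT); clear -l5; lia.
have hf2 : ip ((f :: P2) ++ f' :: (P3 ++ [:: pb])) by exact: hf.
have := hf2; rewrite ip_glueE => /and3P[hf3 hf' aP2].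
have ff' := ip_ends_far f_f' hf3.
constructor 3; exists (P1 ++ f :: d :: f' :: P3), E0, d'; split; last first.
  by rewrite EP EQ !size_cat /= size_cat /= size_rcons; clear -f_f'; lia.
have dY : Y d.
  apply: (allP YW); move: EW; rewrite -cats1 -catA; case: (E0) => [|z E] /= [_ <-]; first exact: mem_head.
  by rewrite mem_cat !inE eqxx !orbT.
have hEd : ip (E0 ++ d' :: [:: d]) by move: hD; rewrite -cats1 -catA.
have := hEd; rewrite ip_glueE ip2 => /and3P[hE0 ed'd aEd].
have d'P : d' \notin P by apply: (ac_notin h0); rewrite mem_rcons mem_head.
have d'd : d' != d by apply: contraTneq ed'd => ->; rewrite e_irr.
rewrite EP EQ in h0; rewrite -cats1 in fA fB h0; ac_split.
split.
- split; first by rewrite size_cat /=; clear; lia.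
    rewrite -catA; apply: (@ip_glue (pa :: P1) f ([:: d, f' & P3 ++ [:: pb]])) => //.
      have hdf : ip (d :: f' :: (P3 ++ [:: pb])).
        by rewrite ip_cons2 edf' hf' andbT andTb; ac_goal.
      by rewrite ip_cons2 e_sym edf hdf andbT andTb -ac11 in ff' *; ac_goal.
    by ac_goal.
  by move: YP; rewrite EP EQ !all_cat /= all_cat /= dY => /and4P[-> -> _ /andP[-> ->]].
- by [].
- move: EW; rewrite -cats1; case: (E0) => [|z E]; first by case=> -> _; exists [::].
  case=> -> EW; exists (E ++ [:: d']) => //; apply/allP => y yE; apply: (allP YW).
  by rewrite -EW mem_cat yE.
- rewrite has_cat /= ed'd !orbT andbT; apply: contra d'P.
  by rewrite EP EQ !(mem_cat, inE) (negbTE d'd) => /or4P[->|->|//|/orP[->|->]]; rewrite ?orbT.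
by ac_goal.
Qed.
End Reduce.

(** A tripod with [size P + size D0] minimal admits none of the reductions. *)
Lemma tripod_normal pa pb P D0 d : ~~ Y pa -> ~~ Y pb -> ~~ Y pc ->
  far pa pb -> far pa pc -> far pb pc -> tripod pa pb P D0 d ->
  [\/ tripod_balanced pa pb, tripod_double pa pb, tripod_skew pa pb | tripod_skew pb pa].
Proof.
move=> Ya Yb Yc ab ac' bc; have ba : far pb pa by rewrite far_sym.
have [k] := ubnP (size P + size D0); elim: k P D0 d => // k IH P D0 d sk tri.
have smaller : (exists P' D0' d', tripod pa pb P' D0' d' /\
    size P' + size D0' < size P + size D0) ->
  [\/ tripod_balanced pa pb, tripod_double pa pb, tripod_skew pa pb | tripod_skew pb pa].
  by move=> [P' [D0' [d' [tri' h]]]]; apply: (IH P' D0' d') tri'; clear -h sk; lia.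
have smaller' : (exists P' D0' d', tripod pb pa P' D0' d' /\
    size P' + size D0' < size (rev P) + size D0) ->
  [\/ tripod_balanced pa pb, tripod_double pa pb, tripod_skew pa pb | tripod_skew pb pa].
  rewrite size_rev => -[P' [D0' [d' [tri' h]]]]; apply: smaller.
  by exists (rev P'), D0', d'; rewrite size_rev; split=> //; apply: tripod_rev.
have tri' := tripod_rev tri.
have [hA|hA] := boolP (has (e pa) (D0 ++ [:: d])); have [hB|hB] := boolP (has (e pb) (D0 ++ [:: d])).
- case: (tripod_two_sided hA hB) => h.
    by apply: smaller; apply: (tripod_cut Ya Yb Yc ab ac' bc tri).
  by apply: smaller'; apply: (tripod_cut Yb Ya Yc ba bc ac' tri').
- by case: (tripod_one_sided Ya Yb Yc ac' bc tri hA hB); [constructor 3 | apply: smaller].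
- by case: (tripod_one_sided Yb Ya Yc bc ac' tri' hB hA); [constructor 4 | apply: smaller'].
by case: (tripod_zero_sided Ya Yb Yc ac' bc tri hA hB) => h; [constructor 1|constructor 2|apply: smaller].
Qed.
End Tripod.

(** * Jumps contained in a tripod *)

Section TripodHole.
Variable c : nat -> T.
Hypothesis Hc : is_hole c.
Local Notation n := (2 * l + 1).

Lemma unl_list_arc s i m : all (unlabelled c) s -> ac s (arc c i m).
Proof.
move=> /allP h; apply/acP => x y xs ya.
by apply: ac_far_mem (unl_arc Hc i m (h x xs)) _ ya; rewrite mem_head.
Qed.

Lemma tripod_leg (f : T) (P3 D0 : seq T) (d p2 : T) :
  ip (f :: P3 ++ [:: p2]) -> ip (D0 ++ [:: d]) -> e d f -> ac [:: d] P3 ->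
  ac (D0 ++ [:: d]) [:: p2] -> ac D0 (f :: P3) -> ip (D0 ++ d :: f :: P3 ++ [:: p2]).
Proof.
move=> hf hd edf dP3 dp2 h0; ac_split.
apply: (@ip_glue D0 d (f :: P3 ++ [:: p2])) => //; last by ac_goal.
by rewrite ip_cons2 edf hf andbT andTb; ac_goal.
Qed.

Variables (Y : T -> bool) (pa pb pc : T) (i j k : nat).
Hypothesis Yu : forall y, Y y -> unlabelled c y.
Hypotheses (la : lab c i pa) (lb : lab c j pb) (lc : lab c k pc).
Hypotheses (ij : far (c i) (c j)) (ik : far (c i) (c k)) (jk : far (c j) (c k)).

Lemma all_unl s : all Y s -> all (unlabelled c) s.
Proof. by apply: sub_all. Qed.

Lemma tripod_jump_ab P D0 d : tripod Y pc pa pb P D0 d ->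
  jump c (c i) (c j) (pa :: P ++ [:: pb]).
Proof. by move=> [[_ hP YP] _ _ _ _]; apply: lab_path_jump => //; apply: all_unl. Qed.

Lemma tripod_jump_cb P1 f P3 D0 d : tripod Y pc pa pb (P1 ++ f :: P3) D0 d ->
  e d f -> ac [:: d] P3 -> ac (D0 ++ [:: d]) [:: pb] ->
  jump c (c k) (c j) (D0 ++ d :: f :: P3 ++ [:: pb]).
Proof.
move=> [[_ hP YP] hD [W EW YW] _ h0] edf dP3 dpb.
have hf : ip (f :: P3 ++ [:: pb]).
  by move: hP; rewrite -catA -cat_cons => /ip_catr.
rewrite ac_catr in h0; have [_ h0'] := andP h0.
have hL := tripod_leg hf hD edf dP3 dpb h0'.
have E : D0 ++ d :: f :: P3 ++ [:: pb] = pc :: (W ++ f :: P3) ++ [:: pb].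
  by rewrite -cat_rcons -cats1 EW /= -catA.
rewrite E in hL *; apply: lab_path_jump => //; first by rewrite far_sym.
by rewrite all_cat !all_unl //; move: YP; rewrite all_cat => /andP[].
Qed.

Lemma tripod_jump_ca P D0 d G1 w G2 : tripod Y pc pa pb P D0 d ->
  D0 ++ [:: d] = G1 ++ w :: G2 -> e w pa -> ac G1 [:: pa] ->
  0 < size G1 /\ jump c (c k) (c i) (G1 ++ w :: [:: pa]).
Proof.
move=> [_ hD [W EW YW] _ _] ED ew hG.
case: G1 ED hG => [|z G1] ED hG.
  move: ED; rewrite EW => -[Ew _]; have := lab_nadj Hc lc la.
  by rewrite Ew ew.
split=> //; have Ez : z = pc by move: ED; rewrite EW => -[].
have -> : (z :: G1) ++ [:: w; pa] = pc :: (G1 ++ [:: w]) ++ [:: pa] by rewrite -catA Ez.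
apply: lab_path_jump => //; first by rewrite far_sym.
  rewrite -catA /= -[pc :: _]/((pc :: G1) ++ w :: [:: pa]) -Ez.
  apply: ip_glue; rewrite ?ip2 //.
  by move: hD; rewrite ED -cat_rcons -cats1 => /ip_catl.
apply: all_unl; move: ED; rewrite EW => -[_ EW']; move: YW.
by rewrite EW' -cat_rcons -cats1 all_cat => /andP[].
Qed.
End TripodHole.

(** * From a tripod to a balanced K4 *)

Section TripodK4.
Variable c : nat -> T.
Hypothesis Hc : is_hole c.
Local Notation n := (2 * l + 1).
Variables (Y : T -> bool) (pa pb pc : T) (ga al be : nat).
Hypotheses (ga2 : 2 <= ga) (al2 : 2 <= al) (be2 : 2 <= be) (sum : ga + al + be = n).
Hypothesis Yu : forall y, Y y -> unlabelled c y.
Hypotheses (la : lab c 0 pa) (lb : lab c ga pb) (lc : lab c (ga + al) pc).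

Lemma gap_far : [/\ far (c 0) (c ga), far (c 0) (c (ga + al)) & far (c ga) (c (ga + al))].
Proof. by have l5 := l_ge; split; apply: (hole_far Hc); clear -ga2 al2 be2 sum; lia. Qed.

Lemma jump_sizes R1 R2 R3 :
  [/\ jump c (c 0) (c ga) R1 -> size R1 = maxn (ga - 1) (n - ga - 1),
      jump c (c (ga + al)) (c ga) R2 -> size R2 = maxn (al - 1) (n - al - 1) &
      jump c (c (ga + al)) (c 0) R3 -> size R3 = maxn (be - 1) (n - be - 1)].
Proof.
have l5 := l_ge; split=> h.
- by rewrite (jump_size Hc h); [congr maxn|]; clear -ga2 al2 be2 sum; lia.
- have := jump_size Hc (jump_rev h); rewrite size_rev => ->.
    by congr maxn; clear -ga2 al2 be2 sum; lia.
  by clear -ga2 al2 be2 sum; lia.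
rewrite -(hole_per Hc 0) in h; rewrite (jump_size Hc h).
  by congr maxn; clear -ga2 al2 be2 sum; lia.
by clear -ga2 al2 be2 sum; lia.
Qed.

(** The cycle formed by [pc] and the part of [P] between its two neighbours has fewer vertices than
    the jump along [P], which has fewer than n. *)
Lemma tripod_not_double : ~ tripod_double Y pc pa pb.
Proof.
move=> [P1 [f [P2 [f' [P3 [hP YP pcP ef ef']]]]]]; have l5 := l_ge.
have [f1 _ _] := gap_far.
have J := lab_path_jump Hc la lb f1 hP (all_unl Yu YP).
have [h _ _] := jump_sizes (pa :: (P1 ++ f :: P2 ++ f' :: P3) ++ [:: pb]) [::] [::].
have {h J} := h J; rewrite /= !size_cat /= size_cat /= => sP.
have hs : ip (f :: P2 ++ [:: f']).
  have : ip ((pa :: P1) ++ (f :: P2 ++ [:: f']) ++ P3 ++ [:: pb]).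
    by move: hP; rewrite /= -!catA /= -!catA.
  by move=> /ip_catr/ip_catl.
have pcs : pc \notin f :: P2 ++ [:: f'].
  by apply: contra pcP; rewrite !(inE, mem_cat) => /or3P[->|->|->]; rewrite ?orbT.
have := girth_close (ip_path hs) (ip_uniq hs) pcs _ ef.
rewrite last_cat /= size_cat /= => h; have {h} := h _ ef'.
by clear -sP sum ga2 al2 be2 l5; lia.
Qed.

(** In a skew tripod the three jumps overlap so that the one from [pc] to the far end has at least
    as many vertices as the other two together, less 2. The sizes dictated by the gaps satisfy a
    triangle inequality with more slack than that. *)
Lemma tripod_not_balanced_gaps (M1 M2 M3 : nat) :
  M1 = maxn (ga - 1) (n - ga - 1) -> M2 = maxn (al - 1) (n - al - 1) ->
  M3 = maxn (be - 1) (n - be - 1) -> M2 + 2 < M1 + M3 /\ M3 + 2 < M1 + M2.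
Proof. by have l5 := l_ge; clear -ga2 al2 be2 sum l5; lia. Qed.

Lemma tripod_not_skew : ~ tripod_skew Y pc pa pb.
Proof.
move=> [f [P3 [D0 [d [G1 [w [G2 [tri [edf dP3] dpb [ED ewa] hG]]]]]]]].
have [f1 f2 f3] := gap_far.
have J1 := tripod_jump_ab Hc Yu la lb f1 tri.
have J2 := tripod_jump_cb Hc Yu lb lc f3 (P1 := [::]) tri edf dP3 dpb.
have [G10 J3] := tripod_jump_ca Hc Yu la lc f2 tri ED ewa hG.
have [/(_ J1) E1 /(_ J2) E2 /(_ J3) E3] := jump_sizes (pa :: (f :: P3) ++ [:: pb])
  (D0 ++ d :: f :: P3 ++ [:: pb]) (G1 ++ w :: [:: pa]).
have [] := tripod_not_balanced_gaps E1 E2 E3.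
have := congr1 size ED; rewrite /= !size_cat /= size_cat /=; clear; lia.
Qed.

Lemma tripod_not_skew' : ~ tripod_skew Y pc pb pa.
Proof.
move=> [f [P3 [D0 [d [G1 [w [G2 [tri [edf dP3] dpb [ED ewa] hG]]]]]]]].
have [f1 f2 f3] := gap_far; have f1' : far (c ga) (c 0) by rewrite far_sym.
have J1 := tripod_jump_ab Hc Yu lb la f1' tri.
have J2 := tripod_jump_cb Hc Yu la lc f2 (P1 := [::]) tri edf dP3 dpb.
have [G10 J3] := tripod_jump_ca Hc Yu lb lc f3 tri ED ewa hG.
have [/(_ (jump_rev J1)) E1 /(_ J3) E2 /(_ J2) E3] := jump_sizes (rev (pb :: (f :: P3) ++ [:: pa]))
  (G1 ++ w :: [:: pb]) (D0 ++ d :: f :: P3 ++ [:: pa]).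
have [_] := tripod_not_balanced_gaps E1 E2 E3.
have := congr1 size ED; rewrite size_rev /= !size_cat /= size_cat /=; clear; lia.
Qed.

(** The three feet on the hole are the corners, the arcs between them the rim, and each leg at [f]
    takes in the labelled vertex at its end. *)
Lemma tripod_balanced_k4 : tripod_balanced Y pc pa pb ->
  exists q AB BC CA QA QB QC,
    K4 (c 0) (c ga) (c (ga + al)) q AB BC CA QA QB QC ga al be.
Proof.
move=> [P1 [f [P3 [D0 [d [tri edf dP1 dP3 dab]]]]]]; have l5 := l_ge.
have [f1 f2 f3] := gap_far.
have [[_ hP YP] hD [W EW YW] _ h0] := tri.
have tri' : tripod Y pc pb pa (rev P3 ++ f :: rev P1) D0 d.
  by have := tripod_rev tri; rewrite rev_cat rev_cons cat_rcons.
have [da db] : ac (D0 ++ [:: d]) [:: pa] /\ ac (D0 ++ [:: d]) [:: pb].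
  by move: dab; rewrite ac_consr => /andP[].
have dP1' : ac [:: d] (rev P1) by rewrite ac_revr.
have J1 := tripod_jump_ab Hc Yu la lb f1 tri.
have J2 := tripod_jump_cb Hc Yu lb lc f3 tri edf dP3 db.
have J3 := tripod_jump_cb Hc Yu la lc f2 tri' edf dP1' da.
have [/(_ J1) E1 /(_ J2) E2 /(_ J3) E3] := jump_sizes (pa :: (P1 ++ f :: P3) ++ [:: pb])
  (D0 ++ d :: f :: P3 ++ [:: pb]) (D0 ++ d :: f :: rev P1 ++ [:: pa]).
move: E1 E2 E3; rewrite /= !size_cat /= !size_cat /= size_rev => E1 E2 E3.
exists f, (arc c 1 (ga - 1)), (arc c ga.+1 (al - 1)), (arc c (ga + al).+1 (be - 1)),
  (rev P1 ++ [:: pa]), (P3 ++ [:: pb]), (rev (D0 ++ [:: d])).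
have [Y1 [Yf Y3]] : all Y P1 /\ Y f /\ all Y P3.
  by move: YP; rewrite all_cat /= => /and3P[].
have P1D : all (unlabelled c) P1 := all_unl Yu Y1.
have P3D : all (unlabelled c) P3 := all_unl Yu Y3.
have WD : all (unlabelled c) W := all_unl Yu YW.
have arcs p x i m : lab c p x -> c p \notin arc c i m -> ac [:: x] (arc c i m) by apply: lab_arc.
have aA i m : c 0 \notin arc c i m -> ac (rev P1 ++ [:: pa]) (arc c i m).
  by move=> h; have := lab_arc Hc la h; have := unl_list_arc Hc i m P1D; move=> ? ?; ac_goal.
have aB i m : c ga \notin arc c i m -> ac (P3 ++ [:: pb]) (arc c i m).
  by move=> h; have := lab_arc Hc lb h; have := unl_list_arc Hc i m P3D; move=> ? ?; ac_goal.
have aC i m : c (ga + al) \notin arc c i m -> ac (rev (D0 ++ [:: d])) (arc c i m).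
  move=> h; have := lab_arc Hc lc h; have := unl_list_arc Hc i m WD; rewrite EW => ? ?.
  by rewrite ac_revl ac_consl; apply/andP.
have af i m : ac [:: f] (arc c i m) := unl_arc Hc i m (Yu Yf).
have n1 i j m : i + m <= j < i + n -> c j \notin arc c i m by apply: notin_arc.
have n0 i m : 0 < i -> i + m <= n -> c 0 \notin arc c i m.
  by move=> h1 h2; rewrite -(hole_per Hc 0); apply: n1; clear -h1 h2; lia.
have n2 i j m : j < i -> i + m <= j + n -> c j \notin arc c i m.
  by move=> h1 h2; rewrite -(hole_per Hc j); apply: n1; clear -h1 h2; lia.
have cyc0 : c 0 = c (ga + al + be) by rewrite sum -(hole_per Hc 0).
(* The three jumps are the pairs of legs, so their sizes determine the legs. A gap greater than l
   would change the parity of the sum of the three sizes, which is odd because every leg is counted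
   twice. *)
have [sP1 sP3 sD bnd] : [/\ size P1 + 2 = al, size P3 + 2 = be, size D0 + 2 = ga &
    [&& 2 <= ga <= l, 2 <= al <= l & 2 <= be <= l]].
  by split; clear -E1 E2 E3 ga2 al2 be2 sum; lia.
have ip1 : ip (c 0 :: arc c 1 (ga - 1) ++ [:: c ga]).
  by apply: (@ip_arc_closed c Hc 0 ga); clear -bnd l5; lia.
have ip2' : ip (c ga :: arc c ga.+1 (al - 1) ++ [:: c (ga + al)]).
  have -> : al - 1 = ga + al - ga.+1 by clear; lia.
  by apply: ip_arc_closed => //; clear -bnd l5; lia.
have ip3' : ip (c (ga + al) :: arc c (ga + al).+1 (be - 1) ++ [:: c 0]).
  have -> : be - 1 = ga + al + be - (ga + al).+1 by clear; lia.
  by rewrite cyc0; apply: ip_arc_closed => //; clear -bnd l5; lia.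
have a12 : ac (arc c 1 (ga - 1)) (arc c ga.+1 (al - 1)).
  by apply: (ac_arc Hc); clear -bnd sum; lia.
have a13 : ac (arc c 1 (ga - 1)) (arc c (ga + al).+1 (be - 1)).
  by apply: (ac_arc Hc); clear -bnd sum; lia.
have a23 : ac (arc c ga.+1 (al - 1)) (arc c (ga + al).+1 (be - 1)).
  by apply: (ac_arc Hc); clear -bnd sum; lia.
have a1c : ac (arc c 1 (ga - 1)) (arc c (ga + al) 1).
  by apply: (ac_arc Hc); clear -bnd sum; lia.
have a2a : ac (arc c ga.+1 (al - 1)) (arc c (0 + n) 1).
  by apply: (ac_arc Hc); clear -bnd sum; lia.
have a3b : ac (arc c ga 1) (arc c (ga + al).+1 (be - 1)).
  by apply: (ac_arc Hc); clear -bnd sum; lia.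
rewrite /arc /= -[_ :: _]/(map c [:: 0 + n]) /= (hole_per Hc 0) -/(arc c _ _) in a2a.
rewrite {2}/arc /= in a1c; rewrite {1}/arc /= in a3b.
have A1 := aA 1 (ga - 1) ltac:(apply: n0; clear -bnd sum; lia).
have A2 := aA ga.+1 (al - 1) ltac:(apply: n0; clear -bnd sum; lia).
have A3 := aA (ga + al).+1 (be - 1) ltac:(apply: n0; clear -bnd sum; lia).
have Ab : ac (rev P1 ++ [:: pa]) [:: c ga] := aA ga 1 ltac:(apply: n0; clear -bnd sum; lia).
have Ac : ac (rev P1 ++ [:: pa]) [:: c (ga + al)] := aA (ga + al) 1 ltac:(apply: n0; clear -bnd sum; lia).
have B1 := aB 1 (ga - 1) ltac:(apply: n1; clear -bnd sum; lia).
have B2 := aB ga.+1 (al - 1) ltac:(apply: n2; clear -bnd sum; lia).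
have B3 := aB (ga + al).+1 (be - 1) ltac:(apply: n2; clear -bnd sum; lia).
have Ba : ac (P3 ++ [:: pb]) [:: c 0] := aB 0 1 ltac:(apply: n1; clear -bnd sum; lia).
have Bc : ac (P3 ++ [:: pb]) [:: c (ga + al)] := aB (ga + al) 1 ltac:(apply: n2; clear -bnd sum; lia).
have C1 := aC 1 (ga - 1) ltac:(apply: n1; clear -bnd sum; lia).
have C2 := aC ga.+1 (al - 1) ltac:(apply: n1; clear -bnd sum; lia).
have C3 := aC (ga + al).+1 (be - 1) ltac:(apply: n2; clear -bnd sum; lia).
have Ca : ac (rev (D0 ++ [:: d])) [:: c 0] := aC 0 1 ltac:(apply: n1; clear -bnd sum; lia).
have Cb : ac (rev (D0 ++ [:: d])) [:: c ga] := aC ga 1 ltac:(apply: n1; clear -bnd sum; lia).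
have F1 := af 1 (ga - 1); have F2 := af ga.+1 (al - 1); have F3 := af (ga + al).+1 (be - 1).
have Fa : ac [:: f] [:: c 0] := af 0 1; have Fb : ac [:: f] [:: c ga] := af ga 1.
have Fc : ac [:: f] [:: c (ga + al)] := af (ga + al) 1.
have v1 : ac [:: c 0] [:: c ga] by rewrite ac11.
have v2 : ac [:: c 0] [:: c (ga + al)] by rewrite ac11.
have v3 : ac [:: c ga] [:: c (ga + al)] by rewrite ac11.
have hP' : ip ((pa :: P1) ++ f :: (P3 ++ [:: pb])) by move: hP; rewrite -catA.
have := hP'; rewrite ip_glueE => /and3P[hPa hPb aPP].
have pab : ac [:: pa] [:: pb] by clear -e_sym e_irr l_ge girth_ge odd_size aPP; ac_split; ac_goal.
have ipq p s v : ip (f :: s ++ [:: p]) -> e p v -> ac [:: f] [:: v] -> ac s [:: v] ->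
    ip (f :: (s ++ [:: p]) ++ [:: v]).
  move=> h1 h2 h3 h4; rewrite -catA /=; apply: (@ip_glue (f :: s) p [:: v]) => //; first by rewrite ip2.
  by ac_goal.
have ipD : ip (D0 ++ d :: [:: f]).
  apply: ip_glue; rewrite ?ip2 //.
  by move: h0; rewrite ac_catr ac_consr => /and3P[].
have ipDr : ip (f :: rev (D0 ++ [:: d])).
  by rewrite -ip_rev rev_cons revK -cats1 -catA.
have rD : rev (D0 ++ [:: d]) = rev W ++ [:: pc] by rewrite EW rev_cons cats1.
split; rewrite ?size_rev ?size_cat ?size_rev /=; try (clear -sP1 sP3 sD bnd sum; rewrite ?size_arc; lia).
all: try exact: ip1.
all: try exact: ip2'.
all: try exact: ip3'.
- have Aa : ac (rev P1) [:: c 0] by apply: (unl_list_arc Hc 0 1); rewrite all_rev.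
  by apply: ipq => //; [exact: ip_swap hPa | by case/andP: la].
- have Bb : ac P3 [:: c ga] by apply: (unl_list_arc Hc ga 1).
  by apply: ipq => //; by case/andP: lb.
- have Cc : ac (rev W) [:: c (ga + al)] by apply: (unl_list_arc Hc (ga + al) 1); rewrite all_rev.
  rewrite rD; apply: ipq => //; last by case/andP: lc.
  by rewrite -rD.
all: by ac_split; ac_goal.
Qed.
End TripodK4.

(** * Existence of jumps *)

Section CloseJump.
Local Notation n := (2 * l + 1).

(** The three consecutive vertices are placed at 1, 2, 3, so that their outer neighbours have
    indices 0 and 4. *)
Definition no_close_jump (c : nat -> T) :=
  forall i v R, 1 <= i <= 3 -> ~ jump c (c i) v R.

Definition reach (c : nat -> T) (Z : T -> Prop) (x : T) :=
  exists2 z, Z z & z = x \/ (unlabelled c x /\ walk (unlabelled c) x z).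

Section OneSide.
Variable c : nat -> T.
Hypothesis Hc : is_hole c.
Hypothesis NJ : no_close_jump c.

Lemma no_close_walk i j x y : 1 <= i <= 3 -> lab c i x -> lab c j y ->
  walk (unlabelled c) x y -> far (c i) (c j) -> False.
Proof. by move=> hi lx ly hw ij; have [s J _] := walk_jump Hc lx ly ij hw; exact: NJ hi J. Qed.

Lemma outside_cases i x : x \notin arc c 0 n ->
  unlabelled c x \/ exists2 j, i <= j < i + n & lab c j x.
Proof.
move=> xC; have [h|h] := boolP (has (e x) (arc c 0 n)); last by left; rewrite /unlabelled xC.
right; case/hasP: h => y yC exy; have [j hj E] := hole_idx Hc i yC.
by exists j => //; rewrite /lab xC -E.
Qed.

Lemma unl_not_lab i x : unlabelled c x -> ~~ lab c i x.
Proof.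
move=> /andP[_ /hasPn h]; apply/negP => /andP[_ ex]; have := h (c i) (on_hole Hc i).
by rewrite ex.
Qed.

Lemma unl_nadj i x : unlabelled c x -> ~~ e x (c i).
Proof. by move=> /andP[_ /hasPn]; apply; apply: on_hole. Qed.

(** Two regions attached to far labels neither meet nor touch: a contact would complete a walk
    through unlabelled vertices, and hence a jump from one of the three excluded vertices. *)
Lemma reach_contact (Z1 Z2 : T -> Prop) i j v u : 1 <= i <= 3 -> far (c i) (c j) ->
  (forall z, Z1 z -> lab c i z) -> (forall z, Z2 z -> lab c j z) ->
  reach c Z1 v -> reach c Z2 u -> v = u \/ e v u -> False.
Proof.
move=> hi ij h1 h2 [z1 /h1 l1 r1] [z2 /h2 l2 r2] [E|evu].
  case: r1 r2 => [E1|[uv w1]] [E2|[uu w2]].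
  - move: ij; rewrite E1 E in l1; rewrite E2 in l2.
    by rewrite (lab_inj Hc l1 l2) /far eqxx.
  - by move: (unl_not_lab i uu); rewrite -E -E1 l1.
  - by move: (unl_not_lab j uv); rewrite E -E2 l2.
  apply: (no_close_walk hi l1 l2 _ ij); apply: walk_cat w2 uu.
  by apply: walk_rev; rewrite -E.
case: r1 r2 => [E1|[uv w1]] [E2|[uu w2]].
- by rewrite E1 in l1; rewrite E2 in l2; rewrite (lab_nadj Hc l1 l2) in evu.
- by rewrite E1 in l1; apply: (no_close_walk hi l1 l2 _ ij); apply: walk_cons evu uu w2.
- rewrite E2 in l2; apply: (no_close_walk hi l1 l2 _ ij).
  by apply: walk_cat (walk_rev w1) (walk_edge _ evu) uv.
apply: (no_close_walk hi l1 l2 _ ij); apply: walk_cat (walk_rev w1) _ uv.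
exact: walk_cons evu uu w2.
Qed.

Lemma reach_path (Z : T -> Prop) x s : path e x s -> Z (last x s) ->
  (forall z, z \in x :: s -> unlabelled c z \/ Z z) ->
  forall v, v \in x :: s -> reach c Z v.
Proof.
elim: s x => [|y s IH] x.
  by move=> _ Zx _ v; rewrite inE => /eqP->; exists x => //; left.
move=> /= /andP[exy hp] Zl hs.
have hs' z : z \in y :: s -> unlabelled c z \/ Z z by move=> h; apply: hs; rewrite inE h orbT.
have {}IH := IH y hp Zl hs'.
move=> v; rewrite inE => /predU1P[->|]; last exact: IH.
case: (hs x (mem_head _ _)) => [ux|Zx]; last by exists x => //; left.
have [z Zz [Ez|[uy w]]] := IH y (mem_head _ _).
  by exists z => //; right; split=> //; rewrite Ez; apply: walk_edge.
by exists z => //; right; split=> //; apply: walk_cons exy uy w.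
Qed.

Definition closed_star (v : T) : {set T} := [set x | (x == v) || e v x].

Lemma closed_star_walk v x y : x \notin closed_star v -> y \notin closed_star v ->
  exists p, [/\ path e x p, last x p = y & {in p, forall z, z \notin closed_star v}].
Proof.
apply: (@star_connected v); first by rewrite inE eqxx.
by move=> z; rewrite inE => /orP[->|].
Qed.

(** How the absence of star cutsets is exploited: along a path off a star, [Inv] persists until the
    vertex sought appears. *)
Lemma path_invariant (Inv Q : T -> Prop) (Stop : Prop) x p :
  path e x p -> (forall z, z \in p -> Q z) ->
  (forall a b, Inv a -> e a b -> Q b -> Inv b \/ Stop) -> Inv x -> Inv (last x p) \/ Stop.
Proof.
move=> + + step; elim: p x => [|y p IH] x /=; first by left.
move=> /andP[exy hp] hQ Ix; have [Iy|] := step _ _ Ix exy (hQ y (mem_head _ _)); last by right.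
by apply: IH => // z zp; apply: hQ; rewrite inE zp orbT.
Qed.

Lemma star_notin k j : k + 1 < j -> j + 1 < k + n -> c j \notin closed_star (c k).
Proof.
move=> h1 h2; have := hole_far Hc (_ : k.+1 < j) (_ : j.+1 < k + n).
rewrite inE negb_or eq_sym => /(_ ltac:(lia) ltac:(lia)); exact.
Qed.

Lemma lab_star_notin k j x : lab c j x -> c j != c k -> x \notin closed_star (c k).
Proof.
move=> lx jk; rewrite inE negb_or; apply/andP; split.
  by apply: contraNneq (andP lx).1 => ->; apply: on_hole.
apply: contra jk => ex; rewrite (lab_inj Hc lx (_ : lab c k x)) //.
by rewrite /lab (andP lx).1 e_sym.
Qed.

Definition left_of z := exists2 w, lab c 1 w & walk (unlabelled c) z w.
Definition right_of z := exists2 w, lab c 3 w & walk (unlabelled c) z w.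

(* N[c 2] does not separate an unlabelled vertex from c 4; the first labelled vertex
   outside N[c 2] can only be labelled 1 or 3. *)
Lemma side_of z u : lab c 2 z -> unlabelled c u -> walk (unlabelled c) z u ->
  left_of u \/ right_of u.
Proof.
move=> lz uu wzu; have l5 := l_ge.
have [] := @closed_star_walk (c 2) u (c 4).
- rewrite inE negb_or; apply/andP; split; last by rewrite e_sym unl_nadj.
  by apply: contraNneq (andP uu).1 => ->; apply: on_hole.
- by apply: star_notin; clear -l5; lia.
move=> p [hp lp hB].
pose Inv x := unlabelled c x /\ (x = u \/ walk (unlabelled c) u x).
have [||uc4|//] := @path_invariant Inv (fun x => x \notin closed_star (c 2)) (left_of u \/ right_of u) u p hp hB.
- move=> a b [ua wa] eab hb.
  have wub : walk (unlabelled c) u b.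
    by case: wa => [<-|wa]; [apply: walk_edge | apply: walk_cat wa (walk_edge _ eab) ua].
  have bC : b \notin arc c 0 n.
    by apply/negP => /mem_arcP[j _ E]; have := unl_nadj j ua; rewrite -E eab.
  case: (outside_cases 1 bC) => [ub|[j hj lb]]; first by left; split=> //; right.
  right; have [E|j1] := eqVneq j 1; first by left; exists b; rewrite -?E.
  have [E|j3] := eqVneq j 3; first by right; exists b; rewrite -?E.
  have [E|j2] := eqVneq j 2.
    by move: hb; rewrite inE negb_or => /andP[_ /negP[]]; rewrite e_sym -E; case/andP: lb.
  exfalso; apply: (no_close_walk (i := 2) isT lz lb (walk_cat wzu wub uu)).
  by apply: (hole_far Hc); clear -l5 hj j1 j2 j3; lia.
- by split=> //; left.
by case: uc4; rewrite lp => /andP[]; rewrite on_hole.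
Qed.

(** Follow a path from [p] to [c 4] off N[c 1]. Its vertices stay connected to labels 1 and 2: the
    star excludes label 1, and any label other than 2 and 3 would give a jump from [c 2]. The path
    cannot reach the hole in this way, so a connection to label 3 appears, and some vertex labelled
    2 has both sides. *)
Lemma exists_both_from_left p : lab c 2 p -> left_of p ->
  exists2 y, lab c 2 y & left_of y /\ right_of y.
Proof.
move=> lp Lp; have l5 := l_ge.
have d21 : c 2 != c 1 by rewrite eq_sym (hole_neq Hc); clear -l5; lia.
have [||p' [hp lp' hB]] := @closed_star_walk (c 1) p (c 4).
- exact: lab_star_notin lp d21.
- by apply: star_notin; clear -l5; lia.
pose Inv x := (lab c 2 x /\ left_of x) \/
  (unlabelled c x /\ left_of x /\ exists2 z, lab c 2 z & walk (unlabelled c) z x).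
have [||ic4|//] := @path_invariant Inv (fun x => x \notin closed_star (c 1))
  (exists2 y, lab c 2 y & left_of y /\ right_of y) p p' hp hB.
- move=> a b [[la La]|[ua [[w lw ww] [z lz wz]]]] eab hb.
    have bC : b \notin arc c 0 n.
      apply/negP => /mem_arcP[j _ E]; have lj : lab c j a by rewrite /lab (andP la).1 -E eab.
      have := lab_inj Hc la lj; rewrite -E => Eb; move: hb; rewrite -Eb inE (hole_adj Hc).
        by rewrite eqxx orbT.
      by clear -l5; lia.
    have ub : unlabelled c b.
      by case: (outside_cases 0 bC) => // -[j _ lb]; rewrite (lab_nadj Hc la lb) in eab.
    case: (side_of la ub (walk_edge _ eab)) => [[w lw wb]|[w lw wb]].
      by left; right; split=> //; split; [exists w | exists a => //; apply: walk_edge].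
    by right; exists a => //; split=> //; exists w => //; apply: walk_cons eab ub wb.
  have bC : b \notin arc c 0 n.
    by apply/negP => /mem_arcP[j _ E]; have := unl_nadj j ua; rewrite -E eab.
  have wab : walk (unlabelled c) b w by apply: walk_cons ua ww; rewrite e_sym.
  have wzb : walk (unlabelled c) z b := walk_cat wz (walk_edge _ eab) ua.
  case: (outside_cases 1 bC) => [ub|[j hj lb]].
    by left; right; split=> //; split; [exists w | exists z].
  have [E|j1] := eqVneq j 1.
    by move: hb; rewrite inE negb_or => /andP[_ /negP[]]; rewrite e_sym -E; case/andP: lb.
  have [E|j2] := eqVneq j 2; first by left; left; rewrite -{1}E; split=> //; exists w.
  have [E|j3] := eqVneq j 3.
    right; exists z => //; split; last by exists b; rewrite -?E.
    by exists w => //; apply: walk_cat wz ww ua.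
  exfalso; apply: (no_close_walk (i := 2) isT lz lb wzb).
  by apply: (hole_far Hc); clear -l5 hj j1 j2 j3; lia.
- by left.
by case: ic4; rewrite lp' => -[/andP[]]; rewrite on_hole.
Qed.

(** The vertex [x1] is the first on [V] labelled 1, so that [l0] is unlabelled, and the path goes on
    to label 0. Replacing the stretch up to [w] by that up to [x1] provides cycles whose parities
    can be compared. *)
Definition left_ear (y : T) (V : seq T) (w : T) (l0 : seq T) (x1 : T) (l1 : seq T) :=
  [/\ lab c 0 w, lab c 1 x1, V = l0 ++ x1 :: l1 & ip (y :: V ++ [:: w])] /\
  all (unlabelled c) l0 /\ (forall z, z \in V -> unlabelled c z \/ lab c 1 z).

(** A path from [x] to [c 0] off N[c 2] runs through vertices that are unlabelled or labelled 1
    until it meets label 0, since any other label would give a jump from [c 1]. The resulting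
    induced path from [y] contains label 1, or else it would give a jump from [c 2] to [c 0]. *)
Lemma exists_left_ear y : lab c 2 y -> left_of y ->
  exists V w l0 x1 l1, left_ear y V w l0 x1 l1.
Proof.
move=> ly [x lx wyx]; have l5 := l_ge.
pose D z := unlabelled c z || lab c 1 z.
have d12 : c 1 != c 2 by rewrite (hole_neq Hc); clear -l5; lia.
have wDx : walk D y x by apply: walk_sub wyx => z; rewrite /D => ->.
have [||p [hp lp hB]] := @closed_star_walk (c 2) x (c 0).
- exact: lab_star_notin lx d12.
- by rewrite -(hole_per Hc); apply: star_notin; clear -l5; lia.
pose Inv z := [/\ D z, walk D y z & exists2 v, lab c 1 v & v = z \/ (unlabelled c z /\ walk (unlabelled c) v z)].
have [||ic0|[w lw wyw]] := @path_invariant Inv (fun x => x \notin closed_star (c 2))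
  (exists2 w, lab c 0 w & walk D y w) x p hp hB.
- move=> a b [Da wya [v lv va]] eab hb.
  have wyb : walk D y b := walk_cat wya (walk_edge _ eab) Da.
  have bC : b \notin arc c 0 n.
    apply/negP => /mem_arcP[j _ E]; case/orP: Da => [ua|la].
      by have := unl_nadj j ua; rewrite -E eab.
    have lj : lab c j a by rewrite /lab (andP la).1 -E eab.
    have := lab_inj Hc la lj; rewrite -E => Eb; move: hb.
    rewrite -Eb inE e_sym (hole_adj Hc); first by rewrite eqxx orbT.
    by clear -l5; lia.
  have wvb : walk (unlabelled c) v b.
    case: va => [->|[ua wva]]; first exact: walk_edge.
    exact: walk_cat wva (walk_edge _ eab) ua.
  case: (outside_cases 1 bC) => [ub|[j hj lb]].
    by left; split=> //; [rewrite /D ub | exists v => //; right].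
  have [E|j1] := eqVneq j 1.
    by rewrite E in lb; left; split=> //; [rewrite /D lb orbT | exists b => //; left].
  have [E|j2] := eqVneq j 2.
    by move: hb; rewrite inE negb_or => /andP[_ /negP[]]; rewrite e_sym -E; case/andP: lb.
  have [E|jn] := eqVneq j n.
    by right; exists b => //; move: lb; rewrite E /lab -[n in c n]add0n (hole_per Hc).
  exfalso; apply: (no_close_walk (i := 1) isT lv lb wvb).
  by apply: (hole_far Hc); clear -l5 hj j1 j2 jn; lia.
- by split=> //; [rewrite /D lx orbT | exists x => //; left].
- by case: ic0; rewrite lp /D => /orP[/andP[]|/andP[]]; rewrite on_hole.
have f20 : far (c 2) (c 0).
  by rewrite -(hole_per Hc 0); apply: (hole_far Hc); clear -l5; lia.
have yw : y != w.
  by apply: contraTneq f20 => E; rewrite -E in lw; rewrite (lab_inj Hc ly lw) /far eqxx.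
have [V [hV DV]] := walk_ip wyw yw.
have : has (lab c 1) V.
  apply/negPn/negP => /hasPn no1; apply: (no_close_walk (i := 2) isT ly lw _ f20).
  exists V; split; first by have := ip_path hV; rewrite cats1.
  by apply/allP => z zV; have := allP DV z zV; rewrite /D (negbTE (no1 z zV)) orbF.
move=> /split_first[l0 [x1 [l1 [EV lx1 nl0]]]].
exists V, w, l0, x1, l1; split=> //; split.
  apply/allP => z zl; have := allP DV z; rewrite /D EV mem_cat zl => /(_ isT) /orP[//|l1z].
  by case/negP: nl0; apply/hasP; exists z.
by move=> z zV; apply/orP; apply: (allP DV).
Qed.

(** The cycle closed by the arc from [c i] to [c j] is induced and longer than n, so it cannot be
    odd. *)
Lemma ear_parity i j x (s : seq T) y : i + 1 < j < i + n - 1 -> lab c i x -> lab c j y ->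
  ip (x :: s ++ [:: y]) -> (forall z, z \in s -> ac [:: z] (arc c i (j - i).+1)) ->
  n < size s + 2 + (j - i.+1) + 2 -> ~~ odd (size s + (j - i.+1)).
Proof.
move=> hij lx ly hs far_s big; have l5 := l_ge.
have sub1 z : z \in arc c i.+1 (j - i.+1) -> z \in arc c i (j - i).+1.
  by move=> /mem_arcP[k hk ->]; apply/mem_arcP; exists k => //; clear -hk hij; lia.
have ei : c i \in arc c i (j - i).+1 by apply/mem_arcP; exists i => //; clear -hij; lia.
have ej : c j \in arc c i (j - i).+1 by apply/mem_arcP; exists j => //; clear -hij; lia.
have nij : c i != c j by apply: (hole_neq Hc); clear -hij; lia.
have fs w : w \in arc c i (j - i).+1 -> ac s [:: w].
  move=> hw; apply/acP => z w' zs /[!inE] /eqP->.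
  by apply: ac_far_mem (far_s z zs) _ hw; rewrite mem_head.
have ax k m : c i \notin arc c k m -> ac [:: x] (arc c k m) by apply: lab_arc.
have ay k m : c j \notin arc c k m -> ac [:: y] (arc c k m) by apply: lab_arc.
have hip : ip (c i :: (x :: s ++ [:: y]) ++ [:: c j]).
  have -> : c i :: (x :: s ++ [:: y]) ++ [:: c j] = (c i :: x :: s) ++ y :: [:: c j].
    by rewrite /= -catA.
  have axj : ac [:: x] [:: c j] by apply: (ax j 1); rewrite /arc /= mem_seq1.
  have ayi : ac [:: y] [:: c i] by apply: (ay i 1); rewrite /arc /= mem_seq1 eq_sym.
  have aij : ac [:: c i] [:: c j].
    by rewrite ac11; apply: (hole_far Hc); clear -hij; lia.
  have asi := fs _ ei; have asj := fs _ ej.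
  apply: ip_glue; first last.
  - by ac_goal.
  - by rewrite ip2 (andP ly).2.
  rewrite -[_ ++ _]/[:: c i, x & s ++ [:: y]] ip_cons2 hs e_sym (andP lx).2 andbT andTb.
  by ac_goal.
have hac : ac (x :: s ++ [:: y]) (arc c i.+1 (j - i.+1)).
  have as_ : ac s (arc c i.+1 (j - i.+1)).
    apply/acP => z w zs /sub1 hw.
    by apply: ac_far_mem (far_s z zs) _ hw; rewrite mem_head.
  have ax' := ax i.+1 (j - i.+1); have ay' := ay i.+1 (j - i.+1).
  have {}ax' := ax' ltac:(rewrite -(hole_per Hc); apply: (notin_arc Hc); clear -hij; lia).
  have {}ay' := ay' ltac:(apply: (notin_arc Hc); clear -hij; lia).
  by ac_goal.
have [||_] := @ear c Hc i j (x :: s ++ [:: y]) _ _ hip hac; [by clear -hij; lia | by [] |].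
rewrite /= size_cat /= => o; apply/negP => odd_s.
have o' : odd ((size s + 1).+1 + (j - i.+1)) by rewrite addn1 !addSn /= negbK.
by have := o o'; clear -big; lia.
Qed.

(** Three cycles longer than n, hence even: from [x3] through [y] to [x1], from [x3] through [y] to
    [w], and from [y] to [w], each closed by an arc of the hole. They make [size m0] even and
    [size l0] odd; on the mirrored hole the two lists exchange roles. *)
Lemma left_ear_parity y V w l0 x1 l1 (m0 : seq T) x3 : lab c 2 y -> left_ear y V w l0 x1 l1 ->
  lab c 3 x3 -> all (unlabelled c) m0 -> ip (y :: m0 ++ [:: x3]) ->
  [/\ odd (size l0 + size m0), ~~ odd (size V + size m0) & ~~ odd (size V)].
Proof.
move=> ly [[lw lx1 EV hV] [ul0 hVl]] lx3 um0 hm; have l5 := l_ge.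
have f31 : far (c 3) (c 1) by rewrite far_sym; apply: (hole_far Hc); clear -l5; lia.
have f30 : far (c 3) (c 0).
  by rewrite -(hole_per Hc 0); apply: (hole_far Hc); clear -l5; lia.
(* A contact between the two sides of [y] would connect label 3 to label 1 or 0. *)
have acVm : ac (V ++ [:: w]) (m0 ++ [:: x3]).
  apply/acP => v u hv hu.
  have ru : reach c (lab c 3) u.
    case: m0 um0 hm hu => [|m m0] um0 hm hu.
      by exists x3 => //; left; move: hu; rewrite mem_seq1 => /eqP.
    apply: (@reach_path (lab c 3) m (m0 ++ [:: x3])) hu.
    - by apply: ip_path; move: hm => /(@ip_catr [:: y]).
    - by rewrite last_cat.
    move=> z; rewrite -cat_cons mem_cat mem_seq1 => /orP[/(allP um0)|/eqP->]; [by left|by right].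
  have rv : reach c (fun z => lab c 1 z \/ lab c 0 z) v.
    case: V hV hv hVl {EV} => [|v0 V] hV hv hVl.
      by exists w; [right | left; move: hv; rewrite mem_seq1 => /eqP].
    apply: (@reach_path _ v0 (V ++ [:: w])) hv.
    - by apply: ip_path; move: hV => /(@ip_catr [:: y]).
    - by rewrite last_cat; right.
    move=> z; rewrite -cat_cons mem_cat mem_seq1 => /orP[/hVl[]|/eqP->]; [by left|by right; left|by right; right].
  have no : ~ (u = v \/ e u v).
    case: rv => z [l1z|l0z] rz; [apply: (@reach_contact (lab c 3) (eq z) 3 1 u v) => //|
      apply: (@reach_contact (lab c 3) (eq z) 3 0 u v) => //]; try (by move=> z' <-);
      by exists z.
  rewrite /far; apply/andP; split; first by apply/eqP => E; apply: no; left.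
  by apply/negP => h; apply: no; right; rewrite e_sym.
have U i m z : unlabelled c z -> ac [:: z] (arc c i m) by apply: unl_arc.
have L k i m z : lab c k z -> i + m <= k + n < i + n -> ac [:: z] (arc c i m).
  by move=> lz h; apply: (lab_arc Hc lz); rewrite -(hole_per Hc k); apply: (notin_arc Hc).
(* Labels 0 and 1 are shifted by the period, so that the closing arcs run upwards from 2 or 3. *)
have lwn : lab c n w by rewrite /lab -[n in c n]add0n (hole_per Hc).
have lx1n : lab c (1 + n) x1 by rewrite /lab (hole_per Hc).
have hm' := ip_swap hm.
have yVm : ip ((x3 :: rev m0) ++ y :: (V ++ [:: w])).
  by apply: ip_glue => //; move: acVm; rewrite ac_sym => h; clear -e_sym e_irr l_ge girth_ge odd_size h; ac_split; ac_goal.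
have hl : ip ((x3 :: rev m0) ++ y :: (l0 ++ [:: x1])).
  move: yVm; rewrite EV; have -> : (x3 :: rev m0) ++ y :: (l0 ++ x1 :: l1) ++ [:: w] =
    ((x3 :: rev m0) ++ y :: (l0 ++ [:: x1])) ++ l1 ++ [:: w] by rewrite /= -!catA /= -catA.
  exact: ip_catl.
have sV : size V = size l0 + size l1 + 1 by rewrite EV size_cat /=; clear; lia.
have pA : ~~ odd (size (rev m0 ++ y :: l0) + (1 + n - 4)).
  apply: (@ear_parity 3 (1 + n) x3 (rev m0 ++ y :: l0) x1) => //.
  - by clear -l5; lia.
  - by move: hl; rewrite /= -catA.
  - move=> z; rewrite mem_cat inE mem_rev => /or3P[/(allP um0)/U|/eqP->|/(allP ul0)/U]; try exact.
    by apply: L ly _; clear -l5; lia.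
  by rewrite size_cat size_rev /=; clear; lia.
have pB : ~~ odd (size (rev m0 ++ y :: V) + (n - 4)).
  apply: (@ear_parity 3 n x3 (rev m0 ++ y :: V) w) => //.
  - by clear -l5; lia.
  - by move: yVm; rewrite /= -catA.
  - move=> z; rewrite mem_cat inE mem_rev => /or3P[/(allP um0)/U|/eqP->|/hVl[/U|lz]]; try exact.
      by apply: L ly _; clear -l5; lia.
    by apply: L lz _; clear -l5; lia.
  by rewrite size_cat size_rev /=; clear -sV; lia.
have pC : ~~ odd (size V + (n - 3)).
  apply: (@ear_parity 2 n y V w) => //.
  - by clear -l5; lia.
  - move=> z /hVl[/U|lz]; first exact.
    by apply: L lz _; clear -l5; lia.
  by clear -sV; lia.
move: pA pB pC; rewrite !size_cat size_rev /=; clear -l5 => pA pB pC.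
by split; lia.
Qed.
End OneSide.

Section Mirror.
Variables c c' : nat -> T.
Hypothesis mem : arc c 0 n =i arc c' 0 n.

Lemma jump_ext u v R : jump c u v R -> jump c' u v R.
Proof.
move=> [uC vC R0 hR h]; split; rewrite -?mem // => w x wR; rewrite -mem; exact: h.
Qed.

Lemma unlabelled_ext x : unlabelled c x = unlabelled c' x.
Proof. by rewrite /unlabelled mem (eq_has_r mem). Qed.
End Mirror.

(** The reflection taking i to d - i; the second formula covers the indices for which it wraps
    round. *)
Lemma hole_mirror c d : is_hole c -> d < n -> exists c', [/\ is_hole c', arc c 0 n =i arc c' 0 n,
  forall i, i <= d -> c' i = c (d - i) & forall i, d <= i < n + d -> c' i = c (n + d - i)].
Proof.
move=> Hc dn; have Hr := hole_reflect Hc.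
exists (fun i => c (n - (i + (n - d)) %% n)); split.
- exact: (hole_shift Hr).
- by move=> x; rewrite (mem_shift Hr (n - d)) mem_reflect.
- move=> i hi; have [->|id] := eqVneq i d.
    by rewrite subnKC ?(ltnW dn) // modnn subnn subn0 -[n in c n]add0n (hole_per Hc).
  by congr c; rewrite modn_small; clear -hi id dn; lia.
move=> i hi; have -> : i + (n - d) = (i - d) + n by clear -hi dn; lia.
by congr c; rewrite modnDr modn_small; clear -hi dn; lia.
Qed.

Lemma close_jump c : is_hole c -> ~ no_close_jump c.
Proof.
move=> Hc NJ.
(* The mirror with d = 4 fixes the index 2 and exchanges 1 and 3, so every statement about the left
   side also serves the right side. *)
have l5' := l_ge; have [|c' [Hc' mem cc' _]] := @hole_mirror c 4 Hc; first by clear -l5'; lia.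
have mem' : arc c' 0 n =i arc c 0 n by move=> x; rewrite mem.
have NJ' : no_close_jump c'.
  move=> i v R hi J; apply: (NJ (4 - i) v R); first by clear -hi; lia.
  by rewrite -cc'; [exact: jump_ext J | clear -hi; lia].
have LL i x : i <= 4 -> lab c' i x = lab c (4 - i) x by move=> hi; rewrite /lab cc' // mem.
have UU x : unlabelled c' x = unlabelled c x by apply: unlabelled_ext.
have WW x y : walk (unlabelled c') x y <-> walk (unlabelled c) x y.
  by split; apply: walk_sub => z; rewrite UU.
have LR z : left_of c' z <-> right_of c z.
  by split=> -[w lw ww]; exists w; rewrite ?LL // in lw *; apply/WW.
have RL z : right_of c' z <-> left_of c z.
  by split=> -[w lw ww]; exists w; rewrite ?LL // in lw *; apply/WW.
have [y ly [Ly Ry]] : exists2 y, lab c 2 y & left_of c y /\ right_of c y.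
  (* Minimum degree 3 gives a vertex [p] labelled 2, and then a neighbour [u] of [p] other than
     [c 2]; by girth [u] is unlabelled, so [side_of] applies to it. *)
  have [p ep /andP[p1 p3]] := degree_gt2 (c 2) (c 1) (c 3).
  have l5 := l_ge.
  have lp : lab c 2 p.
    rewrite /lab e_sym ep andbT; apply/negP => /(hole_idx Hc 2)[j hj E].
    have [E2|j2] := eqVneq j 2; first by rewrite E E2 e_irr in ep.
    move: ep; rewrite E (hole_adj Hc); last by clear -hj j2; lia.
    case/orP => /eqP Ej.
      by move: p3; rewrite E Ej eqxx.
    have Ej' : j = 1 + n by clear -Ej; lia.
    by move: p1; rewrite E Ej' (hole_per Hc) eqxx.
  have [u eu /andP[u2 _]] := degree_gt2 p (c 2) (c 2).
  have uC : u \notin arc c 0 n.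
    apply: contra u2 => /(hole_idx Hc 0)[j hj E].
    by rewrite E (lab_inj Hc lp (_ : lab c j p)) ?eqxx // /lab (andP lp).1 -E.
  have uu : unlabelled c u.
    by case: (outside_cases Hc 0 uC) => // -[j _ lj]; rewrite (lab_nadj Hc lp lj) in eu.
  case: (side_of Hc NJ lp uu (walk_edge _ eu)) => [[w lw ww]|[w lw ww]].
    by apply: (exists_both_from_left Hc NJ lp); exists w => //; apply: walk_cons eu uu ww.
  have [||y ly [Ly Ry]] := @exists_both_from_left c' Hc' NJ' p.
  - by rewrite LL.
  - by apply/LR; exists w => //; apply: walk_cons eu uu ww.
  by exists y; [rewrite LL in ly | split; [apply/RL | apply/LR]].
have [V [w [l0 [x1 [l1 hL]]]]] := exists_left_ear Hc NJ ly Ly.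
have ly' : lab c' 2 y by rewrite LL.
have [V' [w' [m0 [x3 [m1 hR]]]]] := exists_left_ear Hc' NJ' ly' ((LR y).2 Ry).
have [[_ lx1 EV hV] [ul0 _]] := hL.
have [[_ lx3 EV' hV'] [um0 _]] := hR.
have pre (A : seq T) l' x' r' w0 : ip (y :: A ++ [:: w0]) -> A = l' ++ x' :: r' -> ip (y :: l' ++ [:: x']).
  move=> h E; have : ip ((y :: l' ++ [:: x']) ++ r' ++ [:: w0]).
    by move: h; rewrite E /= -!catA.
  exact: ip_catl.
have um0' : all (unlabelled c) m0 by apply: sub_all um0 => z; rewrite UU.
have ul0' : all (unlabelled c') l0 by apply: sub_all ul0 => z; rewrite UU.
have lx3' : lab c 3 x3 by rewrite LL in lx3.
have lx1' : lab c' 3 x1 by rewrite LL.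
have [o1 o2 o3] := left_ear_parity Hc NJ ly hL lx3' um0' (pre _ _ _ _ _ hV' EV').
have [o4 o5 o6] := left_ear_parity Hc' NJ' ly' hR lx1' ul0' (pre _ _ _ _ _ hV EV).
move: o1 o2 o3 o4 o5 o6; rewrite !oddD; move: (odd _) (odd _) (odd _) (odd _).
by do 4!case.
Qed.
End CloseJump.

(** * Excluding the subdivisions of K4 *)

Lemma ip_sublist_close s z1 z2 r : ip s -> z1 \in s -> z2 \in s -> z1 != z2 ->
  r \notin s -> e r z1 -> e r z2 -> 2 * l + 1 <= size s + 1.
Proof.
have H t y1 y2 : ip (y1 :: t) -> y2 \in t -> r \notin y1 :: t -> e r y1 -> e r y2 ->
    2 * l + 1 <= size t + 2.
  move=> ht h2 hr e1 e2; have [t1 [y [t2 [E /eqP yy _]]]] := @split_first (pred1 y2) t ltac:(by rewrite has_pred1).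
  rewrite {}yy in E; have E' : y1 :: t = (y1 :: rcons t1 y2) ++ t2 by rewrite E -cat_rcons.
  have h1 : ip (y1 :: rcons t1 y2) by apply: (@ip_catl _ t2); rewrite -E'.
  have hr' : r \notin y1 :: rcons t1 y2 by apply: contra hr; rewrite E' mem_cat => ->.
  have := girth_close (ip_path h1) (ip_uniq h1) hr' _ e1; rewrite last_rcons size_rcons E size_cat /=.
  by move=> /(_ isT e2); clear; lia.
move=> hs h1 h2 z12 hr e1 e2.
have [s1 [y [s2 [E yy n1]]]] : exists s1 y s2, [/\ s = s1 ++ y :: s2, (y == z1) || (y == z2)
    & ~~ has (fun x => (x == z1) || (x == z2)) s1].
  by apply: split_first; apply/hasP; exists z1; rewrite ?eqxx.
have nin z : (z == z1) || (z == z2) -> z \notin s1.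
  by move=> hz; apply: contra n1 => h; apply/hasP; exists z.
have mem2 z : z \in s -> (z == z1) || (z == z2) -> z != y -> z \in s2.
  by rewrite E mem_cat inE => /orP[h /nin|/predU1P[->|//]]; rewrite ?h ?eqxx.
have hy : ip (y :: s2) by move: hs; rewrite E => /ip_catr.
have ry : r \notin y :: s2 by apply: contra hr; rewrite E mem_cat => ->; rewrite orbT.
have sz : size s2 + 1 <= size s by rewrite E size_cat /=; clear; lia.
case/orP: yy => /eqP yz; rewrite yz in hy ry mem2.
  by have := H _ _ z2 hy (mem2 _ h2 _ _) ry e1 e2; rewrite eqxx orbT eq_sym z12 => /(_ isT isT); clear -sz; lia.
by have := H _ _ z1 hy (mem2 _ h1 _ _) ry e2 e1; rewrite eqxx z12 => /(_ isT isT); clear -sz; lia.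
Qed.

(** Any two vertices of the tree lie on the union of two of its legs, an induced path too short for
    an outside vertex to have two neighbours on it. *)
Lemma tree_unique_nbr a b c q AB BC CA QA QB QC ga al be r z1 z2 :
  K4 a b c q AB BC CA QA QB QC ga al be -> r \notin q :: QA ++ QB ++ QC ->
  z1 \in q :: QA ++ QB ++ QC -> z2 \in q :: QA ++ QB ++ QC -> e r z1 -> e r z2 -> z1 = z2.
Proof.
move=> K rF z1F z2F e1 e2; apply/eqP; apply: contraT => z12.
have two QX QY x y m m' : ip (q :: QX ++ [:: x]) -> ip (q :: QY ++ [:: y]) ->
    ac QX (q :: QY) || ac QX QY -> (size QX).+1 = m -> (size QY).+1 = m' -> m + m' < 2 * l ->
    {subset q :: QX ++ QY <= q :: QA ++ QB ++ QC} ->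
    z1 \in q :: QX ++ QY -> z2 \in q :: QX ++ QY -> false.
  move=> hX hY hXY sX sY mm sub h1 h2.
  have {}hXY : ac QX QY by case/orP: hXY; rewrite // ac_consr => /andP[].
  have hs : ip (rev QX ++ q :: QY).
    apply: ip_glue; last by rewrite ac_revl.
      rewrite -[rev QX ++ _]cats0 -ip_rev cats0 rev_cat revK /=.
      by move: hX; rewrite -cat_cons => /ip_catl.
    by move: hY; rewrite -cat_cons => /ip_catl.
  have mem z : (z \in rev QX ++ q :: QY) = (z \in q :: QX ++ QY).
    by rewrite !(inE, mem_cat, mem_rev) orbCA.
  have rs : r \notin rev QX ++ q :: QY by rewrite mem; apply: contra rF => /sub.
  have := ip_sublist_close hs _ _ z12 rs e1 e2; rewrite !mem h1 h2 => /(_ isT isT).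
  by rewrite size_cat size_rev /=; clear -sX sY mm; lia.
have bnd := k4_bnd K; have sum := k4_sum K.
have AA := k4_QA K; have BB := k4_QB K.
have sA := k4_sQA K; have sB := k4_sQB K; have sC := k4_sQC K.
have hAB : ac QA QB by ac_split; ac_goal.
have hAC : ac QA QC by ac_split; ac_goal.
have hBC : ac QB QC by ac_split; ac_goal.
have tAB := two _ _ _ _ _ _ (k4_qa K) (k4_qb K) _ sA sB; rewrite hAB orbT in tAB.
have tAC := two _ _ _ _ _ _ (k4_qa K) (k4_qc K) _ sA sC; rewrite hAC orbT in tAC.
have tBC := two _ _ _ _ _ _ (k4_qb K) (k4_qc K) _ sB sC; rewrite hBC orbT in tBC.
have [mAB mAC mBC] : [/\ al + be < 2 * l, al + ga < 2 * l & be + ga < 2 * l].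
  by clear -bnd sum; split; lia.
have {}tAB := tAB isT mAB; have {}tAC := tAC isT mAC; have {}tBC := tBC isT mBC.
have : [|| (z1 \in q :: QA ++ QB) && (z2 \in q :: QA ++ QB),
           (z1 \in q :: QA ++ QC) && (z2 \in q :: QA ++ QC) |
           (z1 \in q :: QB ++ QC) && (z2 \in q :: QB ++ QC)].
  move: z1F z2F; rewrite !(inE, mem_cat).
  by case: (z1 == q) (z1 \in QA) (z1 \in QB) (z1 \in QC) => [] [] [] [] //=;
     case: (z2 == q) (z2 \in QA) (z2 \in QB) (z2 \in QC) => [] [] [] [].
case/or3P=> /andP[h1 h2].
- apply: tAB h1 h2 => y; rewrite !(inE, mem_cat) => /or3P[->|->|->]; rewrite ?orbT //.
- apply: tAC h1 h2 => y; rewrite !(inE, mem_cat) => /or3P[->|->|->]; rewrite ?orbT //.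
- apply: tBC h1 h2 => y; rewrite !(inE, mem_cat) => /or3P[->|->|->]; rewrite ?orbT //.
Qed.

Lemma path_close z D x p : ip (z :: D ++ [:: x]) -> p \notin z :: D ++ [:: x] ->
  e p z -> e p x -> 2 * l + 1 <= size D + 3.
Proof.
move=> h hp ez ex; have := girth_close (ip_path h) (ip_uniq h) hp _ ez.
by rewrite last_cat size_cat /= => /(_ _ ex) g; have := g ltac:(by rewrite addn1); clear; lia.
Qed.

Definition k4_tree (q : T) (QA QB QC : seq T) := q :: QA ++ QB ++ QC.
Definition k4_rim (a b c : T) (AB BC CA : seq T) := a :: AB ++ b :: BC ++ c :: CA.

(** Girth alone decides: [p] closes the paths from [z] to [v]. For [z] on the legs to a or b, the
    cycles through a and through b have total length n + 4, less than 2n. For [z] on the leg to c,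
    the two cycles through c are added as well, and the four bounds give [ga >= n - 4], more than
    l. *)
Lemma no_rim_tree_vertex_side a b c q AB BC CA QA QB QC ga al be p z v :
  K4 a b c q AB BC CA QA QB QC ga al be ->
  p \notin k4_tree q QA QB QC -> p \notin k4_rim a b c AB BC CA ->
  z \in k4_tree q QA QB QC -> v \in a :: AB -> e p z -> e p v -> False.
Proof.
move=> K pF pC zF vAB ez ev; have l5 := l_ge.
have bnd := k4_bnd K; have sum := k4_sum K.
have sAB := k4_sAB K; have sBC := k4_sBC K; have sCA := k4_sCA K.
pose F := q :: QA ++ QB ++ QC.
have [s [PA [PB [PC [[hA hB hC] [[sA sB sC] hs]]]]]] : exists s PA PB PC,
  [/\ ip (z :: PA ++ [:: a]), ip (z :: PB ++ [:: b]) & ip (z :: PC ++ [:: c])] /\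
  [/\ {subset PA <= F}, {subset PB <= F} & {subset PC <= F}] /\
  [\/ [/\ s < al, size PA = al - s - 1 & size PB = be + s - 1],
      [/\ s < be, size PA = al + s - 1 & size PB = be - s - 1] |
      [/\ s < ga, size PA = al + s - 1, size PB = be + s - 1, size PC = ga - s - 1 &
          ac [:: a] (z :: PC) /\ ac [:: b] (z :: PC)]].
  move: (zF); rewrite /k4_tree -cat_cons 2!mem_cat => /or3P[zA|zB|zC].
  - have [s [PA [PB [PC [[s0 eA eB eC] [hp [sp _]]]]]]] := leg_paths K zA.
    by exists s, PA, PB, PC; do 2!split=> //; constructor 1.
  - have zB' : z \in q :: QB by rewrite inE zB orbT.
    have [s [PB [PC [PA [[s0 eB eC eA] [[h1 h2 h3] [[s1 s2 s3] _]]]]]]] := leg_paths (k4_rot K) zB'.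
    have sub (P : seq T) : {subset P <= q :: QB ++ QC ++ QA} -> {subset P <= F}.
      by move=> h y /h; rewrite !(inE, mem_cat) => /or4P[->|->|->|->]; rewrite ?orbT.
    exists s, PA, PB, PC; split=> //; split; last by constructor 2.
    by split; apply: sub.
  have zC' : z \in q :: QC by rewrite inE zC orbT.
  have [s [PC [PA [PB [[s0 eC eA eB] [[h1 h2 h3] [[s1 s2 s3] [[a1 a2 a3 a4] _]]]]]]]] :=
    leg_paths (k4_rot (k4_rot K)) zC'.
  have sub (P : seq T) : {subset P <= q :: QC ++ QA ++ QB} -> {subset P <= F}.
    by move=> h y /h; rewrite !(inE, mem_cat) => /or4P[->|->|->|->]; rewrite ?orbT.
  exists s, PA, PB, PC; split=> //; split; last by constructor 3.
  by split; apply: sub.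
have pP (P : seq T) x : {subset P <= F} -> p != x -> p \notin z :: P ++ [:: x].
  move=> hP px; rewrite inE mem_cat mem_seq1 (negbTE px) orbF negb_or.
  by apply/andP; split; [apply: contraNneq pF => -> | apply: contra pF => /hP].
have [pa pAB pb pBC [pc pCA]] : [/\ p != a, p \notin AB, p != b, p \notin BC & p != c /\ p \notin CA].
  by move: pC; rewrite /k4_rim !(inE, mem_cat) !negb_or => /and5P[-> -> -> -> /andP[-> ->]].
move: vAB; rewrite inE => /predU1P[va|vAB].
  rewrite {}va in ev; have := path_close hA (pP _ _ sA pa) ez ev.
  by clear -hs bnd sum; case: hs => [[? -> _]|[? -> _]|[? -> _ _ _]]; lia.
have [X1 [v' [X2 [E /eqP vv _]]]] := @split_first (pred1 v) AB ltac:(by rewrite has_pred1).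
rewrite {}vv in E.
have [[p1 p2 p3 p4] _] := k4_paths K E zF hA hB hC sA sB sC.
have pv : p != v by apply: contraNneq pAB => ->.
have [pX1 pX2] : p \notin X1 /\ p \notin X2.
  by move: pAB; rewrite E mem_cat inE !negb_or => /and3P[].
have sX : size X1 + size X2 + 2 = ga by rewrite -sAB E size_cat /=; clear; lia.
have nz : p != z by apply: contraNneq pF => ->.
have nA : p \notin PA by apply: contra pF => /sA.
have nB : p \notin PB by apply: contra pF => /sB.
have nC : p \notin PC by apply: contra pF => /sC.
have g1 : 2 * l + 1 <= size (PB ++ b :: rev X2) + 3.
  apply: path_close p1 _ ez ev; rewrite !(inE, mem_cat, mem_rev) !negb_or.
  by rewrite nz nB pb pX2 pv.
have g2 : 2 * l + 1 <= size (PA ++ a :: X1) + 3.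
  apply: path_close p2 _ ez ev; rewrite !(inE, mem_cat, mem_rev) !negb_or.
  by rewrite nz nA pa pX1 pv.
rewrite !size_cat /= size_rev in g1 g2.
case: hs => [[h1 h2 h3]|[h1 h2 h3]|[h1 h2 h3 h4 [/p4 h5 /p3 h6]]].
- by clear -h1 h2 h3 g1 g2 sX bnd sum l5; lia.
- by clear -h1 h2 h3 g1 g2 sX bnd sum l5; lia.
have g3 : 2 * l + 1 <= size (PC ++ c :: rev BC ++ b :: rev X2) + 3.
  apply: path_close h6 _ ez ev; rewrite !(inE, mem_cat, mem_rev) !negb_or.
  by rewrite nz nC pc pBC pb pX2 pv.
have g4 : 2 * l + 1 <= size (PC ++ c :: CA ++ a :: X1) + 3.
  apply: path_close h5 _ ez ev; rewrite !(inE, mem_cat, mem_rev) !negb_or.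
  by rewrite nz nC pc pCA pa pX1 pv.
move: g3 g4; rewrite !size_cat /= !size_cat /= !size_rev => g3 g4.
by clear -h1 h2 h3 h4 g1 g2 g3 g4 sX sBC sCA bnd sum l5; lia.
Qed.

Lemma no_rim_tree_vertex a b c q AB BC CA QA QB QC ga al be p z v :
  K4 a b c q AB BC CA QA QB QC ga al be ->
  p \notin k4_tree q QA QB QC -> p \notin k4_rim a b c AB BC CA ->
  z \in k4_tree q QA QB QC -> v \in k4_rim a b c AB BC CA -> e p z -> e p v -> False.
Proof.
move=> K pF pC zF vC ez ev.
have tr1 y : (y \in k4_tree q QB QC QA) = (y \in k4_tree q QA QB QC).
  by rewrite !(inE, mem_cat); case: (y == q) (y \in QA) (y \in QB) (y \in QC) => [] [] [] [].
have tr2 y : (y \in k4_tree q QC QA QB) = (y \in k4_tree q QA QB QC).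
  by rewrite !(inE, mem_cat); case: (y == q) (y \in QA) (y \in QB) (y \in QC) => [] [] [] [].
have rm1 y : (y \in k4_rim b c a BC CA AB) = (y \in k4_rim a b c AB BC CA).
  rewrite /k4_rim !(inE, mem_cat).
  by case: (y == a) (y == b) (y == c) (y \in AB) (y \in BC) (y \in CA) => [] [] [] [] [] [].
have rm2 y : (y \in k4_rim c a b CA AB BC) = (y \in k4_rim a b c AB BC CA).
  rewrite /k4_rim !(inE, mem_cat).
  by case: (y == a) (y == b) (y == c) (y \in AB) (y \in BC) (y \in CA) => [] [] [] [] [] [].
move: (vC); rewrite /k4_rim -cat_cons mem_cat -cat_cons mem_cat => /or3P[h|h|h].
- exact: no_rim_tree_vertex_side K pF pC zF h ez ev.
- by apply: (no_rim_tree_vertex_side (k4_rot K) _ _ _ h ez ev); rewrite ?tr1 ?rm1.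
- by apply: (no_rim_tree_vertex_side (k4_rot (k4_rot K)) _ _ _ h ez ev); rewrite ?tr2 ?rm2.
Qed.

Lemma attached_sub V V' x z R : {subset V' <= V} -> attached V x z R -> attached V' x z R.
Proof. by move=> sub [h1 h2 h3]; split=> // w y wR /sub; apply: h3. Qed.

(* The cycles through x and v with v beyond x on the side from a to b: one uses
   the segment M of the side, the others go round along the rim or through q. *)
Lemma no_chord_of_side a b c q AB BC CA QA QB QC ga al be X1 x X2 v R :
  K4 a b c q AB BC CA QA QB QC ga al be -> AB = X1 ++ x :: X2 -> v \in rcons X2 b ->
  attached (k4_verts a b c q AB BC CA QA QB QC) x v R -> False.
Proof.
move=> K E vX att; have l5 := l_ge.
have bnd := k4_bnd K; have sum := k4_sum K.
have sAB := k4_sAB K; have sBC := k4_sBC K; have sCA := k4_sCA K; have sQC := k4_sQC K; have sQB := k4_sQB K.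
have [R0 hR _] := att.
have [M [N EM]] : exists M N, X2 ++ [:: b] = M ++ v :: N.
  have [M [v' [N [EM /eqP vv _]]]] := @split_first (pred1 v) (rcons X2 b) ltac:(by rewrite has_pred1).
  by exists M, N; rewrite cats1 EM vv.
have hline : ip ((a :: X1) ++ x :: M ++ v :: N).
  by rewrite -EM; have := k4_ab K; rewrite E -catA.
have xv : far x v by apply: ip_ends_far hR.
case: M EM hline => [|m M] EM hline.
  by move: hline => /ip_catr /=; rewrite /ip => /andP[exv _]; rewrite /far exv andbF in xv.
have U := ip_uniq (k4_ab K).
have lineE : a :: AB ++ [:: b] = (a :: X1) ++ x :: m :: M ++ v :: N by rewrite E -catA /= EM.
pose Vk := k4_verts a b c q AB BC CA QA QB QC.
have sub_line y : y \in a :: AB ++ [:: b] -> y \in Vk.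
  rewrite /Vk /k4_verts !(inE, mem_cat) /= => /or3P[->|->|->]; rewrite ?orbT //.
have uline : uniq ((a :: X1) ++ x :: m :: M ++ v :: N) by rewrite -lineE.
have acR s : {subset s <= Vk} -> x \notin s -> v \notin s -> ac R s by apply: attached_ac att.
have hv : ip (v :: N).
  by move: hline; rewrite -[_ :: m :: _]/((x :: m :: M) ++ v :: N) catA => /ip_catr.
have hm : ip (((a :: X1) ++ [:: x]) ++ m :: (M ++ v :: N)) by rewrite -catA.
have := hm; rewrite ip_glueE => /and3P[_ hmv acm].
have hM : ip (x :: (m :: M) ++ [:: v]).
  have : ip ((a :: X1) ++ (x :: (m :: M) ++ [:: v]) ++ N) by rewrite /= -catA.
  by move=> /ip_catr/ip_catl.
have hX1 : ip (a :: X1 ++ [:: x]).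
  by have : ip ((a :: X1 ++ [:: x]) ++ m :: M ++ v :: N) by [rewrite /= -catA]; move=> /ip_catl.
have inAB y : y \in X1 ++ x :: m :: M ++ v :: N -> y != b -> y \in AB.
  move=> h yb; have : y \in AB ++ [:: b] by case: lineE => ->.
  by rewrite mem_cat mem_seq1 (negbTE yb) orbF.
have bN : b = last v N.
  by have := congr1 (last a) lineE; rewrite /= !last_cat /= last_cat.
move: uline; rewrite cat_uniq => /and3P[_ /hasPn uX]; rewrite cons_uniq => /andP[xn _].
have [vX1 va vx vM] : [/\ v \notin X1, v != a, v != x & v \notin m :: M].
  have := ip_uniq hM; rewrite cats1 cons_uniq rcons_uniq mem_rcons inE negb_or eq_sym.
  move=> /and3P[/andP[-> _] -> _].
  have : v \notin a :: X1 by apply: uX; rewrite !(inE, mem_cat) eqxx !orbT.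
  by rewrite inE negb_or => /andP[-> ->].
have xN : x \notin N.
  by apply: contra xn => h; rewrite !(inE, mem_cat) h !orbT.
have [xa xX1] : x != a /\ x \notin X1.
  by have : x \notin a :: X1 by [apply: uX; rewrite mem_head]; rewrite inE negb_or => /andP[].
have vN : v \notin N by move: (ip_uniq hv) => /andP[].
have subN y : y \in N -> y \in Vk.
  by move=> h; apply: sub_line; rewrite lineE !(inE, mem_cat) h !orbT.
have subX y : y \in a :: X1 -> y \in Vk.
  by move=> h; apply: sub_line; rewrite lineE mem_cat h.
have xAB : x \in AB by rewrite E mem_cat mem_head orbT.
have around S : ip (b :: S ++ [:: a]) -> ac AB S -> {subset S <= Vk} ->
    cycle_length (size R + (size N + size S + (size X1).+1) + 2).
  move=> hS aS sS.
  have xS : x \notin S := ac_notin aS xAB.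
  have vS : v \notin S.
    have [->|vb] := eqVneq v b.
      by have := ip_uniq hS; rewrite cons_uniq mem_cat negb_or => /andP[/andP[]].
    by apply: (ac_notin aS); apply: inAB => //; rewrite !(inE, mem_cat) eqxx !orbT.
  have aXS : ac (X1 ++ [:: x]) S.
    by rewrite E in aS; clear -e_sym e_irr l_ge girth_ge odd_size aS; ac_split; ac_goal.
  have RD : ac R (N ++ S ++ a :: X1).
    apply: acR => [y||].
    - by rewrite !mem_cat => /or3P[/subN|/sS|/subX].
    - by rewrite !(mem_cat, inE) !negb_or xN xS xa xX1.
    - by rewrite !(mem_cat, inE) !negb_or vN vS va vX1.
  have Dip : ip (v :: (N ++ S ++ a :: X1) ++ [:: x]).
    have [N0|[N' EN]] : N = [::] \/ exists N', N = N' ++ [:: b].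
      by case/lastP: (N) bN => [_|N' b' ->]; [left | right; exists N'; rewrite last_rcons cats1].
      rewrite N0 /= in bN acm *; rewrite -bN in acm *.
      rewrite -catA /=; apply: (@ip_glue (b :: S) a (X1 ++ [:: x])) => //.
      by clear -e_sym e_irr l_ge girth_ge odd_size acm aXS; ac_split; ac_goal.
    rewrite EN in hv acm *.
    have hN : ip ((v :: N') ++ [:: b]) by [].
    have aXb : ac (b :: S) (X1 ++ [:: x]) by clear -e_sym e_irr l_ge girth_ge odd_size acm aXS; ac_split; ac_goal.
    have vNS : ac (v :: N') S.
      have sub2 : {subset v :: N' <= AB}.
        move=> y yN; apply: inAB.
          rewrite EN !(inE, mem_cat); move: yN; rewrite inE => /orP[->|->]; rewrite ?orbT //.
        have := ip_uniq hN; rewrite cat_uniq /= orbF andbT => /andP[_ bvN].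
        by apply: contraNneq bvN => <-.
      by apply: ac_sub aS sub2 _.
    rewrite -catA /= -!catA.
    apply: (@ip_glue (v :: N') b (S ++ a :: X1 ++ [:: x])) => //.
      by apply: (@ip_glue (b :: S) a (X1 ++ [:: x])).
    by clear -e_sym e_irr l_ge girth_ge odd_size vNS acm; ac_split; ac_goal.
  have := girth2_length R0 hR Dip RD; rewrite !size_cat /=.
  by rewrite (addnA (size N)).
have c1 : cycle_length (size R + (size M).+1 + 2).
  have := @girth2_length x v R (rev (m :: M)) R0 hR (ip_swap hM); rewrite size_rev; apply.
  rewrite ac_revr; apply: acR => [y h||]; rewrite ?(negbTE xn) //.
    by apply: sub_line; rewrite lineE !(inE, mem_cat); move: h; rewrite inE => /orP[->|->]; rewrite ?orbT.
  by apply: contra xn; rewrite !(inE, mem_cat) => /orP[->|->]; rewrite ?orbT.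
have sN : size X1 + size M + size N + 3 = ga.
  have := congr1 size lineE; rewrite /= !size_cat /= size_cat /=; clear -sAB; lia.
have c2 : cycle_length (size R + (size N + size (BC ++ c :: CA) + (size X1).+1) + 2).
  apply: around.
  - rewrite -catA; apply: (@ip_glue (b :: BC) c (CA ++ [:: a])); [exact: k4_bc K|exact: k4_ca K|].
    by k4_atoms; ac_goal.
  - by k4_atoms; ac_goal.
  by move=> y; rewrite /Vk /k4_verts !(inE, mem_cat) => /or3P[->|->|->]; rewrite ?orbT.
have c3 : cycle_length (size R + (size N + size (rev QB ++ q :: QC ++ c :: CA) + (size X1).+1) + 2).
  apply: around.
  - have h1 : ip ((q :: QC) ++ c :: (CA ++ [:: a])).
      by apply: ip_glue; [exact: k4_qc K | exact: k4_ca K | k4_atoms; ac_goal].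
    rewrite -catA /= -catA; apply: (@ip_glue (b :: rev QB) q (QC ++ c :: CA ++ [:: a])) => //.
      exact: ip_swap (k4_qb K).
    by k4_atoms; ac_goal.
  - by k4_atoms; ac_goal.
  by move=> y; rewrite /Vk /k4_verts !(inE, mem_cat, mem_rev) => /or4P[->|->|->|/orP[->|->]]; rewrite ?orbT.
move: c1 c2 c3; rewrite !size_cat /= !size_cat size_rev /= => -[g1 o1] [g2 o2] [g3 o3].
have {bnd}bnd : [/\ ga <= l, 2 <= al & 2 <= be] by clear -bnd; split; lia.
move: (size X1) (size M) (size N) (size R) (size BC) (size CA) (size QC) (size QB)
  sN sBC sCA sQC sQB g1 o1 g2 o2 g3 o3.
clear -sum bnd l5 => x1 m1 n1 r s1 s2 s3 s4 sN sBC sCA sQC sQB g1 o1 g2 o2 g3 o3.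
have [b1 b2 b3] := bnd.
have [o|o] := boolP (odd (r + m1.+1 + 2)).
  have := o1 o; clear o1 o2; have := o3; clear -sN sBC sCA sQC sQB b1 b2 b3 sum o g3; lia.
have oo : odd (r + (n1 + (s1 + s2.+1) + x1.+1) + 2).
  by clear -o sN sBC sCA sum b1 b2 b3; lia.
by have := o2 oo; clear -g1 sN sBC sCA sum b1 b2 b3 l5; lia.
Qed.

(** The rim is a hole of length n, so (1) gives a jump from the interior of its longest side. The
    first vertex of the jump that sees the tree yields an ear to the tree; without such a vertex,
    the jump is a chord of the side or, after exchanging [c] and [q], again an ear. *)
Lemma k4_max_false a b c q AB BC CA QA QB QC ga al be :
  K4 a b c q AB BC CA QA QB QC ga al be -> al <= ga -> be <= ga -> False.
Proof.
move=> K ag bg; have l5 := l_ge.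
have bnd := k4_bnd K; have sum := k4_sum K.
pose C := a :: AB ++ b :: BC ++ c :: CA.
have sC : size C = 2 * l + 1.
  rewrite /C /= !size_cat /= size_cat /= -sum -(k4_sAB K) -(k4_sBC K) -(k4_sCA K); clear; lia.
have hC : induced_cycle e C.
  apply: induced_cycle2; [by have := k4_sAB K; clear -e_sym e_irr l_ge girth_ge odd_size bnd; lia | exact: k4_ab K | | by k4_atoms; ac_goal].
  rewrite -catA; apply: (@ip_glue (b :: BC) c (CA ++ [:: a])); [exact: k4_bc K | exact: k4_ca K|].
  by k4_atoms; ac_goal.
pose h i := nth a C (i %% (2 * l + 1)).
have Hh : is_hole h := hole_of_cycle a hC sC.
have arcC : arc h 0 (2 * l + 1) = C by rewrite (arc_take a sC) // drop0 take_oversize // sC.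
apply: (close_jump Hh) => i v R hi J.
have hAB : arc h 1 (ga - 1) = AB.
  rewrite (arc_take a sC); last by clear -bnd sum; lia.
  by rewrite /C /= drop0 take_size_cat //; have := k4_sAB K; clear; lia.
(* The indices 1, 2, 3 are interior to the side because [ga], as the largest of three numbers with
   sum n >= 11, is at least 4. *)
have xAB : h i \in AB by rewrite -hAB; apply/mem_arcP; exists i => //; clear -hi bnd sum ag bg l5; lia.
move: (h i) xAB J => x xAB J {i hi}.
have RC w : w \in R -> w \notin C by move=> /(jump_outside J); rewrite arcC.
case: J => [xC vC R0 hR hRC]; rewrite arcC in xC vC hRC.
clear arcC hAB Hh h hC sC.
pose F := k4_tree q QA QB QC; pose Vk := k4_verts a b c q AB BC CA QA QB QC.
have VkE : Vk = C ++ F.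
  rewrite /Vk /k4_verts /C /F /k4_tree -[(a :: _) ++ _]/(a :: (AB ++ b :: BC ++ c :: CA) ++ _).
  by rewrite -catA -[(b :: _) ++ _]/(b :: (BC ++ c :: CA) ++ _) -catA.
have [X1 [x' [X2 [EAB /eqP xx _]]]] := @split_first (pred1 x) AB ltac:(by rewrite has_pred1).
rewrite {}xx in EAB.
have aABF : ac AB F by rewrite /F /k4_tree; k4_atoms; ac_goal.
pose seesF := fun r => (r \in F) || has (e r) F.
have [/split_first[R1 [r [R2 [ER sr nR1]]]]|/hasPn none] := boolP (has seesF R).
  have hr1 : ip ((x :: R1) ++ r :: (R2 ++ [:: v])) by move: hR; rewrite ER -catA.
  have := hr1; rewrite ip_glueE => /and3P[hx hrv axr].
  have rF : r \notin F.
    apply: contraTN hx => rF; case/lastP: (R1) nR1 => [_|R1' r' nr].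
      by rewrite ip2 (ac_nedge aABF xAB rF).
    apply: contra nr => hx; rewrite has_rcons /seesF; apply/orP; left; apply/orP; right.
    apply/hasP; exists r => //.
    have : ip ((x :: R1') ++ [:: r'; r]) by move: hx; rewrite /= -cats1 -catA.
    by move=> /ip_catr; rewrite ip2.
  have rR : r \in R by rewrite ER mem_cat mem_head orbT.
  move: sr; rewrite /seesF (negbTE rF) orFb => /hasP[z zF erz].
  (* If [r] is the last vertex of the jump, it is adjacent both to the rim and to the tree. *)
  case: R2 ER hr1 hrv axr => [|y R2] ER hr1 hrv axr.
    move: hrv; rewrite ip2 => erv.
    exact: no_rim_tree_vertex K rF (RC _ rR) zF vC erz erv.
  have hy : ip ((x :: R1 ++ [:: r]) ++ y :: (R2 ++ [:: v])) by move: hr1; rewrite /= -catA.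
  move: hy; rewrite ip_glueE => /and3P[_ _ axy].
  apply: (k4_no_ear (X1 := X1) (X2 := X2) (x := x) (z := z) (R := R1 ++ [:: r]) K ag bg) => //.
  have nF w : w \in R1 -> ac [:: w] F.
    move=> wR; have : ~~ seesF w by apply: contra nR1 => h; apply/hasP; exists w.
    by rewrite /seesF negb_or => /andP[h1 h2]; apply: not_has_ac.
  have sub w : w \in R1 ++ [:: r] -> w \in R.
    by rewrite ER !(inE, mem_cat) => /orP[->|->]; rewrite ?orbT.
  split; first by rewrite size_cat /= addn1.
    have xz : ac (x :: R1) [:: z].
      apply/acP => w z'; rewrite inE => + /[!inE] /eqP->.
      case/predU1P=> [->|wR]; first exact: ac_far_mem aABF xAB zF.
      by apply: ac_far_mem (nF w wR) _ zF; rewrite mem_head.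
    by rewrite -catA; apply: (@ip_glue (x :: R1) r [:: z]); rewrite ?ip2.
  move=> w y' wR; rewrite -/Vk VkE mem_cat => yV yx yz; case/orP: yV => yV.
    have [yv|yv] := eqVneq y' v; last by apply: hRC => //; apply: sub.
    rewrite yv; apply: ac_far_mem axy _ _; first by rewrite inE wR orbT.
    by rewrite mem_cat mem_head orbT.
  move: wR; rewrite mem_cat mem_seq1 => /orP[/nF h|/eqP->].
    by apply: ac_far_mem h _ yV; rewrite mem_head.
  rewrite /far; apply/andP; split; first by apply: contraNneq rF => ->.
  by apply: contra yz => ery; apply/eqP; apply: tree_unique_nbr K rF yV zF ery erz.
have att : attached Vk x v R.
  split=> // w y wR; rewrite VkE mem_cat => /orP[yC yx yv|yF _ _]; first exact: hRC.
  have := none w wR; rewrite /seesF negb_or => /andP[h1 /hasPn/(_ y yF) h2].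
  by rewrite /far h2 andbT; apply: contraNneq h1 => ->.
have vx : v != x.
  have := ip_uniq hR; rewrite cons_uniq mem_cat mem_seq1 negb_or => /andP[/andP[_ h] _].
  by rewrite eq_sym.
have : [|| v \in rcons X2 b, v \in rcons (rev X1) a | v \in c :: CA ++ rev BC ++ rev QC].
  move: vC; rewrite /C EAB !(inE, mem_cat, mem_rcons, mem_rev) (negbTE vx) /=.
  by case: (v == a) (v \in X1) (v \in X2) (v == b) (v \in BC) (v == c) (v \in CA) => [] [] [] [] [] [] [].
case/or3P=> hv.
- exact: no_chord_of_side K EAB hv att.
- apply: (no_chord_of_side (k4_refl K) (X1 := rev X2) (x := x) (X2 := rev X1) _ hv _ ).
    by rewrite EAB rev_cat rev_cons cat_rcons.
  apply: attached_sub att => y; rewrite /Vk /k4_verts !(inE, mem_cat, mem_rev).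
  by case: (y == a) (y == b) (y == c) (y == q) (y \in AB) (y \in BC) (y \in CA) (y \in QA) (y \in QB) (y \in QC) => [] [] [] [] [] [] [] [] [] [].
(* With [c] as the centre, the part of the rim outside the closed side belongs to the tree. *)
apply: (k4_no_ear (k4_exch K) bg ag EAB hv).
apply: attached_sub att => y; rewrite /Vk /k4_verts !(inE, mem_cat, mem_rev).
by case: (y == a) (y == b) (y == c) (y == q) (y \in AB) (y \in BC) (y \in CA) (y \in QA) (y \in QB) (y \in QC) => [] [] [] [] [] [] [] [] [] [].
Qed.

Lemma no_k4 a b c q AB BC CA QA QB QC ga al be :
  ~ K4 a b c q AB BC CA QA QB QC ga al be.
Proof.
move=> K.
have [h|h] := boolP ((al <= ga) && (be <= ga)).
  by case/andP: h => h1 h2; exact: k4_max_false K h1 h2.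
have [h2|h2] := boolP ((be <= al) && (ga <= al)).
  by case/andP: h2 => h3 h4; exact: k4_max_false (k4_rot K) h3 h4.
by apply: (k4_max_false (k4_rot (k4_rot K))); clear -h h2; lia.
Qed.

(** * Three attachments of a connected set to a hole *)

Section NoTri.
Variable c : nat -> T.
Hypothesis Hc : is_hole c.
Local Notation n := (2 * l + 1).

(** Take an induced path from [pa] to [pb] through [Y], follow a walk from [pc] towards it up to the
    first vertex that sees the path, and shorten this walk to an induced leg. *)
Lemma exists_tripod (Y : T -> bool) pa pb pc i j k :
  (forall y, Y y -> unlabelled c y) -> lab c i pa -> lab c j pb -> lab c k pc ->
  far (c i) (c j) -> (exists2 y, Y y & e pa y) -> (exists2 y, Y y & e pb y) ->
  (exists2 y, Y y & e pc y) -> (forall y y', Y y -> Y y' -> y = y' \/ walk Y y y') ->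
  exists P D0 d, tripod Y pc pa pb P D0 d.
Proof.
move=> Yu la lb lc ij [ya Ya ea] [yb Yb eb] [yc Yc ec] conn.
have nY m z : lab c m z -> ~~ Y z.
  by move=> lz; apply/negP => /Yu uz; move: (unl_not_lab Hc m uz); rewrite lz.
have wab : walk Y pa pb.
  apply: (walk_cons ea Ya _); have wb : walk Y yb pb by apply: walk_edge; rewrite e_sym.
  by case: (conn ya yb Ya Yb) => [->//|w]; apply: walk_cat w wb Yb.
have pab : pa != pb by case/andP: (lab_far Hc la lb (andP ij).1).
have [P [hP YP]] := walk_ip wab pab.
case: P hP YP => [|f P] hP YP.
  by move: hP; rewrite ip2 (lab_nadj Hc la lb).
have Yf : Y f by case/andP: YP.
have [s [hs Ys]] : walk Y pc f.
  case: (conn yc f Yc Yf) => [<-|w]; first exact: walk_edge.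
  exact: walk_cons ec Yc w.
pose sees z := (z \in f :: P) || has (e z) (f :: P).
have : has sees (pc :: s).
  apply/hasP; exists (last pc s); first exact: mem_last.
  by move: hs; rewrite rcons_path /sees /= => /andP[_ ->]; rewrite orbT.
move=> /split_first[W1 [w [W2 [EW sw nW1]]]].
have far_f z : z \in W1 -> ac [:: z] (f :: P).
  move=> zW; have : ~~ sees z by apply: contra nW1 => h; apply/hasP; exists z.
  by rewrite /sees negb_or => /andP[]; apply: not_has_ac.
have hps : path e pc s by move: hs; rewrite rcons_path => /andP[].
have wP : w \notin f :: P.
  apply/negP => wP; case: W1 EW nW1 far_f => [|x W1] EW nW1 far_f.
    by case: EW => E _; move: (nY _ _ lc); rewrite E (allP YP w wP).
  case: EW => E Es; rewrite Es cat_path in hps; case/andP: hps => _ /= /andP[ew _].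
  have := far_f (last x W1) (mem_last _ _); rewrite -E => h.
  by rewrite (ac_nedge h (mem_head _ _) wP) in ew.
have ewP : has (e w) (f :: P) by move: sw; rewrite /sees (negbTE wP).
case: W1 EW nW1 far_f => [|x W1] EW nW1 far_f.
  case: EW => E _; exists (f :: P), [::], w; split=> //; last by rewrite wP ewP.
  by exists [::]; rewrite ?E.
case: EW => E Es; rewrite -{x}E in nW1 far_f.
have Yw : Y w by move: Ys; rewrite Es all_cat => /andP[_ /andP[]].
have YW1 : all Y W1 by move: Ys; rewrite Es all_cat => /andP[].
have pcw : pc != w by apply: contraTneq Yw => <-; apply: nY lc.
have hpw : path e pc (rcons W1 w).
  by move: hps; rewrite Es cat_path /= rcons_path => /and3P[-> ->].
have [s' [hs' sub]] := ip_shortest hpw pcw.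
exists (f :: P), (pc :: s'), w; split=> //.
- exists (s' ++ [:: w]) => //; rewrite all_cat; apply/andP; split; last by rewrite /= Yw.
  by apply/allP => z /sub; apply: (allP YW1).
- by rewrite wP ewP.
apply/acP => z u; rewrite inE => hz hu.
apply: ac_far_mem (far_f z _) _ hu; last exact: mem_head.
by rewrite inE; case/orP: hz => [->//|/sub ->]; rewrite orbT.
Qed.

(** Gaps of at least 2 make the feet pairwise nonadjacent; the four normal forms of a tripod are
    then excluded one by one. *)
Lemma no_tri (Y : T -> bool) pa pb pc ga al be :
  2 <= ga -> 2 <= al -> 2 <= be -> ga + al + be = n ->
  (forall y, Y y -> unlabelled c y) ->
  lab c 0 pa -> lab c ga pb -> lab c (ga + al) pc ->
  (exists2 y, Y y & e pa y) -> (exists2 y, Y y & e pb y) ->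
  (exists2 y, Y y & e pc y) -> (forall y y', Y y -> Y y' -> y = y' \/ walk Y y y') -> False.
Proof.
move=> ga2 al2 be2 sum Yu la lb lc ea eb ec conn.
have [f1 f2 f3] := gap_far Hc ga2 al2 be2 sum.
have [P [D0 [d tri]]] := exists_tripod Yu la lb lc f1 ea eb ec conn.
have nY m z : lab c m z -> ~~ Y z.
  by move=> lz; apply/negP => /Yu uz; move: (unl_not_lab Hc m uz); rewrite lz.
have pab := lab_far Hc la lb (andP f1).1.
have pac := lab_far Hc la lc (andP f2).1.
have pbc := lab_far Hc lb lc (andP f3).1.
have [h|h|h|h] := tripod_normal (nY _ _ la) (nY _ _ lb) (nY _ _ lc) pab pac pbc tri.
- have [q [AB [BC [CA [QA [QB [QC K]]]]]]] := tripod_balanced_k4 Hc ga2 al2 be2 sum Yu la lb lc h.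
  exact: no_k4 K.
- exact: (tripod_not_double Hc ga2 al2 be2 sum Yu la lb h).
- exact: (tripod_not_skew Hc ga2 al2 be2 sum Yu la lb lc h).
- exact: (tripod_not_skew' Hc ga2 al2 be2 sum Yu la lb lc h).
Qed.

Lemma jump_ends i j R : jump c (c i) (c j) R -> 2 <= size R ->
  exists x s y, [/\ R = x :: s ++ [:: y], lab c i x, lab c j y & all (unlabelled c) s].
Proof.
move=> J sR; have out w : w \in R -> w \notin arc c 0 n := jump_outside J.
have fij := jump_far J; case: J => [_ _ _ hR hC].
case: R sR out hR hC => [//|x s]; case/lastP: s => [//|s y] _ out hR hC.
rewrite -cats1 in out hR hC; exists x, s, y; rewrite -cats1.
have E : c i :: (x :: s ++ [:: y]) ++ [:: c j] = [:: c i, x & s ++ [:: y; c j]].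
  by rewrite /= -catA.
have hR' : ip ((c i :: x :: s) ++ y :: [:: c j]) by rewrite E in hR.
rewrite E in hR; have := hR; rewrite ip_cons2 => /and3P[eix fi hx].
move: hR'; rewrite ip_glueE ip2 => /and3P[_ eyj aj].
split=> //; first by rewrite /lab out ?mem_head // e_sym.
  by rewrite /lab out ?inE ?mem_cat ?mem_head ?orbT.
apply/allP => z zs; have zR : z \in x :: s ++ [:: y] by rewrite inE mem_cat zs orbT.
rewrite /unlabelled out //; apply/hasPn => w wC.
have [->|wi] := eqVneq w (c i).
  by rewrite e_sym (ac_nedge fi (mem_head _ _)) // mem_cat zs.
have [->|wj] := eqVneq w (c j).
  by rewrite (ac_nedge aj) ?mem_head // !inE zs !orbT.
by case/andP: (hC z w zR wC wi wj).
Qed.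

Lemma jump_arcs i j R k m : jump c (c i) (c j) R -> i < j < i + n ->
  [|| (i < k) && (k + m <= j), (j < k) && (k + m <= i + n) | (k + m <= i) && (j < k + n)] ->
  ac R (arc c k m).
Proof.
move=> J hij h; have ci := hole_per Hc i; have cj := hole_per Hc j.
apply: (jump_ac Hc J); case/or3P: h => /andP[h1 h2].
- by rewrite -ci; apply: (notin_arc Hc); clear -hij h1 h2; lia.
- by rewrite -ci; apply: (notin_arc Hc); clear -hij h1 h2; lia.
- by apply: (notin_arc Hc); clear -hij h1 h2; lia.
- by apply: (notin_arc Hc); clear -hij h1 h2; lia.
- by rewrite -cj; apply: (notin_arc Hc); clear -hij h1 h2; lia.
by apply: (notin_arc Hc); clear -hij h1 h2; lia.
Qed.
End NoTri.

(** * The longest jump *)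

Section LongJump.
Local Notation n := (2 * l + 1).

(* By jump_size, a shortest jump is one whose ends are at maximal distance on the hole. *)
Record jump_pair (c : nat -> T) (d : nat) (R : seq T) (f : nat) (R' : seq T) (t : nat) : Prop :=
MkJumpPair {
  jp_hole : is_hole c;
  jp_d : 2 <= d <= l;
  jp_f : d + 2 <= f <= n - 2;
  jp_t : t < n;
  jp_R : jump c (c 0) (c d) R;
  jp_R' : jump c (c f) (c t) R';
  jp_min : forall u v R0, jump c u v R0 -> size R <= size R0 }.

Section Facts.
Variables (c : nat -> T) (d : nat) (R : seq T) (f : nat) (R' : seq T) (t : nat).
Hypothesis JP : jump_pair c d R f R' t.
Let Hc := jp_hole JP.

Lemma jp_sizeR : size R = n - d - 1.
Proof.
have l5 := l_ge; have hd := jp_d JP; have hf := jp_f JP.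
rewrite (jump_size Hc (jp_R JP)); clear -l5 hd hf; lia.
Qed.

(** Minimality of [R] read on the ends: no jump has its ends at distance greater than d. *)
Lemma jp_size' i j R0 : jump c (c i) (c j) R0 -> i < j < i + n ->
  size R0 = maxn (j - i - 1) (i + n - j - 1) /\ n - d - 1 <= maxn (j - i - 1) (i + n - j - 1).
Proof.
move=> J hij; have sR := jump_size Hc J hij; have := jp_min JP J.
by rewrite jp_sizeR sR.
Qed.

Lemma jp_arcs k m : [|| (0 < k) && (k + m <= d), (d < k) && (k + m <= n) | (n < k) && (k + m <= n + d)] ->
  ac R (arc c k m).
Proof.
have hd := jp_d JP => /or3P[h|h|h].
- by apply: (jump_arcs Hc (jp_R JP)); clear -hd h; lia.
- by apply: (jump_arcs Hc (jp_R JP)); clear -hd h; lia.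
have J : jump c (c n) (c (d + n)) R.
  by rewrite (hole_per Hc) -[n in c n]add0n (hole_per Hc); apply: jp_R JP.
by apply: (jump_arcs Hc J); clear -hd h; lia.
Qed.

Lemma jp_R0 : jump c (c n) (c d) R.
Proof. by rewrite -[n in c n]add0n (hole_per Hc); apply: jp_R JP. Qed.

End Facts.

Ltac arc_step Hc :=
  first
  [ solve [apply (ac_arc Hc); lia]
  | solve [rewrite ac_sym; apply (ac_arc Hc); lia]
  | match goal with
    | H : forall k m, _ -> is_true (ac ?R (arc _ k m)) |- is_true (ac ?R (arc _ _ _)) =>
      solve [apply H; lia]
    | H : forall k m, _ -> is_true (ac ?R (arc _ k m)) |- is_true (ac (arc _ _ _) ?R) =>
      solve [rewrite ac_sym; apply H; lia]
    end ].

(** Single hole vertices are viewed as arcs of length one, so that facts about arcs apply to them as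
    well. *)
Ltac arc_goal Hc :=
  ac_goal;
  repeat match goal with
  | |- is_true (ac [:: ?c ?i] ?s) => change (is_true (ac (arc c i 1) s))
  | |- is_true (ac ?s [:: ?c ?i]) => change (is_true (ac s (arc c i 1)))
  end;
  arc_step Hc.

(** * Two anticomplete jumps *)

Section NoContact.
Variables (c : nat -> T) (d : nat) (R : seq T) (f : nat) (R' : seq T) (t : nat).
Hypothesis JP : jump_pair c d R f R' t.
Hypothesis RR : ac R R'.

(** Here t - f is at most d. Going round [R], the arc from d to f, [R'] and the arc from t to n
    gives length 3n - 2d - 2(t - f), which is odd and greater than n. *)
Lemma jp_after : f < t -> False.
Proof.
move=> ft; have Hc := jp_hole JP; have hd := jp_d JP; have hf := jp_f JP; have ht := jp_t JP.
have l5 := l_ge; have J' := jp_R' JP; have hft : f < t < f + n by clear -ft ht; lia.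
have [far' _ _] := jump_idx Hc J' hft.
have [s1 s2] := jp_size' JP J' hft; have sR := jp_sizeR JP.
have AR := jp_arcs JP; have AR' k m := @jump_arcs c Hc f t R' k m J' hft.
have [_ _ R0 hR _] := jp_R0 JP; have [_ _ R'0 hR' _] := J'.
have df := ip_arc_closed Hc (_ : d < f < d + n - 1).
have {}df := df ltac:(clear -hd hf; lia).
have tn := ip_arc_closed Hc (_ : t < n < t + n - 1).
have {}tn := tn ltac:(clear -ht hf ft l5; lia).
have [A1 EA1] : exists A, A = arc c d.+1 (f - d.+1) by eexists.
have [A2 EA2] : exists A, A = arc c t.+1 (n - t.+1) by eexists.
rewrite -EA1 in df; rewrite -EA2 in tn.
have h1 : ip ((c f :: R') ++ c t :: (A2 ++ [:: c n])).
  by apply: ip_glue => //; rewrite EA2; clear -e_sym e_irr l_ge girth_ge odd_size AR' hd hf ht ft far' Hc l5; arc_goal Hc.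
have h2 : ip ((c d :: A1) ++ c f :: (R' ++ c t :: A2 ++ [:: c n])).
  by apply: ip_glue => //; rewrite EA1 EA2; clear -e_sym e_irr l_ge girth_ge odd_size AR' hd hf ht ft far' Hc l5; arc_goal Hc.
have h3 : ip (c d :: (A1 ++ c f :: R' ++ c t :: A2) ++ [:: c n]).
  by move: h2; rewrite /= -!catA /= -!catA.
have [|g o] := girth2 R0 hR h3.
  by rewrite EA1 EA2; clear -e_sym e_irr l_ge girth_ge odd_size RR AR AR' hd hf ht ft far' Hc l5; arc_goal Hc.
move: g o; rewrite EA1 EA2 !size_cat /= !size_cat /= !size_arc => _ o.
have E : size R' = n - (t - f) - 1 by clear -s1 s2 ft hd hf ht; lia.
have := o ltac:(clear -E sR ft hd hf ht far'; lia).
by clear -E sR ft hd hf ht far'; lia.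
Qed.

(** The jumps share the end [c 0]. The cycle through both and the arc from d to f has length n + 2(f
    - d), odd and too long. *)
Lemma jp_zero : t = 0 -> False.
Proof.
move=> t0; have Hc := jp_hole JP; have hd := jp_d JP; have hf := jp_f JP.
have l5 := l_ge.
have J' : jump c (c f) (c n) R'.
  have -> : c n = c 0 by rewrite -[n in LHS]add0n (hole_per Hc).
  by rewrite -t0; apply: jp_R' JP.
have hft : f < n < f + n by clear -hf hd; lia.
have [s1 s2] := jp_size' JP J' hft; have sR := jp_sizeR JP.
have AR := jp_arcs JP; have AR' k m := @jump_arcs c Hc f n R' k m J' hft.
have [_ _ R0 hR _] := jp_R0 JP; have [_ _ R'0 hR' _] := J'.
have df := ip_arc_closed Hc (_ : d < f < d + n - 1).
have {}df := df ltac:(clear -hd hf; lia).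
have [A1 EA1] : exists A, A = arc c d.+1 (f - d.+1) by eexists.
rewrite -EA1 in df.
have h2 : ip ((c d :: A1) ++ c f :: (R' ++ [:: c n])).
  by apply: ip_glue => //; rewrite EA1; clear -e_sym e_irr l_ge girth_ge odd_size AR' hd hf Hc l5; arc_goal Hc.
have h3 : ip (c d :: (A1 ++ c f :: R') ++ [:: c n]) by move: h2; rewrite /= -!catA.
have [|g o] := girth2 R0 hR h3.
  by rewrite EA1; clear -e_sym e_irr l_ge girth_ge odd_size RR AR AR' hd hf Hc l5; arc_goal Hc.
move: g o; rewrite EA1 !size_cat /= !size_arc => _ o.
have E : size R' = f - 1 by clear -s1 s2 hd hf; lia.
have := o ltac:(clear -E sR hd hf; lia).
by clear -E sR hd hf; lia.
Qed.

(** The ends of the two jumps cross. The cycle uses the arcs from t to d and from f to n and has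
    length 3n - 2f, odd and greater than n as f < n. The bound on f - t fixes the size of [R']. *)
Lemma jp_between : 0 < t < d -> f - t <= d -> False.
Proof.
move=> td ftd; have Hc := jp_hole JP; have hd := jp_d JP; have hf := jp_f JP.
have l5 := l_ge; have J' := jump_rev (jp_R' JP).
have htf : t < f < t + n by clear -hf hd td; lia.
have [s1 s2] := jp_size' JP J' htf; have sR := jp_sizeR JP.
have AR := jp_arcs JP; have AR' k m := @jump_arcs c Hc t f (rev R') k m J' htf.
have [_ _ R0 hR _] := jp_R0 JP; have [_ _ R'0 hR' _] := J'.
have dt := ip_arc_closed Hc (_ : t < d < t + n - 1).
have {}dt := ip_swap (dt ltac:(clear -hd td; lia)).
have fn := ip_arc_closed Hc (_ : f < n < f + n - 1).
have {}fn := fn ltac:(clear -hd hf; lia).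
have [A1 EA1] : exists A, A = arc c t.+1 (d - t.+1) by eexists.
have [A2 EA2] : exists A, A = arc c f.+1 (n - f.+1) by eexists.
have [Q EQ] : exists Q, Q = rev R' by eexists.
rewrite -EA1 in dt; rewrite -EA2 in fn; rewrite -EQ in hR' R'0 AR' s1.
have RQ : ac R Q by rewrite EQ ac_revr.
have h1 : ip ((c t :: Q) ++ c f :: (A2 ++ [:: c n])).
  by apply: ip_glue => //; rewrite EA2; clear -e_sym e_irr l_ge girth_ge odd_size AR' hd hf td ftd Hc l5; arc_goal Hc.
have h2 : ip ((c d :: rev A1) ++ c t :: (Q ++ c f :: A2 ++ [:: c n])).
  by apply: ip_glue => //; rewrite EA1 EA2; clear -e_sym e_irr l_ge girth_ge odd_size AR' hd hf td ftd Hc l5; arc_goal Hc.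
have h3 : ip (c d :: (rev A1 ++ c t :: Q ++ c f :: A2) ++ [:: c n]).
  by move: h2; rewrite /= -!catA /= -!catA.
have [|g o] := girth2 R0 hR h3.
  by rewrite EA1 EA2; clear -e_sym e_irr l_ge girth_ge odd_size RQ AR AR' hd hf td ftd Hc l5; arc_goal Hc.
move: g o; rewrite EA1 EA2 !size_cat /= !size_cat /= !size_rev !size_arc => _ o.
have E : size Q = n - (f - t) - 1 by clear -s1 s2 td hd hf ftd; lia.
have := o ltac:(clear -E sR td hd hf ftd; lia).
by clear -E sR td hd hf ftd; lia.
Qed.
End NoContact.

(** * First contact of the second jump with the first *)

Section Contact.
Variables (c : nat -> T) (d : nat) (R : seq T) (f : nat) (R' : seq T) (t : nat).
Hypothesis JP : jump_pair c d R f R' t.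
Variables (x1 xk : T) (I : seq T).
Hypotheses (ER : R = x1 :: I ++ [:: xk]).

Lemma jp_lab : [/\ lab c 0 x1, lab c d xk & all (unlabelled c) I].
Proof.
have l5 := l_ge; have hd := jp_d JP; have := jp_sizeR JP => sR.
have [|x [s [y [E lx ly us]]]] := jump_ends (jp_R JP); first by clear -sR hd l5; lia.
have {}E : x1 :: I ++ [:: xk] = x :: s ++ [:: y] by rewrite -ER.
by case: E lx ly us => ->; rewrite !cats1 => /rcons_inj[-> ->].
Qed.

(** The start of [R'] up to [r], followed by [x1], is a jump from [c f] to [c 0], so its size is f -
    1. Closing it with the rest of [R] and the arc from d to f gives an odd cycle of length n + 2(f
    - d - 1), too long because f >= d + 2. *)
Lemma jp_first_contact R1 r R2 : R' = R1 ++ r :: R2 -> 0 < size R2 -> ac R1 R ->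
  e r x1 -> ac [:: r] (I ++ [:: xk]) -> False.
Proof.
move=> ER' R20 aR1 erx rI; have Hc := jp_hole JP; have hd := jp_d JP; have hf := jp_f JP.
have l5 := l_ge; have [lx1 lxk uI] := jp_lab.
have sR := jp_sizeR JP; have minR := jp_min JP (jp_R' JP).
have [|p [s [p' [E' lp lp' us]]]] := jump_ends (jp_R' JP); first by clear -sR minR hd l5; lia.
have [_ _ R'0 hR' _] := jp_R' JP.
case: R1 ER' aR1 => [|p1 R1] ER' aR1.
  by move: erx; case: (ER') E' => -> [-> _]; rewrite (lab_nadj Hc lp lx1).
have {}lp : lab c f p1 by move: E'; rewrite ER' => -[-> _].
have uRr : all (unlabelled c) (R1 ++ [:: r]).
  move: E'; rewrite ER'; case/lastP: (R2) R20 => // R3 y _ [_ E].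
  have {E} : rcons (R1 ++ r :: R3) y = rcons s p' by rewrite -cats1 -catA /= cats1 E cats1.
  move=> /rcons_inj[E _]; move: us; rewrite -E -cat_rcons -cats1 all_cat.
  by case/andP.
have lx1n : lab c n x1 by rewrite /lab -[n in c n]add0n (hole_per Hc).
have f_n : far (c f) (c n) by apply: (hole_far Hc); clear -hf hd; lia.
have hpr : ip ((p1 :: R1) ++ [:: r]).
  have : ip (c f :: ((p1 :: R1) ++ [:: r]) ++ (R2 ++ [:: c t])).
    by move: hR'; rewrite ER' /= -!catA.
  by move=> /(@ip_catr [:: c f])/ip_catl.
have hprx : ip ((p1 :: R1) ++ r :: [:: x1]).
  by apply: ip_glue; rewrite ?ip2 //; rewrite ER in aR1; clear -e_sym e_irr l_ge girth_ge odd_size aR1; ac_split; ac_goal.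
have J2 : jump c (c f) (c n) (p1 :: (R1 ++ [:: r]) ++ [:: x1]).
  by apply: (lab_path_jump Hc) => //; move: hprx; rewrite /= -catA.
have hfn : f < n < f + n by clear -hf hd; lia.
have [s1 s2] := jp_size' JP J2 hfn.
have AJ k m := @jump_arcs c Hc f n _ k m J2 hfn.
have AR := jp_arcs JP.
have df := ip_arc_closed Hc (_ : d < f < d + n - 1).
have {}df := df ltac:(clear -hd hf; lia).
have [A1 EA1] : exists A, A = arc c d.+1 (f - d.+1) by eexists.
rewrite -EA1 in df.
have [_ _ _ hJ _] := J2; have [_ _ _ hR _] := jp_R JP.
have hxd : ip (x1 :: (I ++ [:: xk]) ++ [:: c d]).
  by move: hR; rewrite ER => /(@ip_catr [:: c 0]).
have hfx : ip (c f :: (p1 :: R1 ++ [:: r]) ++ [:: x1]).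
  have : ip ((c f :: (p1 :: R1 ++ [:: r]) ++ [:: x1]) ++ [:: c n]) by [].
  by move=> /ip_catl.
have AJ1 : ac (c d :: A1) (p1 :: (R1 ++ [:: r]) ++ [:: x1]).
  have E : c d :: A1 = arc c d (f - d).
    by rewrite EA1 -arcS; congr arc; clear -hd hf; lia.
  by rewrite E ac_sym; apply: AJ; clear -hd hf; lia.
have h2 : ip ((c d :: A1) ++ c f :: ((p1 :: R1 ++ [:: r]) ++ [:: x1])).
  by apply: ip_glue => //; rewrite EA1; clear -e_sym e_irr l_ge girth_ge odd_size hd hf Hc l5; arc_goal Hc.
have h3 : ip (c d :: (A1 ++ c f :: (p1 :: R1 ++ [:: r])) ++ [:: x1]).
  by move: h2; rewrite /= -!catA /= -?catA.
have ARf : ac R (A1 ++ [:: c f]).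
  have -> : A1 ++ [:: c f] = arc c d.+1 (f - d).
    have -> : f - d = (f - d.+1).+1 by clear -hf; lia.
    by rewrite arcSr EA1; congr (_ ++ [:: c _]); clear -hf; lia.
  by apply: AR; clear -hd hf; lia.
have [||g o] := girth2 _ hxd h3; first by rewrite size_cat addn1.
  by rewrite ER in ARf aR1; clear -e_sym e_irr l_ge girth_ge odd_size ARf aR1 rI; ac_split; ac_goal.
have sI : (size (I ++ [:: xk])).+1 = size R by rewrite ER.
move: g o s1; rewrite EA1 !size_cat /= ?size_cat /= ?size_cat /= !size_arc => _ o s1.
rewrite size_cat /= in sI.
have E : size R1 + 3 = f - 1 by clear -s1 s2 hd hf; lia.
have := o ltac:(clear -E sR sI hd hf; lia).
by clear -E sR sI hd hf; lia.
Qed.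
End Contact.
End LongJump.

Section LongJumpEnd.
Local Notation n := (2 * l + 1).

Lemma path_conn (D : T -> bool) x s y z : path e x s -> all D (x :: s) ->
  y \in x :: s -> z \in x :: s -> y = z \/ walk D y z.
Proof.
move=> hp /= /andP[Dx Ds] hy hz.
have H w : w \in x :: s -> w = x \/ walk D x w.
  by rewrite inE => /predU1P[|h]; [left | right; apply: path_walk hp Ds h].
case: (H y hy) => [->|wy]; case: (H z hz) => [->|wz]; try by left.
- by right.
- by right; apply: walk_rev.
by right; apply: walk_cat (walk_rev wy) wz Dx.
Qed.

Section Last.
Variables (c : nat -> T) (d : nat) (R : seq T) (f : nat) (R' : seq T) (t : nat).
Hypothesis JP : jump_pair c d R f R' t.
Variables (x1 xk : T) (I : seq T).
Hypotheses (ER : R = x1 :: I ++ [:: xk]).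
Let Hc := jp_hole JP.

Lemma jp_ip : ip R.
Proof.
by have [_ _ _ h _] := jp_R JP; have : ip ([:: c 0] ++ R ++ [:: c d]) by []; move=> /ip_catr/ip_catl.
Qed.

(** The vertices of [I] and [Q] form a connected unlabelled set attached to [x1], [xk] and [p],
    whose feet 0, d, k are pairwise nonadjacent. An empty [Q] means that [p] itself is adjacent to
    [z]. *)
Lemma jp_tri Q p z k : path e p Q -> all (unlabelled c) Q -> z \in I -> e (last p Q) z ->
  lab c k p -> (d + 2 <= k <= n - 2) || (2 <= k <= d - 2) -> False.
Proof.
move=> hQ uQ zI epz lp hk; have l5 := l_ge; have hd := jp_d JP.
have [lx1 lxk uI] := jp_lab JP ER.
have hR := jp_ip.
pose Y y := y \in I ++ Q.
have [i0 [I' EI]] : exists i0 I', I = i0 :: I' by case: (I) zI => // i0 I'; exists i0, I'.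
rewrite ER EI in hR.
have e1 : e x1 i0 by have := ip_path hR => /= /andP[].
have hI : path e i0 (rcons I' xk).
  by have := ip_path hR => /= /andP[_]; rewrite cats1.
have [hI' ek] : path e i0 I' /\ e (last i0 I') xk.
  by move: hI; rewrite rcons_path => /andP[].
have YI : all Y (i0 :: I') by apply/allP => y; rewrite /Y mem_cat EI => ->.
have YQ : all Y Q by apply/allP => y; rewrite /Y mem_cat => ->; rewrite orbT.
have Yz : Y z by rewrite /Y mem_cat zI.
have toz y : Y y -> y = z \/ walk Y y z.
  rewrite {1}/Y mem_cat => /orP[yI|yQ].
    by apply: (path_conn hI' YI); rewrite -EI.
  case: Q uQ hQ epz @Y YI YQ Yz yQ => // q Q uQ hQ epz Y YI YQ Yz yQ; right.
  have /= /andP[_ hQ'] := hQ.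
  have Yl : Y (last q Q) by apply: (allP YQ); apply: mem_last.
  case: (path_conn hQ' YQ yQ (mem_last q Q)) => [->|w]; first exact: walk_edge.
  exact: walk_cat w (walk_edge _ epz) Yl.
have conn y y' : Y y -> Y y' -> y = y' \/ walk Y y y'.
  move=> /toz[->|w] /toz[->|w']; [by left | right; exact: walk_rev | by right | right].
  exact: walk_cat w (walk_rev w') Yz.
have Yu y : Y y -> unlabelled c y.
  by rewrite /Y mem_cat => /orP[/(allP uI)|/(allP uQ)].
have n1 : exists2 y, Y y & e x1 y by exists i0 => //; case/andP: YI.
have nk : exists2 y, Y y & e xk y.
  by exists (last i0 I'); [apply: (allP YI); exact: mem_last | rewrite e_sym].
have np : exists2 y, Y y & e p y.
  case: Q uQ hQ epz @Y YI YQ Yz toz conn Yu n1 nk => [|q Q] uQ hQ epz Y YI YQ *.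
    by exists z.
  by exists q; [case/andP: YQ | case/andP: hQ].
case/orP: hk => hk.
  have E : k = d + (k - d) by clear -hk; lia.
  rewrite E in lp.
  by apply: (no_tri Hc _ _ _ _ Yu lx1 lxk lp n1 nk np conn (be := n - k)); clear -hk hd; lia.
have E : d = k + (d - k) by clear -hk; lia.
rewrite E in lxk.
by apply: (no_tri Hc _ _ _ _ Yu lx1 lp lxk n1 np nk conn (be := n - d)); clear -hk hd l5; lia.
Qed.

(* p is a labelled vertex with neighbours on R, and A is the part of R before the last of them. *)
Lemma jp_last_contact k p : lab c k p -> has (e p) R -> p \notin R ->
  (k == 0) || (far (c k) (c d) && ((k == 1) || (k == n - 1))) -> False.
Proof.
move=> lp hp pR hk; have l5 := l_ge; have hd := jp_d JP.
have [lx1 lxk uI] := jp_lab JP ER; have sR := jp_sizeR JP.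
have hR := jp_ip.
have [A [z [B [E epz nB]]]] := split_last hp.
have f0d := jump_far (jp_R JP).
have fkd : far (c k) (c d) by case/orP: hk => [/eqP->|/andP[]].
have z1 : z != x1 by apply: contraTneq epz => ->; rewrite (lab_nadj Hc lp lx1).
have zk : z != xk by apply: contraTneq epz => ->; rewrite (lab_nadj Hc lp lxk).
case: A E => [|a1 A] E; first by move: z1; move: E; rewrite ER => -[->]; rewrite eqxx.
have Ea : a1 = x1 by move: E; rewrite ER => -[].
rewrite {}Ea in E.
have [B' EB] : exists B', B = B' ++ [:: xk].
  case/lastP: B E {nB} => [|B y] E.
    have E' : (x1 :: I) ++ [:: xk] = (x1 :: A) ++ [:: z] by rewrite -E ER.
    by move: E' zk; rewrite !cats1 => /rcons_inj[_ ->]; rewrite eqxx.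
  have E' : (x1 :: I) ++ [:: xk] = ((x1 :: A) ++ z :: B) ++ [:: y].
    have -> : ((x1 :: A) ++ z :: B) ++ [:: y] = (x1 :: A) ++ z :: rcons B y.
      by rewrite -cats1 -catA.
    by rewrite -E ER.
  by move: E'; rewrite !cats1 => /rcons_inj[_ ->]; exists B; rewrite cats1.
have EI : I = A ++ z :: B'.
  have E' : (x1 :: I) ++ [:: xk] = (x1 :: A ++ z :: B') ++ [:: xk].
    have -> : (x1 :: A ++ z :: B') ++ [:: xk] = (x1 :: A) ++ z :: B by rewrite EB /= -catA.
    by rewrite -E ER.
  by move: E'; rewrite !cats1 => /rcons_inj[].
have hRz : ip (z :: B' ++ [:: xk]) by move: hR; rewrite E EB => /ip_catr.
have hpz : ip (p :: (z :: B') ++ [:: xk]).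
  rewrite -[_ :: _]/[:: p, z & B' ++ [:: xk]] ip_cons2 epz hRz andbT andTb -EB.
  by apply: not_has_ac => //; apply: contra pR => h; rewrite E !(mem_cat, inE) h !orbT.
have uzB : all (unlabelled c) (z :: B') by move: uI; rewrite EI all_cat => /andP[].
have J2 := lab_path_jump Hc lp lxk fkd hpz uzB.
have sE : size A + size B' + 3 = size R by rewrite E EB /= size_cat /= size_cat /=; clear; lia.
have pC : p \notin arc c 0 n by case/andP: lp.
have RC w : w \in R -> w \notin arc c 0 n := jump_outside (jp_R JP).
have cR j w : w \in R -> c j != w.
  by move=> /RC; apply: contraNneq => <-; apply: on_hole.
have hpre : ip (x1 :: A ++ [:: z]).
  by have : ip ((x1 :: A ++ [:: z]) ++ B) by [move: hR; rewrite E /= -catA]; move=> /ip_catl.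
have preR w : w \in x1 :: A ++ [:: z] -> w \in R.
  by rewrite E !(inE, mem_cat) => /or3P[->|->|->]; rewrite ?orbT.
have cpre j : c j \notin x1 :: A ++ [:: z].
  by apply/negP => /preR /(cR j); rewrite eqxx.
have ppre : p \notin x1 :: A ++ [:: z] by apply: contra pR => /preR.
have pc j : p != c j by apply: contraNneq pC => ->; apply: on_hole.
have ex1 : e (c 0) x1 by rewrite e_sym; case/andP: lx1.
have cn : c n = c 0 by rewrite -[n in LHS]add0n (hole_per Hc).
(* The feet fix the size of the jump from [p] through [z] to [xk], to be compared with [R]. For k =
   1 it would have more vertices than [R]; otherwise nothing lies between [x1] and [z], and [p]
   closes a cycle of at most five vertices. *)
case/orP: hk => [/eqP k0|/andP[_ /orP[]/eqP kk]].
- rewrite k0 in J2 lp; have [|s2 _] := jp_size' JP J2; first by clear -hd; lia.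
  have hp1 : path e (c 0) (x1 :: A ++ [:: z]) by rewrite /= ex1; apply: ip_path hpre.
  have hu1 : uniq (c 0 :: x1 :: A ++ [:: z]) by rewrite cons_uniq cpre (ip_uniq hpre).
  have hn1 : p \notin c 0 :: x1 :: A ++ [:: z] by rewrite inE negb_or pc.
  have := girth_close hp1 hu1 hn1 isT (andP lp).2; rewrite /= last_cat size_cat /= => /(_ epz).
  by move: s2; rewrite /= size_cat /=; clear -sE sR hd l5; lia.
- rewrite kk in J2 fkd.
  have [|s2 _] := jp_size' JP J2; last first.
    by move: s2; rewrite /= size_cat /=; clear -sE sR hd l5; lia.
  have : d != 1 by apply: contraTneq fkd => ->; rewrite /far eqxx.
  by clear -hd; lia.
have J3 := jump_rev J2; rewrite kk in J3 lp.
have [|s2 _] := jp_size' JP J3; first by clear -hd l5; lia.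
have enn : e (c (n - 1)) (c n) by rewrite (hole_adj Hc); clear -l5; lia.
have hp1 : path e (c (n - 1)) (c n :: x1 :: A ++ [:: z]).
  by rewrite /= enn cn ex1; apply: ip_path hpre.
have nn : c (n - 1) != c n by apply: (hole_neq Hc); clear -l5; lia.
have hu1 : uniq (c (n - 1) :: c n :: x1 :: A ++ [:: z]).
  by rewrite cons_uniq inE negb_or nn cpre cons_uniq cpre (ip_uniq hpre).
have hn1 : p \notin c (n - 1) :: c n :: x1 :: A ++ [:: z] by rewrite !(in_cons, negb_or) !pc; move: ppre; rewrite in_cons negb_or.
have := girth_close hp1 hu1 hn1 isT (andP lp).2; rewrite /= last_cat size_cat /= => /(_ epz).
by move: s2; rewrite size_rev /= !size_cat /=; clear -sE sR hd l5; lia.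
Qed.
End Last.
End LongJumpEnd.

(** * Contradiction from the longest jump *)

Section LongJumpFalse.
Local Notation n := (2 * l + 1).

(** The reflection exchanging 0 and d reverses [R] and keeps f between d + 2 and n - 2, so each case
    on t also settles its mirror image. *)
Lemma jp_mirror c d R f R' t : jump_pair c d R f R' t ->
  exists2 c', jump_pair c' d (rev R) (n + d - f) R' (if t <= d then d - t else n + d - t) &
    forall i x, i < n -> lab c i x -> lab c' (if i <= d then d - i else n + d - i) x.
Proof.
move=> JP; have Hc := jp_hole JP; have hd := jp_d JP; have hf := jp_f JP; have ht := jp_t JP.
have [|c' [Hc' mem c1 c2]] := @hole_mirror c d Hc; first by clear -hd; lia.
have c0 : c' 0 = c d by rewrite c1 // subn0.
have cd : c' d = c 0 by rewrite c1 // subnn.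
have cf : c' (n + d - f) = c f.
  by rewrite c2; [congr c | ]; clear -hd hf; lia.
have ci i : i < n -> c' (if i <= d then d - i else n + d - i) = c i.
  move=> hi; case: leqP => h; first by rewrite c1; [congr c|]; clear -h; lia.
  by rewrite c2; [congr c|]; clear -h hi; lia.
have ct := ci t ht.
exists c'; last by move=> i x hi; rewrite /lab ci // mem.
split=> //.
- by clear -hf hd; lia.
- by clear -ht hd; case: (leqP t d) => ?; lia.
- by rewrite c0 cd; apply: jump_ext mem _ _ _ (jump_rev (jp_R JP)).
- by rewrite cf ct; apply: jump_ext mem _ _ _ (jp_R' JP).
move=> u v R0 J; rewrite size_rev; apply: (jp_min JP (u := u) (v := v)).
by apply: jump_ext J => x; rewrite mem.
Qed.

Section False_.
Variables (c : nat -> T) (d : nat) (R : seq T) (f : nat) (R' : seq T) (t : nat).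
Hypothesis JP : jump_pair c d R f R' t.

(** [R'] is no shorter than [R], so its ends are at distance at most d, measured one way round or
    the other. *)
Lemma jp_distance : [/\ t != f, t != f + 1, t + 1 != f, t != f &
  (f < t -> t - f <= d \/ f + n - t <= d) /\ (t < f -> f - t <= d \/ t + n - f <= d)].
Proof.
have Hc := jp_hole JP; have hd := jp_d JP; have hf := jp_f JP; have ht := jp_t JP.
have J := jp_R' JP; have ff := jump_far J.
have tf : t != f by apply: contraTneq ff => ->; rewrite /far eqxx.
have l5 := l_ge; case: (ltngtP t f) tf => // h _.
  have htf : t < f < t + n by clear -h hf; lia.
  have [b _ _] := jump_idx Hc (jump_rev J) htf.
  have [_ s2] := jp_size' JP (jump_rev J) htf.
  by split; [clear -b htf; lia..| split; clear -b htf s2 hd; lia].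
have hft : f < t < f + n by clear -h ht; lia.
have [b _ _] := jump_idx Hc J hft.
have [_ s2] := jp_size' JP J hft.
by split; [clear -b hft; lia..| split; clear -b hft s2 hd; lia].
Qed.

Lemma jp_no_contact : ac R R' -> False.
Proof.
move=> RR; have hd := jp_d JP; have hf := jp_f JP; have ht := jp_t JP.
have [c' JP' lab'] := jp_mirror JP.
have RR' : ac (rev R) R' by rewrite ac_revl.
have [d1 d2 d3 _ [d4 d5]] := jp_distance.
case: (ltngtP t f) d1 => // h _; last exact: (jp_after JP RR h).
have [t0|t0] := eqVneq t 0; first exact: (jp_zero JP RR t0).
case: (ltngtP t d) => td.
- have [ftd|ftd] : f - t <= d \/ t + n - f <= d by apply: d5.
    by apply: (jp_between JP RR) ftd; clear -t0 td; lia.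
  move: JP'; rewrite (ltnW td) => JP'.
  by apply: (jp_between JP' RR'); clear -t0 td ftd hf hd; lia.
- move: JP'; rewrite leqNgt td /= => JP'.
  by apply: (jp_after JP' RR'); clear -h hf ht; lia.
by move: JP'; rewrite td leqnn subnn => JP'; apply: (jp_zero JP' RR').
Qed.

Variables (x1 xk : T) (I : seq T).
Hypotheses (ER : R = x1 :: I ++ [:: xk]).

(** If [r] is not the last vertex of [R'], it is unlabelled or labelled f: a neighbour in [I] gives
    configuration (2), and a single contact at an end of [R] falls to [jp_first_contact] or its
    mirror image. If [r] is the last vertex, its label t decides whether (2) applies or t is too
    close to an end of [R]. *)
Lemma jp_contact R1 r R2 : R' = R1 ++ r :: R2 -> ac R1 R -> r \notin R -> has (e r) R -> False.
Proof.
move=> ER' aR1 rR er; have Hc := jp_hole JP; have l5 := l_ge.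
have hd := jp_d JP; have hf := jp_f JP; have ht := jp_t JP.
have [lx1 lxk uI] := jp_lab JP ER.
have sR := jp_sizeR JP; have minR := jp_min JP (jp_R' JP).
have [c' JP' lab'] := jp_mirror JP.
have Erev : rev R = xk :: rev I ++ [:: x1] by rewrite ER rev_cons rev_cat /= -cats1.
have [|p [s [p' [E' lp lp' us]]]] := jump_ends (jp_R' JP); first by clear -sR minR hd l5; lia.
have hR' : ip R'.
  by have [_ _ _ h _] := jp_R' JP; have : ip ([:: c f] ++ R' ++ [:: c t]) by []; move=> /ip_catr/ip_catl.
have [d1 d2 d3 _ [d4 d5]] := jp_distance.
case/lastP: R2 ER' => [|R2 y] ER'.
  have {p' lp' E'}lr : lab c t r.
    have : rcons (p :: s) p' = rcons R1 r by rewrite -!cats1 -ER' E'.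
    by move/rcons_inj=> [_ <-].
  have [tz|tz] := boolP ((t == 0) || (far (c t) (c d) && ((t == 1) || (t == n - 1)))).
    exact: (jp_last_contact JP ER lr er rR tz).
  have lr' := lab' _ _ ht lr.
  have er' : has (e r) (rev R) by rewrite has_rev.
  have rR' : r \notin rev R by rewrite mem_rev.
  have [Hc' J'0] := (jp_hole JP', jp_R JP').
  have [tz'|tz'] := boolP [|| t == d, t == d + 1 | (t == d - 1) && (2 < d)].
    apply: (jp_last_contact JP' Erev lr' er' rR').
    case/or3P: tz' => [/eqP->|/eqP->|/andP[/eqP-> d3']].
    - by rewrite leqnn subnn.
    - have -> : (d + 1 <= d) = false by clear; lia.
      have -> : n + d - (d + 1) = n - 1 by clear; lia.
      rewrite eqxx orbT andbT orbC far_sym; apply/orP; left.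
      by apply: (hole_far Hc'); clear -hd l5; lia.
    have -> : d - 1 <= d by clear; lia.
    have -> : d - (d - 1) = 1 by clear -hd; lia.
    by rewrite eqxx andbT; apply/orP; right; apply: (hole_far Hc'); clear -hd d3' l5; lia.
  have t1 : ~~ ((t == 1) && (2 < d)) && (t != n - 1).
    apply/andP; split; apply: contra tz; [move=> /andP[/eqP-> h] | move=> /eqP->].
      by rewrite eqxx andbT; apply/orP; right; apply: (hole_far Hc); clear -hd h l5; lia.
    rewrite eqxx orbT andbT far_sym; apply/orP; right.
    by apply: (hole_far Hc); clear -hd l5; lia.
  have t2 : t != 0 by apply: contraNneq tz => ->.
  have [tt|tt] := boolP ((d + 2 <= t <= n - 2) || (2 <= t <= d - 2)).
    case/hasP: er => z; rewrite ER inE mem_cat mem_seq1 => hz erz.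
    apply: (jp_tri JP ER (Q := [::]) (z := z) (p := r) _ _ _ _ lr tt) => //.
    case/or3P: hz erz => [/eqP->|//|/eqP->]; first by rewrite (lab_nadj Hc lr lx1).
    by rewrite (lab_nadj Hc lr lxk).
  (* What is left is d = 2 and t = 1, where both distances from f to t exceed d. *)
  by clear -tt t1 t2 tz' hd hf ht d4 d5; lia.
have [/hasP[z zI erz]|nI] := boolP (has (e r) I).
  have hk : (d + 2 <= f <= n - 2) || (2 <= f <= d - 2) by rewrite hf.
  case: R1 ER' aR1 => [|p1 R1] ER' aR1.
    have Ep : p = r by move: E'; rewrite ER' => -[].
    by apply: (jp_tri JP ER (Q := [::]) (p := r) (z := z) _ _ _ _ _ hk); rewrite // -Ep.
  have Ep : p = p1 by move: E'; rewrite ER' => -[].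
  rewrite {p}Ep in lp E'.
  apply: (jp_tri JP ER (Q := R1 ++ [:: r]) (p := p1) (z := z) _ _ zI _ lp hk).
  - apply: ip_path; have : ip ((p1 :: R1 ++ [:: r]) ++ rcons R2 y).
      by move: hR'; rewrite ER' /= -catA.
    by move=> /ip_catl.
  - have : rcons (R1 ++ r :: R2) y = rcons s p'.
      by move: E'; rewrite ER' cats1 rcons_cat => -[].
    by move=> /rcons_inj[E _]; move: us; rewrite -E -cat_rcons -cats1 all_cat => /andP[].
  by rewrite last_cat.
have rI : ac [:: r] I.
  by apply: not_has_ac => //; apply: contra rR => h; rewrite ER inE mem_cat h orbT.
have rx (w : T) : w \in R -> ~~ e r w -> ac [:: r] [:: w].
  by move=> wR h; rewrite ac11 /far h andbT; apply: contraNneq rR => ->.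
have x1R : x1 \in R by rewrite ER mem_head.
have xkR : xk \in R by rewrite ER inE mem_cat mem_head !orbT.
have hRip : ip (x1 :: I ++ [:: xk]) by rewrite -ER; apply: jp_ip JP.
have R20 : 0 < size (rcons R2 y) by rewrite size_rcons.
have [e1|e1] := boolP (e r x1); have [ek|ek] := boolP (e r xk).
- have := path_close hRip (_ : r \notin _) e1 ek; rewrite -ER => /(_ rR).
  by move: sR; rewrite ER /= size_cat /=; clear -hd l5; lia.
- apply: (jp_first_contact JP ER ER' R20 aR1 e1).
  by rewrite ac_catr rI; apply: rx.
- apply: (jp_first_contact JP' Erev ER' R20 _ ek); first by rewrite ac_revr.
  by rewrite ac_catr ac_revr rI; apply: rx.
move: er; rewrite ER -cat1s !has_cat !has_seq1.
by rewrite (negbTE e1) (negbTE ek) (negbTE nI).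
Qed.

Lemma jp_false0 : False.
Proof.
pose sees r := (r \in R) || has (e r) R.
have [/split_first[R1 [r [R2 [E sr nR1]]]]|/hasPn none] := boolP (has sees R').
  have aR1 : ac R1 R.
    apply/acP => w u wR uR; have : ~~ sees w by apply: contra nR1 => h; apply/hasP; exists w.
    rewrite /sees negb_or => /andP[h1 /hasPn/(_ u uR) h2].
    by rewrite /far h2 andbT; apply: contraNneq h1 => ->.
  have Hc := jp_hole JP; have hd := jp_d JP; have hf := jp_f JP.
  have rR : r \notin R.
    apply/negP => rR; have [_ _ _ hR' _] := jp_R' JP.
    case/lastP: R1 E nR1 aR1 => [|R1 w] E _ aR1.
      have l5 := l_ge; have sR := jp_sizeR JP; have minR := jp_min JP (jp_R' JP).
      have [|p [s [p' [E' lp _ _]]]] := jump_ends (jp_R' JP); first by clear -sR minR hd l5; lia.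
      have Ep : p = r by move: E'; rewrite E => -[].
      have [_ _ _ _ h] := jp_R JP.
      have nf j : j < f < j + n -> c f != c j.
        by move=> hj; rewrite eq_sym; apply: (hole_neq Hc).
      have := h r (c f) rR (on_hole Hc f) (nf 0 _) (nf d _).
      by rewrite /far -Ep (andP lp).2 andbF => h'; have := h' ltac:(clear -hf; lia) ltac:(clear -hd hf; lia).
    have ewr : e w r.
      have : ip ((c f :: R1) ++ [:: w, r & R2 ++ [:: c t]]).
        by move: hR'; rewrite E -cats1 /= -!catA.
      by move=> /ip_catr; rewrite ip_cons2 => /andP[].
    by move: ewr; rewrite (ac_nedge aR1) // mem_rcons mem_head.
  by apply: (jp_contact E aR1 rR); move: sr; rewrite /sees (negbTE rR).
apply: jp_no_contact; rewrite ac_sym; apply/acP => w u wR uR.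
have := none w wR; rewrite /sees negb_or => /andP[h1 /hasPn/(_ u uR) h2].
by rewrite /far h2 andbT; apply: contraNneq h1 => ->.
Qed.
End False_.

Lemma jp_false c d R f R' t : ~ jump_pair c d R f R' t.
Proof.
move=> JP; have l5 := l_ge; have hd := jp_d JP; have sR := jp_sizeR JP.
have [|x [s [y [E _ _ _]]]] := jump_ends (jp_R JP); first by clear -sR hd l5; lia.
exact: (jp_false0 JP E).
Qed.
End LongJumpFalse.

(** Induction on the size provides a jump [R] of minimal size; reversing it if necessary, its ends
    become i and i + d with d <= l, and a shift moves them to 0 and d. *)
Lemma no_hole c : ~ is_hole c.
Proof.
move=> Hc; have l5 := l_ge.
suff H k u v R : size R < k -> jump c u v R -> False.
  by apply: (close_jump Hc) => i v R _ J; apply: H (leqnn _) J.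
elim: k u v R => // k IH u v R sk J.
have minJ u' v' R0 : jump c u' v' R0 -> size R <= size R0.
  by move=> J0; rewrite leqNgt; apply/negP => h; apply: IH J0; clear -h sk; lia.
have [i [d [hd [u' [v' [R0 [J0 [sR0 Eu Ev]]]]]]]] : exists i d, 2 <= d <= l /\
    exists u v R0, [/\ jump c u v R0, size R0 = size R, u = c i & v = c (i + d)].
  have [uC vC _ _ _] := J; have [i _ Eu] := hole_idx Hc 0 uC; have [j hj Ev] := hole_idx Hc i vC.
  have f_uv := jump_far J; have ij : i < j < i + (2 * l + 1).
    have : i != j by apply: contraTneq f_uv => E; rewrite Eu Ev E /far eqxx.
    by clear -hj; lia.
  rewrite Eu Ev in J f_uv; have b := far_idx Hc ij f_uv.
  have [h|h] := leqP (j - i) l.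
    exists i, (j - i); split; first by clear -h b; lia.
    by exists (c i), (c j), R; split=> //; congr c; clear -ij; lia.
  exists j, (i + (2 * l + 1) - j); split; first by clear -h b; lia.
  exists (c j), (c i), (rev R); split; rewrite ?size_rev //; first exact: jump_rev.
  by rewrite subnKC ?(hole_per Hc) //; clear -ij; lia.
rewrite {u'}Eu {v'}Ev in J0; rewrite -sR0 in minJ.
have Hs := hole_shift Hc i; pose cs k := c (k + i).
have mem x : (x \in arc cs 0 (2 * l + 1)) = (x \in arc c 0 (2 * l + 1)) by apply: mem_shift.
have mem' : arc c 0 (2 * l + 1) =i arc cs 0 (2 * l + 1) by move=> x; rewrite mem.
(* The shift by d + 1 turns the indices 1, 2, 3 of [close_jump] into d + 2, d + 3, d + 4, which lie
   on the long arc and are not adjacent to its ends. *)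
have Hs2 := hole_shift Hs (d + 1).
apply: (close_jump Hs2) => i' v' R' hi J'.
have {}J' : jump cs (cs (i' + (d + 1))) v' R'.
  by apply: jump_ext J' => x; rewrite (mem_shift Hs).
have [_ vC _ _ _] := J'; have [t ht Et] := hole_idx Hs 0 vC.
apply: (@jp_false cs d R0 (i' + (d + 1)) R' t); split=> //.
- by clear -hi hd l5; lia.
- by have := jump_ext mem' J0; rewrite /cs add0n addnC.
- by rewrite Et in J'.
by move=> u' v2 R1 J1; apply: (minJ u' v2); apply: jump_ext J1.
Qed.

Lemma critical_false : False.
Proof. by have [c Hc] := exists_hole; exact: no_hole Hc. Qed.

End CriticalGraph.

(** * Minimal counterexamples *)

Section Induced.
Variables (T : finType) (e : rel T) (A : {set T}).
Let S := {x | x \in A}.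
Let eS : rel S := relpre val e.

Lemma graph_cycle_val (s : seq S) : graph_cycle eS s -> graph_cycle e (map val s).
Proof.
move=> [s2 /andP[cs us]]; split; first by rewrite size_map.
rewrite /ucycle (map_inj_uniq val_inj) us andbT.
by case: s cs {s2 us} => //= x s; rewrite -map_rcons path_map.
Qed.

Lemma induced_cycle_val (s : seq S) : induced_cycle eS s -> induced_cycle e (map val s).
Proof.
move=> [hs ch]; split; first exact: graph_cycle_val.
have /andP[_ us] := hs.2.
move=> _ _ /mapP[x xs ->] /mapP[y ys ->] exy; rewrite !(next_map val_inj us).
by case: (ch x y xs ys exy) => <-; [left | right].
Qed.
End Induced.

(** Having girth exactly n does not pass to induced subgraphs, whereas the lower bound and the
    condition on odd induced cycles do; this makes induction on the number of vertices possible. *)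
Lemma girth_colorable l : 5 <= l -> forall (T : finType) (e : rel T),
  symmetric e -> irreflexive e ->
  (forall s, graph_cycle e s -> 2 * l + 1 <= size s) ->
  (forall s, induced_cycle e s -> odd (size s) -> size s = 2 * l + 1) ->
  colorable e 3.
Proof.
move=> hl T; have [k] := ubnP #|T|; elim: k T => // k IH T Tk e sym irr hg ho.
(* Colourings as finite functions make colourability decidable, so that a minimal counterexample can
   be assumed. *)
pose good (f : {ffun T -> 'I_3}) := [forall x, forall y, e x y ==> (f x != f y)].
have [/existsP[f /forallP hf]|none] := boolP [exists f, good f].
  by exists f => x y exy; have /forallP/(_ y) := hf x; rewrite exy.
exfalso; apply: (critical_false sym irr hl hg ho) => [[f hf]|A AT].
  case/existsP: none; exists [ffun x => f x].
  by apply/forallP => x; apply/forallP => y; apply/implyP => /hf; rewrite !ffunE.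
have [|||||f hf] := IH {x | x \in A} _ (relpre val e).
- rewrite card_sig; apply: (@leq_trans #|T|); last by rewrite -ltnS.
  apply: proper_card; rewrite properE subset_predT /=.
  by apply: contra AT => /subsetP h; apply/eqP/setP => x; rewrite inE h.
- by move=> x y; rewrite /= sym.
- by move=> x; rewrite /= irr.
- by move=> s /graph_cycle_val/hg; rewrite size_map.
- by move=> s /induced_cycle_val hs os; have := ho _ hs; rewrite size_map; apply.
exists (fun x => if insub x is Some u then f u else ord0) => x y xA yA exy.
by rewrite !insubT; apply: hf.
Qed.

Theorem theorem1p3 (l : nat) (hl : 5 <= l) (T : finType) (e : rel T)
    (e_sym : symmetric e) (e_irr : irreflexive e)
    (e_girth : has_girth e (2 * l + 1))
    (e_no_odd_hole : forall c : seq T, odd_hole e c -> ~ (2 * l + 3 <= size c)) :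
  colorable e 3.
Proof.
have [_ hg] := e_girth.
apply: (girth_colorable hl) => // s hs os; have := hg s hs.1 => h.
(* An odd length that is at least n and less than n + 2 equals n. *)
have nlong : ~ (2 * l + 3 <= size s).
  by apply: e_no_odd_hole; split=> //; split=> //; clear -h hl; lia.
by clear -h nlong os; lia.
Qed.
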